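(* The achievable sensing-communication rate regions $\mathcal{C}_{\mathrm{isac}}$ and $\mathcal{C}_{\mathrm{fdsac}}$ of the NOMA-ISAC and NOMA-FDSAC systems, defined in the context, satisfy $\mathcal{C}_{\mathrm{fdsac}}\subseteq\mathcal{C}_{\mathrm{isac}}$.
   Context: Fix $p>0$, integers $M,L\ge1$, noise variances $\sigma_{\mathrm{c}}^2,\sigma_{\mathrm{s}}^2>0$, and power allocation factors $\alpha_{\mathrm{N}},\alpha_{\mathrm{F}}>0$ with $\alpha_{\mathrm{N}}+\alpha_{\mathrm{F}}=1$, $\alpha_{\mathrm{N}}<\alpha_{\mathrm{F}}$. In frequency-division sensing and communications (FDSAC), a fraction $\kappa\in[0,1]$ of the bandwidth and a fraction $\mu\in[0,1]$ of the power are used for communications, the rest for sensing; in integrated sensing and communications (ISAC) everything is shared. Communication rates. Let $h_1\sim\mathcal{CN}(0,\varrho_1)$, $h_2\sim\mathcal{CN}(0,\varrho_2)$ be independent, $\varrho_1,\varrho_2>0$, $|h_{\mathrm{N}}|=\max\{|h_1|,|h_2|\}$, $|h_{\mathrm{F}}|=\min\{|h_1|,|h_2|\}$. For $t\in\{\mathrm{i},\mathrm{f}\}$ put $\kappa_{\mathrm{i}}=\mu_{\mathrm{i}}=1$, $\kappa_{\mathrm{f}}=\kappa$, $\mu_{\mathrm{f}}=\mu$, and $$\gamma_t^{\mathrm{N}}=\frac{\mu_t p|h_{\mathrm{N}}|^2\alpha_{\mathrm{N}}}{\kappa_t\sigma_{\mathrm{c}}^2},\quad \gamma_t^{\mathrm{F}}=\frac{\mu_t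 p|h_{\mathrm{F}}|^2\alpha_{\mathrm{F}}}{\kappa_t\sigma_{\mathrm{c}}^2+\mu_t p|h_{\mathrm{F}}|^2\alpha_{\mathrm{N}}}.$$ The sum ergodic communication rate is $\mathcal{R}_t^{\mathrm{c}}=\mathbb{E}\{\kappa_t\log_2(1+\gamma_t^{\mathrm{N}})\}+\mathbb{E}\{\kappa_t\log_2(1+\gamma_t^{\mathrm{F}})\}$, with $\mathcal{R}_{\mathrm{f}}^{\mathrm{c}}=0$ when $\kappa=0$. Sensing rates. The target response vector is $\mathbf{g}=\sum_k\beta_k\mathbf{a}(\theta_k)\in\mathbb{C}^{M\times1}$, a finite sum with fixed vectors $\mathbf{a}(\theta_k)\in\mathbb{C}^{M\times 1}$ and independent $\beta_k\sim\mathcal{CN}(0,\sigma_k^2)$. The received echo is $\mathbf{Y}_{\mathrm{s}}=\mathbf{g}\mathbf{x}^{\mathsf{T}}+\mathbf{N}_{\mathrm{s}}\in\mathbb{C}^{M\times L}$ with waveform $\mathbf{x}\in\mathbb{C}^{L\times1}$, where $\mathbf{x},\mathbf{g},\mathbf{N}_{\mathrm{s}}$ are mutually independent, and $I(X;Y|Z)$ is conditional mutual information in bits. For ISAC: $\mathbf{x}^{\mathsf{T}}=\sqrt{p}\,[\sqrt{\alpha_{\mathrm{N}}},\sqrt{\alpha_{\mathrm{F}}}]\,\mathbf{S}$ with $\mathbf{S}\in\mathbb{C}^{2\times L}$, $\mathbf{S}\mathbf{S}^{\mathsf{H}}=L\mathbf{I}_2$; $\mathbf{N}_{\mathrm{s}}$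 has i.i.d. $\mathcal{CN}(0,\sigma_{\mathrm{s}}^2)$ entries; $\mathcal{R}_{\mathrm{i}}^{\mathrm{s}}=L^{-1}I(\mathbf{Y}_{\mathrm{s}};\mathbf{g}|\mathbf{x})$. For FDSAC: $\mathbf{x}^{\mathsf{H}}\mathbf{x}=(1-\mu)pL$; $\mathbf{N}_{\mathrm{s}}$ has i.i.d. $\mathcal{CN}(0,(1-\kappa)\sigma_{\mathrm{s}}^2)$ entries; $\mathcal{R}_{\mathrm{f}}^{\mathrm{s}}=\frac{1-\kappa}{L}I(\mathbf{Y}_{\mathrm{s}};\mathbf{g}|\mathbf{x})$, i.e. $\mathcal{R}_{\mathrm{f}}^{\mathrm{s}}=\frac{1-\kappa}{L}\log_2\det\left(\mathbf{I}_M+\frac{(1-\mu)pL}{(1-\kappa)\sigma_{\mathrm{s}}^2}\mathbb{E}\{\mathbf{g}\mathbf{g}^{\mathsf{H}}\}\right)$, with $\mathcal{R}_{\mathrm{f}}^{\mathrm{s}}=0$ when $\kappa=1$. Rate regions. $\mathcal{C}_{\mathrm{isac}}$ is the set of pairs $(\mathcal{R}^{\mathrm{s}},\mathcal{R}^{\mathrm{c}})$ with $\mathcal{R}^{\mathrm{s}}\in[0,\mathcal{R}_{\mathrm{i}}^{\mathrm{s}}]$ and $\mathcal{R}^{\mathrm{c}}\in[0,\mathcal{R}_{\mathrm{i}}^{\mathrm{c}}]$. $\mathcal{C}_{\mathrm{fdsac}}$ is the set of pairs $(\mathcal{R}^{\mathrm{s}},\mathcal{R}^{\mathrm{c}})$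 for which there exist $\kappa\in[0,1]$, $\mu\in[0,1]$ with $\mathcal{R}^{\mathrm{s}}\in[0,\mathcal{R}_{\mathrm{f}}^{\mathrm{s}}]$ and $\mathcal{R}^{\mathrm{c}}\in[0,\mathcal{R}_{\mathrm{f}}^{\mathrm{c}}]$ (both evaluated at the same $\kappa,\mu$). *)

(* Defs.v *)
From HB Require Import structures.
From mathcomp Require Import all_boot all_order all_algebra.
From mathcomp Require Export all_classical all_reals all_analysis.
From mathcomp.real_closed Require Export complex.

Set Implicit Arguments.
Unset Strict Implicit.
Unset Printing Implicit Defensive.

Import Order.TTheory GRing.Theory Num.Theory.
Import numFieldNormedType.Exports.

Local Open Scope classical_set_scope.
Local Open Scope ring_scope.
Local Open Scope complex_scope.

HB.instance Definition _ (R : realType) := isPointed.Build R[i] 0.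

Section complex_measurable.
Variable R : realType.

Definition complex_coords (z : R[i]) : R * R := (complex.Re z, complex.Im z).

(* Borel sets of the complex plane, through the identification with R * R *)
Definition complex_measurable : set_system R[i] :=
  preimage_set_system setT complex_coords measurable.

Let complex_sigma_algebra : sigma_algebra setT complex_measurable.
Proof. by apply: sigma_algebra_preimage; exact: sigma_algebra_measurable. Qed.

Let complex_measurable0 : complex_measurable set0.
Proof. by case: complex_sigma_algebra. Qed.

Let complex_measurableC A : complex_measurable A -> complex_measurable (~` A).
Proof. by case: complex_sigma_algebra => _ + _ => /[apply]; rewrite setTD. Qed.

Let complex_measurableU (F : (set R[i])^nat) :
  (forall i, complex_measurable (F i)) -> complex_measurable (\bigcup_i (F i)).
Proof. by case: complex_sigma_algebra => _ _; exact. Qed.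

Fact complex_display : measure_display. Proof. exact. Qed.

HB.instance Definition _ := @isMeasurable.Build complex_display R[i]
  complex_measurable complex_measurable0 complex_measurableC complex_measurableU.

End complex_measurable.

Section matrix_measurable.
Context d (T : measurableType d) (m n : nat).

(* product sigma-algebra on matrices, generated by the entries *)
Definition matrix_measurable : set_system 'M[T]_(m, n) :=
  <<s [set (fun A : 'M[T]_(m, n) => A ij.1 ij.2) @^-1` B |
        ij in [set: 'I_m * 'I_n] & B in measurable] >>.

Let matrix_measurable0 : matrix_measurable set0.
Proof. exact: sigma_algebra0. Qed.

Let matrix_measurableC A : matrix_measurable A -> matrix_measurable (~` A).
Proof. exact: sigma_algebraC. Qed.

Let matrix_measurableU (F : (set 'M[T]_(m, n))^nat) :
  (forall i, matrix_measurable (F i)) -> matrix_measurable (\bigcup_i (F i)).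
Proof. exact: sigma_algebra_bigcup. Qed.

HB.instance Definition _ := @isMeasurable.Build (measure_tuple_display d)
  'M[T]_(m, n) matrix_measurable
  matrix_measurable0 matrix_measurableC matrix_measurableU.

End matrix_measurable.

Section projections.
Context d1 d2 (T1 : measurableType d1) (T2 : measurableType d2).

HB.instance Definition _ :=
  @isMeasurableFun.Build _ _ (T1 * T2)%type T1 fst measurable_fst.
HB.instance Definition _ :=
  @isMeasurableFun.Build _ _ (T1 * T2)%type T2 snd measurable_snd.

End projections.

Section independence.
Context d (T : measurableType d) (R : realType) (P : probability T R).

Definition sigma_of d' (U : measurableType d') (X : T -> U) : set_system T :=
  preimage_set_system setT X measurable.

Definition mutually_independent (I : finType) (F : I -> set_system T) : Prop :=
  forall (J : {set I}) (E : I -> set T), (forall i, i \in J -> F i (E i)) ->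
    P (\bigcap_(i in [set` J]) E i) = (\prod_(i in J) P (E i))%E.

End independence.

Section gaussian.
Context d (T : measurableType d) (R : realType) (P : probability T R).

(* [normal_prob 0 0] is not the Dirac mass at 0 in the library, hence the
   case distinction. *)
Definition normal_law (X : T -> R) (v : R) : Prop :=
  forall A : set R, measurable A ->
    P (X @^-1` A) = if v == 0 then \d_(0 : R) A else normal_prob 0 (Num.sqrt v) A.

(* circularly symmetric complex Gaussian CN(0, v) *)
Definition complex_normal_law (Z : T -> R[i]) (v : R) : Prop :=
  let X t := complex.Re (Z t) in
  let Y t := complex.Im (Z t) in
  [/\ normal_law X (v / 2), normal_law Y (v / 2) &
      mutually_independent P (tnth [tuple sigma_of X; sigma_of Y])].

Definition white_noise (m n : nat) (N : T -> 'M[R[i]]_(m, n)) (v : R) : Prop :=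
  (forall i j, complex_normal_law (fun t => N t i j) v) /\
  mutually_independent P
    (fun ij : 'I_m * 'I_n => sigma_of (fun t => N t ij.1 ij.2)).

End gaussian.

Section information.
Context (R : realType).

Definition log2 (x : R) : R := ln x / ln 2.

Local Open Scope charge_scope.

(* Kullback-Leibler divergence, in bits *)
Definition relative_entropy d (T : measurableType d) (mu : probability T R)
    (nu : {sigma_finite_measure set T -> \bar R}) : \bar R :=
  if `[< mu `<< nu >] then
    (\int[mu]_w (log2 (fine (('d (charge_of_finite_measure mu) '/d nu) w)))%:E)%E
  else +oo%E.

Local Close Scope charge_scope.

Context d1 d2 (T1 : measurableType d1) (T2 : measurableType d2).

Definition product_law (mu : probability T1 R) (nu : probability T2 R) :
  probability (T1 * T2)%type R := (mu \x nu)%E.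

(* mutual information of the two components of a pair with law J *)
Definition mutual_info (J : probability (T1 * T2)%type R) : \bar R :=
  relative_entropy J (product_law
    (distribution J (fst : {mfun (T1 * T2)%type >-> T1}))
    (distribution J (snd : {mfun (T1 * T2)%type >-> T2}))).

Context d d3 (T : measurableType d) (T3 : measurableType d3).
Variable P : probability T R.

Definition conditional_law d4 (T4 : measurableType d4) (W : T -> T4)
    (Z : T -> T3) (k : T3 -> pprobability T4 R) : Prop :=
  measurable_fun setT k /\
  forall A B, measurable A -> measurable B ->
    P (W @^-1` A `&` Z @^-1` B) = (\int[P]_(t in Z @^-1` B) k (Z t) A)%E.

(* I(X; Y | Z), the expectation over Z of the mutual information of the
   conditional law of (X, Y) given Z; when the sigma-algebras of T1 and T2 are
   countably generated it does not depend on the version k. *)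
Definition cond_mutual_info (X : T -> T1) (Y : T -> T2) (Z : T -> T3) : \bar R :=
  xget 0%E [set i | exists2 k : T3 -> pprobability (T1 * T2)%type R,
    conditional_law (fun t => (X t, Y t)) Z k &
    i = (\int[P]_t mutual_info (k (Z t)))%E].

End information.

Section communication.
Context d (T : measurableType d) (R : realType) (P : probability T R).
Variables (p vc aN aF : R) (h1 h2 : T -> R[i]).

Definition abs_hN (t : T) : R := Num.max (Normc.normc (h1 t)) (Normc.normc (h2 t)).
Definition abs_hF (t : T) : R := Num.min (Normc.normc (h1 t)) (Normc.normc (h2 t)).

Variables kappa mu : R.

Definition gammaN (t : T) : R := mu * p * abs_hN t ^+ 2 * aN / (kappa * vc).
Definition gammaF (t : T) : R :=
  mu * p * abs_hF t ^+ 2 * aF / (kappa * vc + mu * p * abs_hF t ^+ 2 * aN).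

Definition comm_rate : \bar R :=
  if kappa == 0 then 0%E
  else ('E_P[fun t => (kappa * log2 (1 + gammaN t))%R] +
        'E_P[fun t => (kappa * log2 (1 + gammaF t))%R])%E.

End communication.

Section sensing.
Context d (T : measurableType d) (R : realType) (P : probability T R).

Definition conj_tr (m n : nat) (A : 'M[R[i]]_(m, n)) : 'M[R[i]]_(n, m) :=
  map_mx (@conjc R) A^T.

Definition target_response (M K : nat) (a : 'I_K -> 'cV[R[i]]_M)
    (beta : 'I_K -> T -> R[i]) (t : T) : 'cV[R[i]]_M :=
  \sum_k beta k t *: a k.

Definition echo (M L : nat) (g : T -> 'cV[R[i]]_M) (x : T -> 'cV[R[i]]_L)
    (N : T -> 'M[R[i]]_(M, L)) (t : T) : 'M[R[i]]_(M, L) :=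
  g t *m (x t)^T + N t.

Definition isac_waveform (L : nat) (p aN aF : R) (S : T -> 'M[R[i]]_(2, L))
    (t : T) : 'cV[R[i]]_L :=
  ((Num.sqrt p)%:C *:
    ((\row_(j < 2) (if j == 0 then Num.sqrt aN else Num.sqrt aF)%:C) *m S t))^T.

Definition isac_sensing_rate (M L : nat) (g : T -> 'cV[R[i]]_M)
    (x : T -> 'cV[R[i]]_L) (N : T -> 'M[R[i]]_(M, L)) : \bar R :=
  ((L%:R^-1)%:E * cond_mutual_info P (echo g x N) g x)%E.

Definition fdsac_sensing_rate (M L : nat) (g : T -> 'cV[R[i]]_M)
    (kappa : R) (x : T -> 'cV[R[i]]_L) (N : T -> 'M[R[i]]_(M, L)) : \bar R :=
  if kappa == 1 then 0%E
  else (((1 - kappa) / L%:R)%:E * cond_mutual_info P (echo g x N) g x)%E.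

Definition echo_independent (M L : nat) (g : T -> 'cV[R[i]]_M)
    (x : T -> 'cV[R[i]]_L) (N : T -> 'M[R[i]]_(M, L)) : Prop :=
  mutually_independent P (tnth [tuple sigma_of x; sigma_of g; sigma_of N]).

End sensing.

Section regions.
Context (R : realType).

Definition rate_rectangle (Rs Rc : \bar R) : set (R * R) :=
  [set r | [/\ 0 <= r.1, (r.1%:E <= Rs)%E, 0 <= r.2 & (r.2%:E <= Rc)%E]].

Context d (T : measurableType d) (P : probability T R).
Variables (p vc aN aF : R) (h1 h2 : T -> R[i]).
Variables (M L : nat) (g : T -> 'cV[R[i]]_M).

Definition isac_region (S : T -> 'M[R[i]]_(2, L)) (N : T -> 'M[R[i]]_(M, L)) :
    set (R * R) :=
  rate_rectangle (isac_sensing_rate P g (isac_waveform p aN aF S) N)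
                 (comm_rate P p vc aN aF h1 h2 1 1).

(* x kappa mu and N kappa mu are the waveform and the noise of the system using
   the fractions kappa of the bandwidth and mu of the power to communicate. *)
Definition fdsac_region (x : R -> R -> T -> 'cV[R[i]]_L)
    (N : R -> R -> T -> 'M[R[i]]_(M, L)) : set (R * R) :=
  [set r | exists kappa mu : R, [/\ 0 <= kappa <= 1, 0 <= mu <= 1 &
    rate_rectangle (fdsac_sensing_rate P g kappa (x kappa mu) (N kappa mu))
                   (comm_rate P p vc aN aF h1 h2 kappa mu) r]].

End regions.

(* Main.v *)
(* The mutual information between the echo and g only depends on the ratio
   s = |x|^2 / v of the waveform energy to the noise variance: correlating the
   echo with the waveform preserves the likelihood of g, and leaves the channel
   u = s g + n with n of law CN(0, s I). With lik_s(u, g) = exp(2 Re<g, u> - s |g|^2)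
   the likelihood ratio with respect to pure noise, and mix_s(u) its average over g,
   the information in nats is
     F(s) = s E|g|^2 - E[mix_s(n) ln mix_s(n)].
   The channel at s + a is made of the channel at s and of an independent channel
   at a, whence F(s + (a + b)) + F(s) <= F(s + a) + F(s + b) by Gibbs' inequality.
   As F is also nonnegative, it is nondecreasing and F(s) / s is nonincreasing, so
   that t F(s') <= F(s) as soon as 0 <= t <= 1 and t s' <= s. The sensing rates are
   compared by taking t = 1 - kappa, s' = (1 - mu) p L / ((1 - kappa) vs) and
   s = p L / vs. Only E|g|^2 < +oo is used of the law of g, and determinants never
   appear. The communication rates are compared pointwise, by the concavity of ln. *)
Require Import Defs.
From HB Require Import structures.
From mathcomp Require Import all_boot all_order all_algebra.
From mathcomp Require Import all_classical all_reals all_analysis.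
From mathcomp Require Import measurable_realfun.
From mathcomp Require Import ring lra.
From mathcomp.real_closed Require Import complex.

Set Implicit Arguments.
Unset Strict Implicit.
Unset Printing Implicit Defensive.

Import Order.TTheory GRing.Theory Num.Theory.
Import numFieldNormedType.Exports.

Local Open Scope classical_set_scope.
Local Open Scope ring_scope.
Local Open Scope complex_scope.

(** * Measurability of complex matrices *)

(** The laws [gam s] enter the channel part only through their behaviour under shifts, sums and
    change of sign. They are realised as the laws of the ISAC noise filtered by a waveform of energy
    [s * vs], and this one family serves both systems. The sensing rates are defined by a
    conditional law of which [cond_mutual_info] selects an unknown version. Two versions agree
    almost surely on all events at once, and the waveform energy is constant, so what has to be
    integrated is almost surely a constant. The submodularity rests on a martingale: likelihoods of
    independent observations multiply, so under pure noise [mix] at the accumulated sum keeps its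
    mean as observations are added. Hence every partial sum of the observations has the expected
    density, and signed integrals are moved between spaces by [same_law]. Submodularity yields
    concavity along arithmetic progressions only. The comparison of [F(s) / s] at two arbitrary
    points is reached from there by refining the step, with no derivative of [F]. *)

Section complex_measurability.
Context {R : realType} d (T : measurableType d).
Implicit Types f g : T -> R[i].

Lemma measurable_complex_coords :
  measurable_fun [set: R[i]] (@complex_coords R).
Proof. by move=> _ B mB; exists B. Qed.

Lemma measurable_Re : measurable_fun [set: R[i]] (@complex.Re R).
Proof.
exact: (measurableT_comp (f := fst) measurable_fst measurable_complex_coords).
Qed.

Lemma measurable_Im : measurable_fun [set: R[i]] (@complex.Im R).
Proof.
exact: (measurableT_comp (f := snd) measurable_snd measurable_complex_coords).
Qed.

Lemma measurable_fun_complex f :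
  measurable_fun setT (fun t => complex.Re (f t)) ->
  measurable_fun setT (fun t => complex.Im (f t)) -> measurable_fun setT f.
Proof.
move=> mRe mIm _ _ [B mB <-].
have /(_ measurableT _ mB) := measurable_fun_pair mRe mIm.
by rewrite !setTI.
Qed.

Lemma measurable_fun_Re f : measurable_fun setT f ->
  measurable_fun setT (fun t => complex.Re (f t)).
Proof. by move=> mf; exact: (measurableT_comp measurable_Re mf). Qed.

Lemma measurable_fun_Im f : measurable_fun setT f ->
  measurable_fun setT (fun t => complex.Im (f t)).
Proof. by move=> mf; exact: (measurableT_comp measurable_Im mf). Qed.

Lemma measurable_fun_addC f g : measurable_fun setT f ->
  measurable_fun setT g -> measurable_fun setT (fun t => f t + g t).
Proof.
move=> mf mg; apply: measurable_fun_complex.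
  rewrite (_ : (fun t => _) =
    (fun t => complex.Re (f t)) \+ (fun t => complex.Re (g t))).
    by apply: measurable_funD; exact: measurable_fun_Re.
  by apply/funext => t /=; case: (f t) (g t) => ? ? [].
rewrite (_ : (fun t => _) =
  (fun t => complex.Im (f t)) \+ (fun t => complex.Im (g t))).
  by apply: measurable_funD; exact: measurable_fun_Im.
by apply/funext => t /=; case: (f t) (g t) => ? ? [].
Qed.

Lemma measurable_fun_mulC f g : measurable_fun setT f ->
  measurable_fun setT g -> measurable_fun setT (fun t => f t * g t).
Proof.
move=> mf mg; apply: measurable_fun_complex.
  rewrite (_ : (fun t => _) =
    ((fun t => complex.Re (f t)) \* (fun t => complex.Re (g t))) \-
    ((fun t => complex.Im (f t)) \* (fun t => complex.Im (g t)))).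
    apply: measurable_funB; apply: measurable_funM;
      do ?[exact: measurable_fun_Re|exact: measurable_fun_Im].
  by apply/funext => t /=; case: (f t) (g t) => ? ? [].
rewrite (_ : (fun t => _) =
    ((fun t => complex.Re (f t)) \* (fun t => complex.Im (g t))) \+
    ((fun t => complex.Im (f t)) \* (fun t => complex.Re (g t)))).
  apply: measurable_funD; apply: measurable_funM;
      do ?[exact: measurable_fun_Re|exact: measurable_fun_Im].
by apply/funext => t /=; case: (f t) (g t) => ? ? [].
Qed.

Lemma measurable_fun_conjC f : measurable_fun setT f ->
  measurable_fun setT (fun t => conjc (f t)).
Proof.
move=> mf; apply: measurable_fun_complex.
  rewrite (_ : (fun t => _) = (fun t => complex.Re (f t))).
    exact: measurable_fun_Re.
  by apply/funext => t /=; case: (f t).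
rewrite (_ : (fun t => _) = \- (fun t => complex.Im (f t))).
  by apply: measurable_funN; exact: measurable_fun_Im.
by apply/funext => t /=; case: (f t).
Qed.

Lemma measurable_fun_sumC (I : Type) (s : seq I) (h : I -> T -> R[i]) :
  (forall i, measurable_fun setT (h i)) ->
  measurable_fun setT (fun t => \sum_(i <- s) h i t).
Proof.
move=> mh; elim: s => [|i s IH].
  by under eq_fun do rewrite big_nil; exact: measurable_cst.
by under eq_fun do rewrite big_cons; exact: measurable_fun_addC.
Qed.

End complex_measurability.

Section matrix_measurability.
Context {R : realType} d (T : measurableType d).

Lemma measurable_entry d' (U : measurableType d') m n (i : 'I_m) (j : 'I_n) :
  measurable_fun [set: 'M[U]_(m, n)] (fun A => A i j).
Proof.
move=> _ B mB; rewrite setTI; apply: sub_sigma_algebra.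
by exists (i, j) => //; exists B.
Qed.

Lemma measurable_fun_entry d' (U : measurableType d') m n (f : T -> 'M[U]_(m, n))
  i j : measurable_fun setT f -> measurable_fun setT (fun t => f t i j).
Proof. by move=> mf; exact: (measurableT_comp (measurable_entry i j) mf). Qed.

Lemma measurable_fun_mx d' (U : measurableType d') m n (f : T -> 'M[U]_(m, n)) :
  (forall i j, measurable_fun setT (fun t => f t i j)) -> measurable_fun setT f.
Proof.
move=> mf; apply: (@measurability _ _ _ _ setT f
  [set (fun A : 'M[U]_(m, n) => A ij.1 ij.2) @^-1` B |
        ij in [set: 'I_m * 'I_n] & B in measurable]) => //.
move=> _ [_ [[i j] _ [B mB <-]] <-].
exact: (mf i j measurableT).
Qed.

Lemma measurable_fun_addmx m n (f g : T -> 'M[R[i]]_(m, n)) :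
  measurable_fun setT f -> measurable_fun setT g ->
  measurable_fun setT (fun t => f t + g t).
Proof.
move=> mf mg; apply: measurable_fun_mx => i j; under eq_fun do rewrite mxE.
by apply: measurable_fun_addC; exact: measurable_fun_entry.
Qed.

Lemma measurable_fun_mulmx m n p (f : T -> 'M[R[i]]_(m, n))
    (g : T -> 'M[R[i]]_(n, p)) :
  measurable_fun setT f -> measurable_fun setT g ->
  measurable_fun setT (fun t => f t *m g t).
Proof.
move=> mf mg; apply: measurable_fun_mx => i j; under eq_fun do rewrite mxE.
by apply: measurable_fun_sumC => k; apply: measurable_fun_mulC;
  exact: measurable_fun_entry.
Qed.

Lemma measurable_fun_trmx m n (f : T -> 'M[R[i]]_(m, n)) :
  measurable_fun setT f -> measurable_fun setT (fun t => (f t)^T).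
Proof.
move=> mf; apply: measurable_fun_mx => i j; under eq_fun do rewrite mxE.
exact: measurable_fun_entry.
Qed.

Lemma measurable_fun_scalemx m n (a : T -> R[i]) (f : T -> 'M[R[i]]_(m, n)) :
  measurable_fun setT a -> measurable_fun setT f ->
  measurable_fun setT (fun t => a t *: f t).
Proof.
move=> ma mf; apply: measurable_fun_mx => i j; under eq_fun do rewrite mxE.
by apply: measurable_fun_mulC => //; exact: measurable_fun_entry.
Qed.

End matrix_measurability.

(** * Gaussian integrals *)

Section density.
Context d (T : measurableType d) (R : realType).
Variables nu mu : {measure set T -> \bar R}.
Variable p : T -> R.
Hypotheses (mp : measurable_fun setT p) (p0 : forall x, 0 <= p x).
Hypothesis nuE :
  forall A, measurable A -> nu A = (\int[mu]_(x in A) (p x)%:E)%E.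
Local Open Scope ereal_scope.
Import HBNNSimple.

Let nu_nnsfun (h : {nnsfun T >-> R}) :
  \int[nu]_x (h x)%:E = \int[mu]_x ((h x)%:E * (p x)%:E).
Proof.
under [in RHS]eq_integral => x _.
  rewrite fimfunE -fsumEFin// ge0_mule_fsuml; last first.
    by move=> y; exact: nnfun_muleindic_ge0.
  over.
rewrite ge0_integral_fsum//; last 2 first.
  - move=> y; apply: emeasurable_funM; last exact/measurable_EFinP.
    by apply/measurable_EFinP; exact: measurable_funM.
  - by move=> y x _; apply: mule_ge0; rewrite ?lee_fin//; exact: nnfun_muleindic_ge0.
under eq_integral do rewrite fimfunE -fsumEFin//.
rewrite ge0_integral_fsum//; last 2 first.
  - by move=> y; apply/measurable_EFinP; exact: measurable_funM.
  - by move=> y x _; exact: nnfun_muleindic_ge0.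
apply: eq_fsbigr => r /[!inE] -[t _ ht].
rewrite integralZl_indic_nnsfun// integral_indic// setIT nuE//.
under [in RHS]eq_integral do rewrite EFinM -muleA.
rewrite ge0_integralZl//; last 3 first.
  - apply: emeasurable_funM; last exact/measurable_EFinP.
    exact/measurable_EFinP.
  - by move=> x _; rewrite mule_ge0 ?lee_fin.
  - by rewrite -ht lee_fin.
congr (_ * _).
under [in RHS]eq_integral do rewrite muleC.
rewrite integral_mkcond; apply: eq_integral => x _.
by rewrite epatch_indic.
Qed.

(** Simple functions are settled by [nuE] on their level sets; monotone convergence along
    [nnsfun_approx] does the rest. *)
Lemma ge0_integral_density (f : T -> \bar R) : measurable_fun setT f ->
  (forall x, 0 <= f x) -> \int[nu]_x f x = \int[mu]_x (f x * (p x)%:E).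
Proof.
move=> mf f0; pose h := nnsfun_approx measurableT mf.
have hf x : (h n x)%:E @[n --> \oo] --> f x by exact: cvg_nnsfun_approx.
have h_nd x (m n : nat) : (m <= n)%N -> (h m x)%:E <= (h n x)%:E.
  by move=> mn; rewrite lee_fin; exact/lefP/nd_nnsfun_approx.
transitivity (limn (fun n => \int[nu]_x (h n x)%:E)).
  rewrite -monotone_convergence//.
  - by apply: eq_integral => x _; apply/esym/cvg_lim => //; exact: hf.
  - by move=> n; exact/measurable_EFinP.
  - by move=> n x _; rewrite lee_fin.
  - by move=> x _ m n mn; exact: h_nd.
under eq_fun do rewrite nu_nnsfun.
rewrite -monotone_convergence//.
- by apply: eq_integral => x _; apply/cvg_lim => //; exact: cvgeZr.
- by move=> n; apply: emeasurable_funM; exact/measurable_EFinP.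
- by move=> n x _; rewrite mule_ge0 ?lee_fin.
- by move=> x _ m n mn; apply: lee_wpmul2r; rewrite ?lee_fin//; exact: h_nd.
Qed.

End density.

Section lebesgue_affine.
Context {R : realType}.
Local Open Scope ereal_scope.
Notation lambda := (@lebesgue_measure R).

(** The image of Lebesgue measure under [x => c * x + b], scaled by [c], gives half-open intervals
    their length, and this characterises Lebesgue measure. *)
Lemma ge0_integral_lebesgue_affine (c b : R) (f : R -> \bar R) : (0 < c)%R ->
  measurable_fun setT f -> (forall x, 0 <= f x) ->
  c%:E * \int[lambda]_x f (c * x + b)%R = \int[lambda]_x f x.
Proof.
move=> c0 mf f0.
have mphi : measurable_fun setT
    (fun x : measurableTypeR R => (c * x + b)%R : measurableTypeR R).
  by apply: measurable_funD => //; apply: measurable_funM.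
have c0' : (0 <= c)%R by exact: ltW.
pose cn := NngNum c0'.
transitivity (c%:E *
    \int[pushforward lambda (fun x => (c * x + b)%R : measurableTypeR R)]_x f x).
  by rewrite ge0_integral_pushforward.
rewrite -[c in LHS]/(cn%:num).
rewrite -ge0_integral_mscale//.
apply: eq_measure_integral => A mA _.
apply/esym/lebesgue_measure_unique => // _ [[x y] /= xy <-].
rewrite /mscale/= /pushforward /=.
rewrite (_ : _ @^-1` _ = `](x - b) / c, (y - b) / c]%classic)%R; last first.
  apply/seteqP; split => z /=; rewrite !in_itv/=.
    by rewrite ltr_pdivrMr// ler_pdivlMr// ltrBlDr lerBrDr mulrC.
  by rewrite ltr_pdivrMr// ler_pdivlMr// ltrBlDr lerBrDr mulrC.
rewrite !lebesgue_measure_itv/= !lte_fin ltr_pM2r ?invr_gt0// ltrD2r.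
case: ifPn => _; last by rewrite mule0.
rewrite -!EFinD -EFinM; congr EFin.
field. by rewrite gt_eqF.
Qed.

Lemma ge0_integral_lebesgueN (f : R -> \bar R) : 
  measurable_fun setT f -> (forall x, 0 <= f x) ->
  \int[lambda]_x f (- x)%R = \int[lambda]_x f x.
Proof.
move=> mf f0.
transitivity (\int[pushforward lambda (-%R : _ -> measurableTypeR R)]_x f x).
  by rewrite ge0_integral_pushforward.
by apply: eq_measure_integral => A mA _; exact: lebesgue_measureN.
Qed.

End lebesgue_affine.

(** * Rotations of the plane, and rotations and shifts of Gaussian measures *)

Section plane.
Context {R : realType}.
Local Open Scope ereal_scope.
Notation lambda := (@lebesgue_measure R).

Let I2 (F : R * R -> \bar R) := \int[lambda]_x \int[lambda]_y F (x, y).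

Let I2_swap F : measurable_fun setT F -> (forall z, 0 <= F z) ->
  I2 F = \int[lambda]_y \int[lambda]_x F (x, y).
Proof.
by move=> mF F0; have := @fubini_tonelli _ _ _ _ _ lambda lambda F mF F0.
Qed.

Let I2_shear1 (a : R) F : measurable_fun setT F -> (forall z, 0 <= F z) ->
  I2 (fun z : R * R => F (z.1 + a * z.2, z.2)%R) = I2 F.
Proof.
move=> mF F0.
have mF1 : measurable_fun setT (fun z : R * R => F (z.1 + a * z.2, z.2)%R).
  apply: (measurableT_comp mF).
  by apply: measurable_fun_pair => //; apply: measurable_funD => //;
    apply: measurable_funM.
rewrite (I2_swap mF1 (fun=> F0 _)) (I2_swap mF F0); apply: eq_integral => y _.
rewrite -(@ge0_integral_lebesgue_affine _ 1%R (a * y)%R (fun x => F (x, y)))//.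
  by rewrite mul1e; apply: eq_integral => x _ /=; rewrite mul1r.
exact: measurable_fun_pair1.
Qed.

Let I2_shear2 (a : R) F : measurable_fun setT F -> (forall z, 0 <= F z) ->
  I2 (fun z : R * R => F (z.1, z.2 + a * z.1)%R) = I2 F.
Proof.
move=> mF F0; apply: eq_integral => x _.
rewrite -(@ge0_integral_lebesgue_affine _ 1%R (a * x)%R (fun y => F (x, y)))//.
  by rewrite mul1e; apply: eq_integral => y _ /=; rewrite mul1r.
exact: measurable_fun_pair2.
Qed.

Let I2_opp F : measurable_fun setT F -> (forall z, 0 <= F z) ->
  I2 (fun z => F (- z.1, - z.2)%R) = I2 F.
Proof.
move=> mF F0.
have mG : measurable_fun setT (fun x => \int[lambda]_y F (x, y)).
  exact: (measurable_fun_fubini_tonelli_F (m2 := lambda)).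
apply: etrans (ge0_integral_lebesgueN mG _); last by move=> x; exact: integral_ge0.
apply: eq_integral => x _ /=.
rewrite -(ge0_integral_lebesgueN (f := fun y => F ((- x)%R, y)))//.
exact: measurable_fun_pair2.
Qed.

(** For an angle [theta] with cosine [c] and sine [s], the rotation is a product of three shears,
    with [a = - tan (theta / 2)]; a shear translates each line, so Fubini and translation invariance
    handle it. The half turn is not such a product and falls to [I2_opp]. *)
Let I2_rot (c s : R) F : (c ^+ 2 + s ^+ 2 = 1)%R ->
  measurable_fun setT F -> (forall z, 0 <= F z) ->
  I2 (fun z => F (c * z.1 - s * z.2, s * z.1 + c * z.2)%R) = I2 F.
Proof.
move=> cs mF F0.
have [c1|c1] := eqVneq (1 + c)%R 0%R.
  have -> : c = (-1)%R by lra.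
  have -> : s = 0%R by apply/eqP; rewrite -sqrf_eq0; apply/eqP; nra.
  apply: etrans (I2_opp mF F0); congr I2; apply/funext => z /=.
  by congr (F (_, _)); ring.
pose a := (- s / (1 + c))%R.
have mshear1 : measurable_fun setT (fun z : R * R => (z.1 + a * z.2, z.2)%R).
  by apply: measurable_fun_pair => //; apply: measurable_funD => //;
    apply: measurable_funM.
have mshear2 : measurable_fun setT (fun z : R * R => (z.1, z.2 + s * z.1)%R).
  by apply: measurable_fun_pair => //; apply: measurable_funD => //;
    apply: measurable_funM.
have mF1 : measurable_fun setT (fun z : R * R => F (z.1 + a * z.2, z.2)%R).
  exact: (measurableT_comp mF mshear1).
have mF2 := measurableT_comp mF1 mshear2.
transitivity (I2 (fun z : R * R => F (z.1 + a * z.2, z.2)%R)); last exact: I2_shear1.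
apply: etrans (I2_shear2 s mF1 (fun=> F0 _)).
apply: etrans (I2_shear1 a mF2 (fun=> F0 _)).
congr I2; apply/funext => z /=; congr (F (_, _)).
  have -> : c = (1 + a * s)%R.
    by rewrite /a; apply: (mulIf c1); rewrite mulrDl mulrAC mulrVK ?unitfE//; nra.
  have e2 : (- s = 2 * a + a * a * s)%R.
    rewrite /a; apply: (mulIf (mulf_neq0 c1 c1)).
    transitivity (- s * (1 + c) * (1 + c))%R; first ring.
    transitivity (- 2 * s * (1 + c) + s * s * s)%R; last by field.
    have -> : (s * s * s = s * (1 - c ^+ 2))%R by rewrite -cs; ring.
    ring.
  rewrite -mulNr e2; ring.
have -> : c = (1 + a * s)%R.
  by rewrite /a; apply: (mulIf c1); rewrite mulrDl mulrAC mulrVK ?unitfE//; nra.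
ring.
Qed.

Notation gauss := (@normal_prob R 0 1).

Lemma ge0_integral_gauss (f : R -> \bar R) : measurable_fun setT f ->
  (forall x, 0 <= f x) ->
  \int[gauss]_x f x = \int[lambda]_x (f x * (normal_pdf 0 1 x)%:E).
Proof.
move=> mf f0; apply: ge0_integral_density => //.
  exact: measurable_normal_pdf.
by move=> x; exact: normal_pdf_ge0.
Qed.

Lemma gauss_pdfE (x : R) :
  normal_pdf 0 1 x = (normal_peak 1 * expR (- (x ^+ 2 / 2)))%R.
Proof.
by rewrite normal_pdfE ?oner_neq0// /normal_fun subr0 expr1n mulr2n mulNr.
Qed.

(** The product density is a function of [x ^+ 2 + y ^+ 2], which a rotation preserves. *)
Lemma gauss_rotation (c s : R) (f : R * R -> \bar R) :
  (c ^+ 2 + s ^+ 2 = 1)%R -> measurable_fun setT f -> (forall z, 0 <= f z) ->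
  \int[gauss]_x \int[gauss]_y f (c * x - s * y, s * x + c * y)%R =
  \int[gauss]_x \int[gauss]_y f (x, y).
Proof.
move=> cs mf f0.
pose F z := f z * (normal_pdf 0 1 z.1 * normal_pdf 0 1 z.2)%:E.
have I2E g : measurable_fun setT g -> (forall z, 0 <= g z) ->
    \int[gauss]_x \int[gauss]_y g (x, y) =
    I2 (fun z => g z * (normal_pdf 0 1 z.1 * normal_pdf 0 1 z.2)%:E).
  move=> mg g0; rewrite ge0_integral_gauss//; last first.
  - by move=> x; exact: integral_ge0.
  - exact: (measurable_fun_fubini_tonelli_F (m2 := gauss)).
  apply: eq_integral => x _; rewrite ge0_integral_gauss//; last first.
    exact: measurable_fun_pair2.
  rewrite muleC -ge0_integralZl//.
  - by apply: eq_integral => y _ /=; rewrite muleCA EFinM.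
  - apply: emeasurable_funM; first exact: measurable_fun_pair2.
    by apply/measurable_EFinP; exact: measurable_normal_pdf.
  - by move=> y _; rewrite mule_ge0// lee_fin normal_pdf_ge0.
  - by rewrite lee_fin normal_pdf_ge0.
have mrot : measurable_fun setT
    (fun z : R * R => (c * z.1 - s * z.2, s * z.1 + c * z.2)%R).
  by apply: measurable_fun_pair; [apply: measurable_funB|apply: measurable_funD];
    apply: measurable_funM.
rewrite (I2E (fun z => f (c * z.1 - s * z.2, s * z.1 + c * z.2)%R))//; last first.
  exact: measurableT_comp.
rewrite (I2E f mf f0); apply: etrans (I2_rot cs _ _).
- congr I2; apply/funext => z /=; congr (_ * _%:E).
  rewrite !gauss_pdfE mulrACA -expRD [RHS]mulrACA -expRD; congr (_ * expR _)%R.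
  rewrite -!opprD -!mulrDl; congr (- (_ / _))%R.
  by rewrite -[LHS]mul1r -cs; ring.
- apply: emeasurable_funM => //; apply/measurable_EFinP; apply: measurable_funM;
    apply: measurableT_comp => //; exact: measurable_normal_pdf.
- by move=> z; rewrite mule_ge0// lee_fin mulr_ge0// normal_pdf_ge0.
Qed.

(** Cameron-Martin formula in dimension one, obtained by expanding the square in the shifted
    density. *)
Lemma gauss_shift (h : R) (f : R -> \bar R) : measurable_fun setT f ->
  (forall x, 0 <= f x) ->
  \int[gauss]_x f (x + h)%R =
  \int[gauss]_x (f x * (expR (h * x - h ^+ 2 / 2))%:E).
Proof.
move=> mf f0.
rewrite ge0_integral_gauss//; last first.
  by apply: (measurableT_comp mf); exact: measurable_funD.
rewrite [RHS]ge0_integral_gauss//; last 2 first.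
- apply: emeasurable_funM => //; apply/measurable_EFinP; apply: measurableT_comp => //.
  by apply: measurable_funB => //; exact: measurable_funM.
- by move=> x; rewrite mule_ge0// lee_fin expR_ge0.
rewrite -[RHS](@ge0_integral_lebesgue_affine _ 1 h)//.
- rewrite mul1e; apply: eq_integral => x _; rewrite mul1r -muleA; congr (_ * _).
  rewrite -EFinM !gauss_pdfE mulrCA -expRD; congr (_ * expR _)%:E%R.
  by field.
- apply: emeasurable_funM.
    apply: emeasurable_funM => //; apply/measurable_EFinP; apply: measurableT_comp => //.
    by apply: measurable_funB => //; exact: measurable_funM.
  by apply/measurable_EFinP; exact: measurable_normal_pdf.
- by move=> x; rewrite !mule_ge0// lee_fin ?expR_ge0 ?normal_pdf_ge0.
Qed.

Lemma normal_prob_scale (sigma : R) (f : R -> \bar R) : (0 < sigma)%R ->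
  measurable_fun setT f -> (forall x, 0 <= f x) ->
  \int[normal_prob 0 sigma]_x f x = \int[gauss]_x f (sigma * x)%R.
Proof.
move=> s0 mf f0.
have -> : \int[normal_prob 0 sigma]_x f x =
    \int[lambda]_x (f x * (normal_pdf 0 sigma x)%:E).
  apply: ge0_integral_density => //; first exact: measurable_normal_pdf.
  by move=> x; exact: normal_pdf_ge0.
rewrite -(@ge0_integral_lebesgue_affine _ sigma 0)//; last first.
- by move=> x; rewrite mule_ge0// lee_fin normal_pdf_ge0.
- by apply: emeasurable_funM => //; apply/measurable_EFinP; exact: measurable_normal_pdf.
rewrite ge0_integral_gauss//; last first.
  by apply: (measurableT_comp mf); exact: measurable_funM.
rewrite -ge0_integralZl//.
- apply: eq_integral => x _; rewrite addr0 muleCA; congr (_ * _).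
  rewrite -EFinM gauss_pdfE normal_pdfE ?gt_eqF// /normal_fun mulrA; congr (_ * _)%:E%R.
    rewrite /normal_peak expr1n mul1r -mulrnAr sqrtrM ?sqr_ge0// sqrtr_sqr gtr0_norm//.
    by rewrite invfM mulrA mulfV ?gt_eqF// mul1r.
  by congr expR; rewrite subr0; field; rewrite gt_eqF.
- apply: emeasurable_funM; last first.
    apply/measurable_EFinP; apply: measurableT_comp; first exact: measurable_normal_pdf.
    by apply: measurable_funD => //; exact: measurable_funM.
  by apply: (measurableT_comp mf); apply: measurable_funD => //; exact: measurable_funM.
- by move=> x _; rewrite mule_ge0// lee_fin normal_pdf_ge0.
- by rewrite lee_fin ltW.
Qed.

End plane.

Section mfun_of.
Context d d' (T : measurableType d) (U : measurableType d') (f : T -> U).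
Hypothesis mf : measurable_fun setT f.

(** [distribution] expects a bundled measurable function, whereas measurability is proved here for
    plain functions. *)
Definition mfun_of : {mfun T >-> U} :=
  HB.pack f (isMeasurableFun.Build _ _ _ _ f mf).

End mfun_of.

Lemma integral_probability_cst d (T : measurableType d) (R : realType)
  (P : probability T R) (c : \bar R) : (\int[P]_x c = c)%E.
Proof.
rewrite integral_cst// -[RHS]mule1; congr (_ * _)%E.
exact: probability_setT.
Qed.

Section independent_pair.
Context d (T : measurableType d) (R : realType) (P : probability T R).

Definition independent_pair d1 d2 (U1 : measurableType d1)
    (U2 : measurableType d2) (X : T -> U1) (Y : T -> U2) : Prop :=
  forall A B, measurable A -> measurable B ->
    P (X @^-1` A `&` Y @^-1` B) = (P (X @^-1` A) * P (Y @^-1` B))%E.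

Lemma mutually_independent2 (F G : set_system T) :
  mutually_independent P (tnth [tuple F; G]) ->
  forall A B, F A -> G B -> P (A `&` B) = (P A * P B)%E.
Proof.
move=> FG A B FA GB.
have /= := FG [set: 'I_2]%SET (fun i => if i == ord0 then A else B).
rewrite (eq_bigl xpredT); last by move=> i; rewrite finset.in_setT.
rewrite big_ord_recl big_ord1/= => <-.
  congr (P _); apply/seteqP; split => [t [At Bt] i _|t h].
    by case: ifP.
  split; first exact: (h ord0 (finset.in_setT _)).
  exact: (h (lift ord0 ord0) (finset.in_setT _)).
by move=> [[|[|//]] ilt] _; rewrite (tnth_nth set0).
Qed.

(** For fixed [B] both sides are finite measures of [A]: [m1] is the image of [P] restricted to [D],
    and [m2] is the law of [X] scaled by [P D]. Agreeing on the pi-system [G], they agree on all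
    events. *)
Lemma independent_pair_of_pi_system d1 d2 (U1 : measurableType d1)
    (U2 : measurableType d2) (X : T -> U1) (Y : T -> U2) (G : set (set U1)) :
  measurable_fun setT X -> measurable_fun setT Y ->
  measurable = <<s G >> -> setI_closed G -> G setT ->
  (forall A B, G A -> measurable B ->
    P (X @^-1` A `&` Y @^-1` B) = (P (X @^-1` A) * P (Y @^-1` B))%E) ->
  independent_pair X Y.
Proof.
move=> mX mY mG GI GT GXY A B mA mB.
pose D := Y @^-1` B.
have mD : measurable D by rewrite -[D]setTI; exact: mY.
have PDfin : (0 <= fine (P D)) by exact: fine_ge0.
pose m1 : {measure set _ -> \bar R} :=
  measure_function_pushforward__canonical__measure_function_Measure
    (mrestr P mD) mX.
pose m2 : {measure set _ -> \bar R} :=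
  mscale (NngNum PDfin) (distribution P (mfun_of mX)).
have m1E C : m1 C = P (X @^-1` C `&` D) by [].
have m2E C : m2 C = (P (X @^-1` C) * P D)%E.
  transitivity ((fine (P D))%:E * P (X @^-1` C))%E => //.
  by rewrite fineK ?fin_num_measure// muleC.
rewrite -[X in P (_ `&` X)]/D -m1E -[X in (_ * P X)%E]/D -m2E.
apply: (measure_unique G (fun=> setT)) => //.
- by rewrite bigcup_const.
- by move=> C GC; rewrite m1E m2E GXY.
- move=> _; rewrite m1E; apply: le_lt_trans (ltry 1%R).
  apply: probability_le1; apply: measurableI => //.
  by rewrite -[X in measurable X]setTI; exact: (mX measurableT).
Qed.

Context d1 d2 (U1 : measurableType d1) (U2 : measurableType d2).
Variables (X : T -> U1) (Y : T -> U2).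
Hypotheses (mX : measurable_fun setT X) (mY : measurable_fun setT Y).
Hypothesis XY : independent_pair X Y.

Lemma independent_pair_law A : measurable A ->
  P ((fun t => (X t, Y t)) @^-1` A) =
  (distribution P (mfun_of mX) \x distribution P (mfun_of mY))%E A.
Proof.
move=> mA; rewrite -[LHS]/(distribution P (mfun_of (measurable_fun_pair mX mY)) A).
by apply/esym/product_measure_unique => // B C mB mC; rewrite -XY.
Qed.

(** The right-hand side integrates twice over [P] itself, [t'] standing for an independent copy, so
    that the laws of [X] and [Y] need not be named. *)
Lemma ge0_integral_independent_pair (f : U1 * U2 -> \bar R) :
  measurable_fun setT f -> (forall z, 0 <= f z)%E ->
  (\int[P]_t f (X t, Y t) = \int[P]_t \int[P]_t' f (X t, Y t'))%E.
Proof.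
move=> mf f0.
transitivity (\int[distribution P (mfun_of (measurable_fun_pair mX mY))]_z f z)%E.
  by rewrite ge0_integral_distribution.
transitivity
    (\int[distribution P (mfun_of mX) \x distribution P (mfun_of mY)]_z f z)%E.
  by apply: eq_measure_integral => A mA _; exact: independent_pair_law.
rewrite fubini_tonelli1// ge0_integral_distribution//; last 2 first.
- exact: (measurable_fun_fubini_tonelli_F (m2 := distribution P (mfun_of mY))).
- by move=> x; exact: integral_ge0.
apply: eq_integral => t _ /=; rewrite /fubini_F ge0_integral_distribution//.
exact: measurable_fun_pair2.
Qed.

End independent_pair.

Section complex_gaussian.
Context {R : realType}.
Local Open Scope ereal_scope.
Notation gauss := (@normal_prob R 0 1).
Implicit Types f : R[i] -> \bar R.

Lemma normc_ge0 (z : R[i]) : (0 <= Normc.normc z)%R.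
Proof. by case: z => x y; exact: sqrtr_ge0. Qed.

Lemma real_mul_complex (a x y : R) :
  (a%:C * (x +i* y)%C)%R = ((a * x)%R +i* (a * y)%R)%C.
Proof. by apply/eqP; rewrite eq_complex /= !mul0r subr0 addr0 !eqxx. Qed.

Definition complex_of_pair (z : R * R) : R[i] := (z.1 +i* z.2)%C.

Lemma measurable_complex_of_pair : measurable_fun setT complex_of_pair.
Proof. exact: measurable_fun_complex. Qed.

(* the law CN(0, 2) of x + iy with x and y independent standard normal *)
Definition cgauss : probability R[i] R :=
  distribution (gauss \x gauss)
    (mfun_of (T := (measurableTypeR R * measurableTypeR R)%type)
      measurable_complex_of_pair).

Lemma ge0_integral_cgauss f : measurable_fun setT f -> (forall w, 0 <= f w) ->
  \int[cgauss]_w f w = \int[gauss]_x \int[gauss]_y f (x +i* y)%C.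
Proof.
move=> mf f0; rewrite ge0_integral_distribution// fubini_tonelli1//.
  exact: (measurableT_comp mf measurable_complex_of_pair).
by move=> z; exact: f0.
Qed.

Let measurable_mulC (z : R[i]) : measurable_fun setT (fun w : R[i] => z * w)%R.
Proof.
by apply: measurable_fun_mulC; [exact: measurable_cst|exact: measurable_id].
Qed.

Lemma cgauss_unit (z : R[i]) f : Normc.normc z = 1%R ->
  measurable_fun setT f -> (forall w, 0 <= f w) ->
  \int[cgauss]_w f (z * w)%R = \int[cgauss]_w f w.
Proof.
case: z => c s z1 mf f0.
rewrite (ge0_integral_cgauss (measurableT_comp mf (measurable_mulC _)) (fun=> f0 _)).
rewrite (ge0_integral_cgauss mf f0).
have cs : (c ^+ 2 + s ^+ 2 = 1)%R.
  have := congr1 (fun x => x ^+ 2)%R z1.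
  by rewrite /= sqr_sqrtr ?expr1n// addr_ge0// sqr_ge0.
have mfc := measurableT_comp mf measurable_complex_of_pair.
rewrite -(gauss_rotation cs mfc (fun=> f0 _)).
apply: eq_integral => x _; apply: eq_integral => y _ /=.
by congr (f (_ +i* _)%C); rewrite addrC.
Qed.

(** Circular symmetry: [z] is its modulus times a unit [u], and [cgauss_unit] absorbs the unit. *)
Lemma cgauss_normc (z : R[i]) f :
  measurable_fun setT f -> (forall w, 0 <= f w) ->
  \int[cgauss]_w f (z * w)%R = \int[cgauss]_w f ((Normc.normc z)%:C * w)%R.
Proof.
move=> mf f0; have [->|z0] := eqVneq z 0%R.
  by rewrite Normc.normc0 !(mul0r, rmorph0).
have n0 : Normc.normc z != 0%R by apply: contra_neq z0; exact: Normc.eq0_normc.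
pose u := ((Normc.normc z)^-1%:C * z)%R.
have u1 : Normc.normc u = 1%R.
  rewrite Normc.normcM {1}/Normc.normc/= expr0n addr0 sqrtr_sqr.
  by rewrite ger0_norm ?invr_ge0 ?normc_ge0// mulVf.
have mg := measurableT_comp mf (measurable_mulC (Normc.normc z)%:C).
rewrite -(cgauss_unit u1 mg (fun=> f0 _)).
apply: eq_integral => w _ /=; congr f; rewrite mulrA /u mulrA -rmorphM/=.
by rewrite mulfV// mul1r.
Qed.

Let measurable_lin2 (z z' : R[i]) :
  measurable_fun setT (fun w : R[i] * R[i] => z * w.1 + z' * w.2)%R.
Proof.
by apply: measurable_fun_addC;
  apply: (measurableT_comp (f := fun w : R[i] => _ * w)%R).
Qed.

Let measurable_lin2C (z z' u : R[i]) :
  measurable_fun setT (fun w : R[i] => z * u + z' * w)%R.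
Proof. exact: measurable_fun_addC. Qed.

(** [a * x + b * y] is [r] times the first coordinate of a rotated pair, hence distributed as
    [r * x]; the second coordinate then integrates out. *)
Let gauss_add (a b : R) (f : R -> \bar R) : measurable_fun setT f ->
  (forall x, 0 <= f x) ->
  \int[gauss]_x \int[gauss]_y f (a * x + b * y)%R =
  \int[gauss]_x f (Num.sqrt (a ^+ 2 + b ^+ 2) * x)%R.
Proof.
move=> mf f0; set r := Num.sqrt _.
have r2 : (r ^+ 2 = a ^+ 2 + b ^+ 2)%R by rewrite sqr_sqrtr// addr_ge0// sqr_ge0.
have [r0|r0] := eqVneq r 0%R.
  have /eqP : (a ^+ 2 + b ^+ 2 = 0)%R by rewrite -r2 r0 expr0n.
  rewrite paddr_eq0 ?sqr_ge0// !sqrf_eq0 => /andP[/eqP -> /eqP ->].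
  under eq_integral do under eq_integral do rewrite !mul0r addr0.
  rewrite r0; apply: eq_integral => x _; rewrite mul0r.
  exact: integral_probability_cst.
pose g (z : R * R) := f (r * z.1)%R.
have mg : measurable_fun setT g.
  by apply: (measurableT_comp mf); apply: measurable_funM.
transitivity (\int[gauss]_x \int[gauss]_y g (x, y)).
  have cs : ((a / r) ^+ 2 + (- b / r) ^+ 2 = 1)%R.
    by rewrite !expr_div_n sqrrN -mulrDl -r2 mulfV ?sqrf_eq0.
  rewrite -(gauss_rotation cs mg (fun=> f0 _)).
  apply: eq_integral => x _; apply: eq_integral => y _; rewrite /g /=.
  by congr f; field.
apply: eq_integral => x _; rewrite /g /=.
exact: integral_probability_cst.
Qed.

Let cgauss_addR (a b : R) f : measurable_fun setT f -> (forall w, 0 <= f w) ->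
  \int[cgauss]_w \int[cgauss]_w' f (a%:C * w + b%:C * w')%R =
  \int[cgauss]_w f ((Num.sqrt (a ^+ 2 + b ^+ 2))%:C * w)%R.
Proof.
move=> mf f0; set r := Num.sqrt _.
have mfl := measurableT_comp mf (measurable_lin2 a%:C b%:C).
rewrite ge0_integral_cgauss; last 2 first.
- exact: (measurable_fun_fubini_tonelli_F (m2 := cgauss) _ mfl (fun=> f0 _)).
- by move=> w; exact: integral_ge0.
rewrite [RHS](ge0_integral_cgauss (measurableT_comp mf (measurable_mulC _)) (fun=> f0 _)).
have mc4 : measurable_fun setT (fun v : (R * R) * (R * R) =>
   ((a * v.1.1 + b * v.2.1)%R +i* (a * v.1.2 + b * v.2.2)%R)%C).
  have m11 : measurable_fun setT (fun v : (R * R) * (R * R) => v.1.1).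
    exact: (measurableT_comp measurable_fst measurable_fst).
  have m12 : measurable_fun setT (fun v : (R * R) * (R * R) => v.1.2).
    exact: (measurableT_comp measurable_snd measurable_fst).
  have m21 : measurable_fun setT (fun v : (R * R) * (R * R) => v.2.1).
    exact: (measurableT_comp measurable_fst measurable_snd).
  have m22 : measurable_fun setT (fun v : (R * R) * (R * R) => v.2.2).
    exact: (measurableT_comp measurable_snd measurable_snd).
  by apply: measurable_fun_complex => /=; apply: measurable_funD;
    apply: measurable_funM.
have mf4 := measurableT_comp mf mc4.
transitivity (\int[gauss]_x \int[gauss]_y \int[gauss]_x' \int[gauss]_y'
    f ((a * x + b * x')%R +i* (a * y + b * y')%R)%C).
  apply: eq_integral => x _; apply: eq_integral => y _.
  rewrite (ge0_integral_cgauss (measurableT_comp mf (measurable_lin2C _ _ _))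
    (fun=> f0 _)).
  by do 2 (apply: eq_integral => ? _); congr f; rewrite !real_mul_complex.
(* Exchanging [y] and [x'] puts the two real parts together and the two imaginary parts together, so
   that [gauss_add] applies to each pair. *)
transitivity (\int[gauss]_x \int[gauss]_x' \int[gauss]_y \int[gauss]_y'
    f ((a * x + b * x')%R +i* (a * y + b * y')%R)%C).
  apply: eq_integral => x _.
  have mh : measurable_fun setT (fun v : R * R =>
      \int[gauss]_y' f ((a * x + b * v.2)%R +i* (a * v.1 + b * y')%R)%C).
    apply: (@measurable_fun_fubini_tonelli_F _ _ _ _ _ gauss (fun v : (R * R) * R =>
         f ((a * x + b * v.1.2)%R +i* (a * v.1.1 + b * v.2)%R)%C)) => //.
    have m11 : measurable_fun setT (fun v : (R * R) * R => v.1.1).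
      exact: (measurableT_comp measurable_fst measurable_fst).
    have m12 : measurable_fun setT (fun v : (R * R) * R => v.1.2).
      exact: (measurableT_comp measurable_snd measurable_fst).
    apply: (measurableT_comp mf); apply: measurable_fun_complex => /=;
      apply: measurable_funD => //; exact: measurable_funM.
  have := @fubini_tonelli _ _ _ _ _ gauss gauss _ mh.
  by move=> ->// z; exact: integral_ge0.
under eq_integral => x _.
  under eq_integral => x' _.
    rewrite (gauss_add a b (f := fun y => f ((a * x + b * x')%R +i* y)%C)); first over.
    - by apply: (measurableT_comp mf); apply: measurable_fun_complex => //=;
        exact: measurable_cst.
    - by [].
  over.
rewrite /=.
have mk : measurable_fun setT (fun x => \int[gauss]_y f (x +i* (r * y)%R)%C).
  apply: (@measurable_fun_fubini_tonelli_F _ _ _ _ _ gauss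
    (fun v : R * R => f (v.1 +i* (r * v.2)%R)%C)) => //.
  apply: (measurableT_comp mf); apply: measurable_fun_complex => //=.
  exact: measurable_funM.
rewrite (gauss_add a b mk); last by move=> x; exact: integral_ge0.
by do 2 (apply: eq_integral => ? _); congr f; rewrite !real_mul_complex.
Qed.

Lemma cgauss_add (z z' : R[i]) f :
  measurable_fun setT f -> (forall w, 0 <= f w) ->
  \int[cgauss]_w \int[cgauss]_w' f (z * w + z' * w')%R =
  \int[cgauss]_w
    f ((Num.sqrt (Normc.normc z ^+ 2 + Normc.normc z' ^+ 2))%:C * w)%R.
Proof.
move=> mf f0; rewrite -(cgauss_addR _ _ mf f0).
under eq_integral => w _.
  rewrite (cgauss_normc z' (f := fun u => f (z * w + u)%R)); first over.
  - apply: (measurableT_comp mf); apply: measurable_fun_addC => //.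
  - by [].
rewrite /= (cgauss_normc z
  (f := fun u => \int[cgauss]_w' f (u + (Normc.normc z')%:C * w')%R)) //.
- have -> : (fun u => \int[cgauss]_w' f (u + (Normc.normc z')%:C * w')%R) =
    (fun u => \int[cgauss]_w' f (1 * u + (Normc.normc z')%:C * w')%R).
    by apply/funext => u; under [RHS]eq_integral do rewrite mul1r.
  apply: (@measurable_fun_fubini_tonelli_F _ _ _ _ _ cgauss
    (fun v : R[i] * R[i] => f (1 * v.1 + (Normc.normc z')%:C * v.2)%R)) => //.
  exact: (measurableT_comp mf (measurable_lin2 _ _)).
- by move=> u; exact: integral_ge0.
Qed.

Lemma measurable_expR_shift (h : R[i]) : measurable_fun setT
  (fun w => expR (complex.Re (conjc h * w)%R - Normc.normc h ^+ 2 / 2)%R).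
Proof.
apply: measurableT_comp => //; apply: measurable_funB => //.
exact: measurable_fun_Re.
Qed.

(** [gauss_shift] on each coordinate; both have variance 1, so the two exponents add up to the real
    inner product minus half the squared modulus of [h]. *)
Lemma cgauss_shift (h : R[i]) f :
  measurable_fun setT f -> (forall w, 0 <= f w) ->
  \int[cgauss]_w f (w + h)%R = \int[cgauss]_w (f w *
    (expR (complex.Re (conjc h * w)%R - Normc.normc h ^+ 2 / 2)%R)%:E).
Proof.
case: h => a b mf f0.
have mfh : measurable_fun setT (fun w : R[i] => f (w + (a +i* b)%C)%R).
  by apply: (measurableT_comp mf); apply: measurable_fun_addC.
rewrite (ge0_integral_cgauss mfh (fun=> f0 _)).
rewrite [RHS]ge0_integral_cgauss; last 2 first.
- by apply: emeasurable_funM => //; apply/measurable_EFinP; exact: measurable_expR_shift.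
- by move=> w; rewrite mule_ge0// lee_fin expR_ge0.
have mfi x : measurable_fun setT (fun y => f (x +i* y)%C).
  by apply: (measurableT_comp mf); apply: measurable_fun_complex => //=;
    exact: measurable_cst.
have mp (c : R) : measurable_fun setT (fun y => (expR (c * y - c ^+ 2 / 2)%R)%:E).
  apply/measurable_EFinP; apply: measurableT_comp => //.
  by apply: measurable_funB => //; exact: measurable_funM.
under eq_integral => x _.
  rewrite (gauss_shift b (f := fun y => f ((x + a)%R +i* y)%C))//; first over.
pose g x := \int[gauss]_y (f (x +i* y)%C * (expR (b * y - b ^+ 2 / 2)%R)%:E).
have mg : measurable_fun setT g.
  apply: (@measurable_fun_fubini_tonelli_F _ _ _ _ _ gauss (fun v : R * R =>
    f (v.1 +i* v.2)%C * (expR (b * v.2 - b ^+ 2 / 2)%R)%:E)).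
    apply: emeasurable_funM.
      exact: (measurableT_comp mf measurable_complex_of_pair).
    exact: (measurableT_comp (mp b)).
  by move=> v; rewrite mule_ge0// lee_fin expR_ge0.
have g0 x : 0 <= g x.
  by apply: integral_ge0 => y _; rewrite mule_ge0// lee_fin expR_ge0.
apply: etrans (gauss_shift a mg g0) _.
apply: eq_integral => x _; rewrite muleC -ge0_integralZl//.
- apply: eq_integral => y _; rewrite muleC -muleA; congr (_ * _).
  rewrite -EFinM -expRD sqr_sqrtr ?addr_ge0 ?sqr_ge0//; congr (expR _)%:E.
  by rewrite /=; field.
- by apply: emeasurable_funM; [exact: mfi|exact: mp].
- by move=> y _; rewrite mule_ge0// lee_fin expR_ge0.
Qed.

End complex_gaussian.

Section complex_normal.
Context d (T : measurableType d) (R : realType) (P : probability T R).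
Local Open Scope ereal_scope.
Notation gauss := (@normal_prob R 0 1).

Lemma ge0_integral_normal_law (X : T -> R) (v : R) (f : R -> \bar R) :
  measurable_fun setT X -> (0 < v)%R -> normal_law P X v ->
  measurable_fun setT f -> (forall x, 0 <= f x) ->
  \int[P]_t f (X t) = \int[gauss]_x f (Num.sqrt v * x)%R.
Proof.
move=> mX v0 Xv mf f0.
rewrite -normal_prob_scale ?sqrtr_gt0//.
transitivity (\int[distribution P (mfun_of (U := measurableTypeR R) mX)]_x f x).
  by rewrite ge0_integral_distribution.
by apply: eq_measure_integral => A mA _; have := Xv A mA; rewrite gt_eqF.
Qed.

(** Real and imaginary parts have variance [v / 2], those of [cgauss] have variance 1, whence the
    scale [sqrt (v / 2)]. *)
Lemma ge0_integral_complex_normal (Z : T -> R[i]) (v : R) (f : R[i] -> \bar R) :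
  measurable_fun setT Z -> (0 < v)%R -> complex_normal_law P Z v ->
  measurable_fun setT f -> (forall x, 0 <= f x) ->
  \int[P]_t f (Z t) = \int[cgauss]_w f ((Num.sqrt (v / 2))%:C * w)%R.
Proof.
move=> mZ v0 [Re_law Im_law ReIm] mf f0.
have v20 : (0 < v / 2)%R by rewrite divr_gt0.
have mRe := measurable_fun_Re mZ; have mIm := measurable_fun_Im mZ.
have ind : independent_pair P (fun t => complex.Re (Z t)) (fun t => complex.Im (Z t)).
  move=> A B mA mB; apply: (mutually_independent2 ReIm).
    by exists A => //; rewrite setTI.
  by exists B => //; rewrite setTI.
have mfc := measurableT_comp mf (@measurable_complex_of_pair R).
transitivity (\int[P]_t (f \o @complex_of_pair R) (complex.Re (Z t), complex.Im (Z t))).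
  by apply: eq_integral => t _ /=; congr f; rewrite /complex_of_pair; case: (Z t).
rewrite (ge0_integral_independent_pair mRe mIm ind mfc); last by move=> z; exact: f0.
under eq_integral => t _.
  rewrite (ge0_integral_normal_law
    (f := fun y => (f \o @complex_of_pair R) (complex.Re (Z t), y))
    mIm v20 Im_law (measurable_fun_pair2 _ mfc) (fun=> f0 _)); over.
rewrite /=.
pose g x := \int[gauss]_y f (complex_of_pair (x, Num.sqrt (v / 2) * y)%R).
have mg : measurable_fun setT g.
  apply: (@measurable_fun_fubini_tonelli_F _ _ _ _ _ gauss
    (fun u : R * R => f (complex_of_pair (u.1, Num.sqrt (v / 2) * u.2)%R))) => //.
  apply: (measurableT_comp mfc); apply: measurable_fun_pair => //.
  exact: measurable_funM.
have g0 x : 0 <= g x by exact: integral_ge0.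
apply: etrans (ge0_integral_normal_law mRe v20 Re_law mg g0) _.
have mfs : measurable_fun setT (fun w : R[i] => f ((Num.sqrt (v / 2))%:C * w)%R).
  by apply: (measurableT_comp mf); apply: measurable_fun_mulC.
rewrite (ge0_integral_cgauss mfs (fun=> f0 _)).
by do 2 (apply: eq_integral => ? _); rewrite real_mul_complex.
Qed.

End complex_normal.

(** * White noise *)

Section gauss_kernels.
Context {R : realType} (M : nat).
Local Open Scope ereal_scope.
Notation V := 'cV[R[i]]_M.
Implicit Types (F : V -> \bar R) (m : 'I_M) (z : R[i]) (b : V).

(* [smooth m z] convolves with the law of z w on coordinate m, w of law [cgauss] *)
Definition smooth m z F b : \bar R :=
  \int[cgauss]_w F (b + (z * w) *: delta_mx m ord0)%R.

Let measurable_move m z :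
  measurable_fun setT (fun v : V * R[i] => v.1 + (z * v.2) *: delta_mx m ord0)%R.
Proof.
apply: measurable_fun_addmx => //; apply: measurable_fun_scalemx => //.
exact: measurable_fun_mulC.
Qed.

Lemma smooth_ge0 m z F b : (forall u, 0 <= F u) -> 0 <= smooth m z F b.
Proof. by move=> F0; exact: integral_ge0. Qed.

Lemma measurable_smooth m z F : measurable_fun setT F -> (forall u, 0 <= F u) ->
  measurable_fun setT (smooth m z F).
Proof.
move=> mF F0; exact: (@measurable_fun_fubini_tonelli_F _ _ _ _ _ cgauss _
  (measurableT_comp mF (measurable_move m z)) (fun=> F0 _)).
Qed.

Let measurable_line m F b : measurable_fun setT F ->
  measurable_fun setT (fun w : R[i] => F (b + w *: delta_mx m ord0)%R).
Proof.
move=> mF; apply: (measurableT_comp mF); apply: measurable_fun_addmx => //.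
exact: measurable_fun_scalemx.
Qed.

Lemma smooth0 m F : smooth m 0%R F = F.
Proof.
apply/funext => b; rewrite /smooth; under eq_integral do rewrite mul0r scale0r addr0.
exact: integral_probability_cst.
Qed.

Lemma smooth_add m z z' F : measurable_fun setT F -> (forall u, 0 <= F u) ->
  smooth m z (smooth m z' F) =
  smooth m (Num.sqrt (Normc.normc z ^+ 2 + Normc.normc z' ^+ 2))%:C F.
Proof.
move=> mF F0; apply/funext => b.
apply: etrans (cgauss_add z z' (measurable_line m b mF) (fun=> F0 _)).
apply: eq_integral => w _; apply: eq_integral => w' _.
by congr F; rewrite scalerDl addrA.
Qed.

Lemma smooth_comm m m' z z' F : measurable_fun setT F -> (forall u, 0 <= F u) ->
  smooth m z (smooth m' z' F) = smooth m' z' (smooth m z F).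
Proof.
move=> mF F0; apply/funext => b.
pose G (v : R[i] * R[i]) :=
  F (b + (z * v.1) *: delta_mx m ord0 + (z' * v.2) *: delta_mx m' ord0)%R.
have mG : measurable_fun setT G.
  apply: (measurableT_comp mF); apply: measurable_fun_addmx.
    apply: measurable_fun_addmx => //; apply: measurable_fun_scalemx => //.
    exact: measurable_fun_mulC.
  by apply: measurable_fun_scalemx => //; exact: measurable_fun_mulC.
apply: etrans (@fubini_tonelli _ _ _ _ _ cgauss cgauss _ mG (fun=> F0 _)) _.
by apply: eq_integral => w _; apply: eq_integral => w' _; congr F; rewrite addrAC.
Qed.

Definition smooths (s : seq ('I_M * R[i])) F :=
  foldl (fun G p => smooth p.1 p.2 G) F s.

Lemma smooths_ge0 s F b : (forall u, 0 <= F u) -> 0 <= smooths s F b.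
Proof.
elim: s F => [//|p s IH] F F0 /=.
by apply: IH => u; exact: smooth_ge0.
Qed.

Lemma measurable_smooths s F : measurable_fun setT F -> (forall u, 0 <= F u) ->
  measurable_fun setT (smooths s F).
Proof.
elim: s F => [//|p s IH] F mF F0 /=.
by apply: IH => [|u]; [exact: measurable_smooth|exact: smooth_ge0].
Qed.

Lemma smooths_smooth s m z F : measurable_fun setT F -> (forall u, 0 <= F u) ->
  smooths s (smooth m z F) = smooth m z (smooths s F).
Proof.
elim: s F => [//|p s IH] F mF F0 /=.
rewrite (smooth_comm _ _ _ _ mF F0).
exact: IH (measurable_smooth _ _ mF F0) (fun u => smooth_ge0 _ _ _ F0).
Qed.

Definition smooth_all (r : R) := smooths [seq (m, r%:C) | m <- enum 'I_M].

Let normc_real (r : R) : (0 <= r)%R -> Normc.normc r%:C = r.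
Proof. by move=> r0; rewrite /Normc.normc /= expr0n addr0 sqrtr_sqr ger0_norm. Qed.

(** Convolutions commute, so the two that act on the same coordinate can be brought together and
    merged by [smooth_add], where variances add up. *)
Lemma smooth_allD (r r' : R) F : (0 <= r)%R -> (0 <= r')%R ->
  measurable_fun setT F -> (forall u, 0 <= F u) ->
  smooth_all r (smooth_all r' F) = smooth_all (Num.sqrt (r ^+ 2 + r' ^+ 2)) F.
Proof.
move=> r0 r'0; rewrite /smooth_all; elim: (enum 'I_M) F => [//|m s IH] F mF F0 /=.
have mF' := measurable_smooth m r'%:C mF F0.
have F'0 u := smooth_ge0 m r'%:C u F0.
rewrite -(smooths_smooth _ m r%:C mF' F'0) smooth_add// !normc_real//.
exact: IH (measurable_smooth _ _ mF F0) (fun u => smooth_ge0 _ _ _ F0).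
Qed.

Lemma smooths_row m (t : seq R[i]) F : measurable_fun setT F ->
  (forall u, 0 <= F u) ->
  smooths [seq (m, z) | z <- t] F =
  smooth m (Num.sqrt (\sum_(z <- t) Normc.normc z ^+ 2))%:C F.
Proof.
elim: t F => [|z t IH] F mF F0 /=; first by rewrite big_nil sqrtr0 smooth0.
rewrite (IH _ (measurable_smooth _ _ mF F0) (fun u => smooth_ge0 _ _ _ F0)).
have S0 : (0 <= \sum_(z <- t) Normc.normc z ^+ 2)%R.
  by apply: sumr_ge0 => ? _; exact: sqr_ge0.
rewrite (smooth_add m _ _ mF F0) (normc_real (sqrtr_ge0 _)) (sqr_sqrtr S0).
by rewrite big_cons addrC.
Qed.

Lemma smooths_cat s s' F : smooths (s ++ s') F = smooths s' (smooths s F).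
Proof. exact: foldl_cat. Qed.

Lemma smooths_allpairs (t : seq R[i]) F : measurable_fun setT F ->
  (forall u, 0 <= F u) ->
  smooths [seq (m, z) | m <- enum 'I_M, z <- t] F =
  smooth_all (Num.sqrt (\sum_(z <- t) Normc.normc z ^+ 2)) F.
Proof.
rewrite /smooth_all; elim: (enum 'I_M) F => [//|m s IH] F mF F0 /=.
rewrite smooths_cat (smooths_row _ _ mF F0).
exact: IH (measurable_smooth _ _ mF F0) (fun u => smooth_ge0 _ _ _ F0).
Qed.

End gauss_kernels.

(** * One entry of a random matrix against all the others *)

Section entrywise_independence.
Context d (T : measurableType d) (R : realType) (P : probability T R).
Context d' (U : measurableType d') (m n : nat).
Notation I := ('I_m * 'I_n)%type.

Let cylinders : set (set 'M[U]_(m, n)) :=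
  [set C | exists B : I -> set U, (forall ij, measurable (B ij)) /\
    C = [set A : 'M[U]_(m, n) | forall ij, B ij (A ij.1 ij.2)]].

Let cylinder_measurable : cylinders `<=` measurable.
Proof.
move=> _ [B [mB ->]].
rewrite (_ : [set A | _] = \bigcap_(ij in [set: I])
    (fun A : 'M[U]_(m, n) => A ij.1 ij.2) @^-1` B ij); last first.
  by apply/seteqP; split => [A BA ij _|A BA ij]; [exact: BA|exact: BA].
apply: fin_bigcap_measurable => [|ij _]; first exact: finite_finset.
by rewrite -[X in measurable X]setTI; exact: measurable_entry.
Qed.

Let measurable_cylinders : @measurable _ 'M[U]_(m, n) = <<s cylinders >>.
Proof.
apply/seteqP; split; last first.
  exact: (smallest_sub (@sigma_algebra_measurable _ _) cylinder_measurable).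
apply: smallest_sub; first exact: smallest_sigma_algebra.
move=> _ [ij _ [B mB <-]]; apply: sub_sigma_algebra.
exists (fun kl => if kl == ij then B else setT); split.
  by move=> kl; case: ifP.
apply/seteqP; split => [A BA kl|A /(_ ij)]; last by rewrite eqxx.
by case: eqP => // ->.
Qed.

Variable N : T -> 'M[U]_(m, n).
Hypotheses (mN : measurable_fun setT N)
  (N_indep : mutually_independent P
    (fun ij : I => sigma_of (fun t => N t ij.1 ij.2))).
Variable ij : I.

(** Overwriting entry [ij] by a constant represents the family of all other entries as a matrix of
    the same size. *)
Definition set_entry (u : U) (A : 'M[U]_(m, n)) : 'M[U]_(m, n) :=
  \matrix_(k, l) if (k, l) == ij then u else A k l.

Lemma measurable_set_entry u : measurable_fun setT (set_entry u).
Proof.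
apply: measurable_fun_mx => k l; under eq_fun do rewrite mxE.
by case: ((k, l) == ij); [exact: measurable_cst|exact: measurable_entry].
Qed.

(** Cylinders form a pi-system generating the events on matrices. On a cylinder the claim compares
    the product formula for all entries with the one for the entries other than [ij]. *)
Lemma independent_set_entry u :
  independent_pair P (fun t => set_entry u (N t)) (fun t => N t ij.1 ij.2).
Proof.
have mZ : measurable_fun setT (fun t => set_entry u (N t)).
  exact: (measurableT_comp (measurable_set_entry u) mN).
have mNij : measurable_fun setT (fun t => N t ij.1 ij.2).
  exact: measurable_fun_entry.
apply: (independent_pair_of_pi_system (G := cylinders)) => //.
- move=> _ _ [B1 [mB1 ->]] [B2 [mB2 ->]].
  exists (fun kl => B1 kl `&` B2 kl); split.
    by move=> kl; exact: measurableI.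
  apply/seteqP; split => [C [C1 C2] kl|C C12].
    by split; [exact: C1|exact: C2].
  by split=> kl; have [] := C12 kl.
- by exists (fun=> setT); split => //; apply/seteqP; split.
- move=> _ B [E [mE ->]] mB; pose D := (fun t => N t ij.1 ij.2) @^-1` B.
  rewrite -[X in P (_ `&` X)]/D -[X in (_ * P X)%E]/D.
  (* The overwritten matrix has [u] in position [ij], so the cylinder event is empty unless [u]
     satisfies the constraint there. *)
  have [Eu|Eu] := pselect (E ij u); last first.
    rewrite (_ : _ @^-1` _ = set0) ?set0I ?measure0 ?mul0e//.
    apply/seteqP; split => // t /= /(_ ij); rewrite mxE.
    by rewrite -surjective_pairing eqxx.
  pose G kl := (fun t => N t kl.1 kl.2) @^-1` E kl : set T.
  have GE : (fun t => set_entry u (N t)) @^-1`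
      [set A0 : 'M[U]_(m, n) | forall kl, E kl (A0 kl.1 kl.2)] =
      \bigcap_(kl in [set` [set~ ij]%SET]) G kl.
    apply/seteqP; split => [t /= tE kl|t /= tG kl].
      rewrite /= !inE => klij; have := tE kl; rewrite mxE.
      by rewrite -surjective_pairing (negbTE klij).
    rewrite mxE -surjective_pairing; case: eqP => [->//|/eqP klij].
    by apply: (tG kl); rewrite /= !inE.
  have sG kl : sigma_of (fun t => N t kl.1 kl.2) (G kl).
    by exists (E kl) => //; rewrite setTI.
  pose G' kl := if kl == ij then D else G kl.
  have sG' kl : sigma_of (fun t => N t kl.1 kl.2) (G' kl).
    rewrite /G'; case: eqP => [->|_//].
    by exists B => //; rewrite setTI.
  have := N_indep (J := [set: I]%SET) (E := G') (fun kl _ => sG' kl).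
  rewrite (bigD1 ij) ?finset.in_setT//= {2}/G' eqxx => PG'.
  rewrite GE N_indep//.
  rewrite muleC (_ : _ `&` D = \bigcap_(i in [set` [set: I]%SET]) G' i).
    rewrite PG'; congr (_ * _)%E; apply: eq_big => kl.
      by rewrite finset.in_setT finset.in_setC1.
    by move=> /andP[_ /negbTE klij]; rewrite /G' klij.
  apply/seteqP; split => [t [tG tD] kl _|t tG'].
    rewrite /G'; case: eqP => // /eqP klij; apply: (tG kl).
    by rewrite /= !inE.
  split => [kl /=|]; last first.
    by have := tG' ij; rewrite /G' eqxx; apply; rewrite /= finset.in_setT.
  rewrite !inE => klij; have := tG' kl; rewrite /G' (negbTE klij); apply.
  by rewrite /= finset.in_setT.
Qed.

End entrywise_independence.

Section white_noise_law.
Context d (T : measurableType d) (R : realType) (P : probability T R).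
Variables (M L : nat) (N : T -> 'M[R[i]]_(M, L)) (v : R).
Hypotheses (mN : measurable_fun setT N) (v_gt0 : 0 < v) (N_law : white_noise P N v).
Local Open Scope ereal_scope.
Notation I := ('I_M * 'I_L)%type.
Notation c := (Num.sqrt (v / 2)).
Notation clear p := (set_entry p (0%R : R[i])).

Let set_entryE (p : I) (u : R[i]) (A : 'M[R[i]]_(M, L)) :
  set_entry p u A = (clear p A + u *: delta_mx p.1 p.2)%R.
Proof.
apply/matrixP => k l; rewrite !mxE; case: p => i j /=; rewrite xpair_eqE.
by case: eqP => _; case: eqP => _; rewrite /= ?(mulr0, mulr1, add0r, addr0).
Qed.

Let set_entry_id (p : I) (A : 'M[R[i]]_(M, L)) : set_entry p (A p.1 p.2) A = A.
Proof.
apply/matrixP => k l; rewrite !mxE; case: eqP => // kl.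
by case: p kl => ? ? [-> ->].
Qed.

(** Entry [p] is independent of the rest of the matrix, so it may be replaced by an independent
    variable [c * w] of law CN(0, v). *)
Lemma white_noise_entry (p : I) (F : R[i] * 'M[R[i]]_(M, L) -> \bar R) :
  measurable_fun setT F -> (forall z, 0 <= F z) ->
  \int[P]_t F (N t p.1 p.2, clear p (N t)) =
  \int[P]_t \int[cgauss]_w F (c%:C * w, clear p (N t))%R.
Proof.
move=> mF F0; case: N_law => entry_law entry_indep.
have mZ : measurable_fun setT (fun t => clear p (N t)).
  exact: (measurableT_comp (measurable_set_entry p (0%R : R[i])) mN).
have mNp : measurable_fun setT (fun t => N t p.1 p.2) by exact: measurable_fun_entry.
pose G (z : 'M[R[i]]_(M, L) * R[i]) := F (z.2, z.1).
have mG : measurable_fun setT G.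
  by apply: (measurableT_comp mF); exact: measurable_fun_pair.
have := ge0_integral_independent_pair mZ mNp
  (independent_set_entry mN entry_indep p (0%R : R[i])) mG (fun=> F0 _).
move=> ->; apply: eq_integral => t _.
have mFt : measurable_fun setT (fun w => F (w, clear p (N t))).
  by apply: (measurableT_comp mF); exact: measurable_fun_pair.
exact: (ge0_integral_complex_normal mNp v_gt0 (entry_law p.1 p.2) mFt (fun=> F0 _)).
Qed.

Let gain (s : seq I) (z : I -> R[i]) (A : 'M[R[i]]_(M, L)) : 'cV[R[i]]_M :=
  (\sum_(p <- s) (z p * A p.1 p.2) *: delta_mx p.1 ord0)%R.

Let measurable_gain s z : measurable_fun setT (gain s z).
Proof.
apply: measurable_fun_mx => k l; rewrite /gain.
under eq_fun do rewrite summxE.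
apply: measurable_fun_sumC => p; under eq_fun do rewrite mxE.
apply: measurable_fun_mulC => //.
by apply: measurable_fun_mulC => //; exact: measurable_entry.
Qed.

(** Entries are integrated out one at a time. As [p] is not in [s], [gain s] does not see entry [p],
    which by [white_noise_entry] acts as one convolution on its row. *)
Let gain_law s z (F : 'cV[R[i]]_M -> \bar R) b : uniq s ->
  measurable_fun setT F -> (forall u, 0 <= F u) ->
  \int[P]_t F (b + gain s z (N t))%R =
  smooths [seq (p.1, c%:C * z p)%R | p <- s] F b.
Proof.
elim: s F b => [|p s IH] F b /=.
  move=> _ mF F0; rewrite /gain; under eq_integral do rewrite big_nil addr0.
  exact: integral_probability_cst.
move=> /andP[ps us] mF F0.
rewrite -(IH _ _ us (measurable_smooth _ _ mF F0) (fun u => smooth_ge0 _ _ _ F0)).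
have gain_set A u : gain s z (set_entry p u A) = gain s z A.
  rewrite /gain; apply: eq_big_seq => q qs; rewrite mxE -surjective_pairing.
  by case: eqP => // qp; rewrite -qp qs in ps.
pose G (x : R[i] * 'M[R[i]]_(M, L)) :=
  F (b + gain s z x.2 + (z p * x.1) *: delta_mx p.1 ord0)%R.
have mG : measurable_fun setT G.
  apply: (measurableT_comp mF); apply: measurable_fun_addmx.
    apply: measurable_fun_addmx => //.
    exact: (measurableT_comp (measurable_gain s z)).
  apply: measurable_fun_scalemx => //.
  by apply: measurable_fun_mulC.
transitivity (\int[P]_t G (N t p.1 p.2, clear p (N t))).
  apply: eq_integral => t _; rewrite /G /= gain_set /gain big_cons; congr F.
  by rewrite addrAC addrA.
rewrite (white_noise_entry p mG (fun=> F0 _)).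
apply: eq_integral => t _; rewrite /smooth; apply: eq_integral => w _.
by rewrite /G /= gain_set mulrCA mulrA.
Qed.

(** Each coordinate of [N t *m y] is a sum of independent terms of variances [v |y_l|^2], and
    different coordinates come from different rows of the noise. *)
Lemma white_noise_mulmx (y : 'cV[R[i]]_L) (F : 'cV[R[i]]_M -> \bar R) b :
  measurable_fun setT F -> (forall u, 0 <= F u) ->
  \int[P]_t F (b + N t *m y)%R =
  smooth_all (c * Num.sqrt (\sum_l Normc.normc (y l ord0) ^+ 2))%R F b.
Proof.
move=> mF F0.
pose s : seq I := [seq (m, l) | m <- enum 'I_M, l <- enum 'I_L].
have us : uniq s by apply: allpairs_uniq; rewrite ?enum_uniq// => -[? ?] [? ?].
transitivity (\int[P]_t F (b + gain s (fun p => y p.2 ord0) (N t))%R).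
  apply: eq_integral => t _; congr (F (b + _)%R); rewrite /gain big_allpairs.
  apply/matrixP => k j; rewrite ord1 !mxE summxE big_enum/= (bigD1 k)//=.
  rewrite [X in (_ + X)%R]big1 ?addr0; last first.
    move=> i ik; rewrite summxE big1// => l _.
    by rewrite !mxE eq_sym (negbTE ik) mulr0.
  rewrite summxE big_enum/=; apply: eq_bigr => l _.
  by rewrite !mxE !eqxx mulr1 mulrC.
rewrite (gain_law _ _ us mF F0).
pose t := [seq (c%:C * y l ord0)%R | l <- enum 'I_L].
have -> : [seq (p.1, c%:C * y p.2 ord0)%R | p <- s] =
    [seq (m, z) | m <- enum 'I_M, z <- t].
  by rewrite /s /t map_allpairs allpairs_mapr.
rewrite (smooths_allpairs t mF F0).
congr (smooth_all _ F b).
rewrite big_map big_enum/=.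
have c0 : (0 <= c)%R by exact: sqrtr_ge0.
have normcc : Normc.normc c%:C = c.
  by rewrite /Normc.normc /= expr0n addr0 sqrtr_sqr ger0_norm.
under eq_bigr do rewrite Normc.normcM normcc exprMn.
by rewrite -mulr_sumr sqrtrM ?sqr_ge0// sqrtr_sqr ger0_norm.
Qed.

(** The likelihood ratio at [A] of noise with mean [h] against centred noise, both of variance
    [v]. *)
Definition noise_density (h A : 'M[R[i]]_(M, L)) : R :=
  (expR (\sum_(p : I) (2 * complex.Re (conjc (h p.1 p.2) * A p.1 p.2)
     - Normc.normc (h p.1 p.2) ^+ 2) / v))%R.

(** Cameron-Martin formula for white noise: the entries are shifted one after the other by
    [cgauss_shift], each contributing its own exponential factor. *)
Lemma white_noise_shift (h : 'M[R[i]]_(M, L)) (F : 'M[R[i]]_(M, L) -> \bar R) :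
  measurable_fun setT F -> (forall u, 0 <= F u) ->
  \int[P]_t F (N t + h)%R = \int[P]_t (F (N t) * (noise_density h (N t))%:E).
Proof.
pose e (p : I) (A : 'M[R[i]]_(M, L)) : R :=
  (expR ((2 * complex.Re (conjc (h p.1 p.2) * A p.1 p.2)
     - Normc.normc (h p.1 p.2) ^+ 2) / v))%R.
pose hs (s : seq I) : 'M[R[i]]_(M, L) :=
  (\sum_(p <- s) h p.1 p.2 *: delta_mx p.1 p.2)%R.
have me p : measurable_fun setT (e p).
  apply: measurableT_comp => //; apply: measurable_funM => //.
  apply: measurable_funB => //; apply: measurable_funM => //.
  apply: measurable_fun_Re; apply: measurable_fun_mulC => //.
  exact: measurable_entry.
have step s G : uniq s -> measurable_fun setT G -> (forall u, 0 <= G u) ->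
    \int[P]_t G (N t + hs s)%R = \int[P]_t (G (N t) * (\prod_(p <- s) e p (N t))%:E).
  elim: s G => [|p s IH] G /=.
    move=> _ mG G0; apply: eq_integral => t _.
    by rewrite /hs !big_nil addr0 mule1.
  move=> /andP[ps us] mG G0.
  have mGe : measurable_fun setT (fun A => G A * (e p A)%:E).
    by apply: emeasurable_funM => //; exact/measurable_EFinP.
  have Ge0 A : 0 <= G A * (e p A)%:E by rewrite mule_ge0// lee_fin expR_ge0.
  (* The induction hypothesis serves for [G] times the weight [e p]: shifting the entries listed in
     [s] leaves entry [p], hence [e p], unchanged ([hsp]). *)
  transitivity (\int[P]_t (G (N t + hs s)%R * (e p (N t + hs s)%R)%:E)); last first.
    rewrite (IH _ us mGe Ge0); apply: eq_integral => t _.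
    by rewrite big_cons EFinM muleA.
  have hsp : hs s p.1 p.2 = 0%R.
    rewrite /hs summxE big_seq big1// => q qs; rewrite !mxE.
    case: eqP => [pq1|]; case: eqP => [pq2|]; rewrite ?mulr0//.
    by move: qs ps; rewrite [p]surjective_pairing pq1 pq2 -surjective_pairing => ->.
  pose G1 (x : R[i] * 'M[R[i]]_(M, L)) := G (x.2 + hs s + x.1 *: delta_mx p.1 p.2)%R.
  have mmove : measurable_fun setT (fun x : R[i] * 'M[R[i]]_(M, L) =>
      x.2 + hs s + x.1 *: delta_mx p.1 p.2)%R.
    apply: measurable_fun_addmx; first exact: measurable_fun_addmx.
    exact: measurable_fun_scalemx.
  have mG1 : measurable_fun setT G1 by exact: (measurableT_comp mG mmove).
  pose k (w : R[i]) : R := (expR ((2 * complex.Re (conjc (h p.1 p.2) * w)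
     - Normc.normc (h p.1 p.2) ^+ 2) / v))%R.
  have mk : measurable_fun setT k.
    apply: measurableT_comp => //; apply: measurable_funM => //.
    apply: measurable_funB => //; apply: measurable_funM => //.
    by apply: measurable_fun_Re; exact: measurable_fun_mulC.
  transitivity (\int[P]_t G1 (N t p.1 p.2 + h p.1 p.2, clear p (N t))%R).
    apply: eq_integral => t _; rewrite /G1 /=; congr G.
    rewrite -[in LHS](set_entry_id p (N t)) set_entryE /hs big_cons -/(hs s).
    by rewrite scalerDl [RHS]addrAC !addrA.
  transitivity (\int[P]_t
      (G1 (N t p.1 p.2, clear p (N t)) * (k (N t p.1 p.2))%:E)); last first.
    apply: eq_integral => t _; congr (_ * _).
      rewrite /G1 /=; congr G; rewrite addrAC; congr (_ + _)%R.
      by rewrite -set_entryE set_entry_id.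
    by rewrite /e mxE hsp addr0.
  have mG1h : measurable_fun setT
      (fun x : R[i] * 'M[R[i]]_(M, L) => G1 (x.1 + h p.1 p.2, x.2)%R).
    apply: (measurableT_comp mG1); apply: measurable_fun_pair => //.
    exact: measurable_fun_addC.
  apply: etrans (white_noise_entry p mG1h (fun=> G0 _)) _.
  have mG1k : measurable_fun setT (fun x => G1 x * (k x.1)%:E).
    apply: emeasurable_funM => //; apply/measurable_EFinP; exact: measurableT_comp.
  apply: etrans (esym (white_noise_entry p mG1k _)); last first.
    by move=> x; apply: mule_ge0; [exact: G0|rewrite lee_fin expR_ge0].
  apply: eq_integral => t _ /=.
  set B := clear p (N t).
  have c0 : (0 < c)%R by rewrite sqrtr_gt0 divr_gt0.
  have cC : (c%:C != 0 :> R[i])%R by rewrite eq_complex /= eqxx andbT gt_eqF.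
  have mB : measurable_fun setT (fun w => G1 (c%:C * w, B)%R).
    apply: (measurableT_comp mG1); apply: measurable_fun_pair => //.
    exact: measurable_fun_mulC.
  (* In units of the scale [c] the entry is shifted by [c^-1 * h p.1 p.2], which is the form that
     [cgauss_shift] takes. *)
  transitivity (\int[cgauss]_w G1 (c%:C * (w + c%:C^-1 * h p.1 p.2), B)%R).
    by apply: eq_integral => w _; rewrite mulrDr mulrA mulfV// mul1r.
  rewrite (cgauss_shift _ mB (fun=> G0 _)); apply: eq_integral => w _.
  congr (_ * (expR _)%:E).
  have c2 : (c ^+ 2 = v / 2)%R by rewrite sqr_sqrtr// divr_ge0// ltW.
  have cV : (c%:C^-1 = (c^-1)%:C :> R[i])%R.
    by apply: (mulfI cC); rewrite mulfV// -rmorphM/= mulfV// gt_eqF.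
  rewrite cV Normc.normcM exprMn.
  have -> : (Normc.normc (c^-1)%:C ^+ 2 = c^-1 ^+ 2)%R.
    by rewrite /Normc.normc /= expr0n addr0 sqr_sqrtr// sqr_ge0.
  case: (h p.1 p.2) w => a b [x y] /=.
  rewrite !(mul0r, mulr0, subr0, addr0, sub0r, oppr0, add0r).
  have vE : (v = c ^+ 2 * 2)%R by rewrite c2; field.
  move: vE (lt0r_neq0 c0); move: c => cc vE; rewrite vE => cc0.
  by rewrite ?(sqr_sqrtr (addr_ge0 (sqr_ge0 _) (sqr_ge0 _))); field.
move=> mF F0.
have hE : h = hs (index_enum _).
  rewrite /hs [LHS]matrix_sum_delta pair_big/=.
  by apply: eq_bigr => -[].
transitivity (\int[P]_t F (N t + hs (index_enum _))%R).
  by apply: eq_integral => t _; congr (F (_ + _)%R).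
apply: etrans (step _ _ (index_enum_uniq _) mF F0) _.
apply: eq_integral => t _; congr (_ * _%:E).
by rewrite /noise_density expR_sum.
Qed.

End white_noise_law.

(** * Mutual information and densities *)

Lemma measurable_fun_inv_gt0 d (T : measurableType d) (R : realType)
    (f : T -> R) : (forall x, 0 < f x) -> measurable_fun setT f ->
  measurable_fun setT (fun x => (f x)^-1).
Proof.
move=> f0 mf; rewrite (_ : (fun _ => _) = expR \o (-%R \o (@ln R \o f))).
  by apply: measurableT_comp => //; apply: measurableT_comp => //;
    exact: measurableT_comp.
by apply/funext => x /=; rewrite expRN lnK// posrE.
Qed.
Section same_law.
Context d1 d2 d (T1 : measurableType d1) (T2 : measurableType d2)
  (T : measurableType d) (R : realType).
Variables (mu1 : {measure set T1 -> \bar R}) (mu2 : {measure set T2 -> \bar R}).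
Variables (phi1 : T1 -> T) (p1 : T1 -> R) (phi2 : T2 -> T) (p2 : T2 -> R).
Local Open Scope ereal_scope.

(* The image under [phi1] of the measure of density [p1] w.r.t. [mu1] is the
   image under [phi2] of the measure of density [p2] w.r.t. [mu2]. *)
Definition same_law :=
  forall f : T -> \bar R, measurable_fun setT f -> (forall y, 0 <= f y) ->
  \int[mu1]_x (f (phi1 x) * (p1 x)%:E) = \int[mu2]_x (f (phi2 x) * (p2 x)%:E).

Hypotheses (p1_ge0 : forall x, (0 <= p1 x)%R) (p2_ge0 : forall x, (0 <= p2 x)%R).
Hypothesis law12 : same_law.

(** Multiplying by nonnegative weights commutes with taking positive and negative parts, each of
    which is transferred by [law12]. *)
Lemma same_law_integral (f : T -> \bar R) : measurable_fun setT f ->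
  \int[mu1]_x (f (phi1 x) * (p1 x)%:E) = \int[mu2]_x (f (phi2 x) * (p2 x)%:E).
Proof.
move=> mf; rewrite integralE [RHS]integralE; congr (_ - _).
  transitivity (\int[mu1]_x (f^\+ (phi1 x) * (p1 x)%:E)).
    by apply: eq_integral => x _; rewrite !funeposE maxe_pMl ?lee_fin// mul0e.
  rewrite (law12 (measurable_funepos mf) (fun=> funepos_ge0 _ _)).
  by apply: eq_integral => x _; rewrite !funeposE maxe_pMl ?lee_fin// mul0e.
transitivity (\int[mu1]_x (f^\- (phi1 x) * (p1 x)%:E)).
  by apply: eq_integral => x _; rewrite !funenegE maxe_pMl ?lee_fin// mul0e mulNe.
rewrite (law12 (measurable_funeneg mf) (fun=> funeneg_ge0 _ _)).
by apply: eq_integral => x _; rewrite !funenegE maxe_pMl ?lee_fin// mul0e mulNe.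
Qed.

Hypotheses (mphi1 : measurable_fun setT phi1) (mp1 : measurable_fun setT p1).

Lemma same_law_integrable (f : T -> \bar R) : measurable_fun setT f ->
  mu2.-integrable setT (fun x => f (phi2 x) * (p2 x)%:E) ->
  mu1.-integrable setT (fun x => f (phi1 x) * (p1 x)%:E).
Proof.
move=> mf /integrableP[_ foo]; apply/integrableP; split.
  apply: emeasurable_funM; last exact/measurable_EFinP.
  exact: measurableT_comp.
have mabs : measurable_fun setT (fun y => `|f y|) by exact: measurableT_comp.
rewrite (le_lt_trans _ foo)// le_eqVlt; apply/orP; left; apply/eqP.
transitivity (\int[mu1]_x (`|f (phi1 x)| * (p1 x)%:E)).
  by apply: eq_integral => x _; rewrite abseM (@gee0_abs _ (p1 x)%:E)// lee_fin.
rewrite (law12 mabs (fun=> abse_ge0 _)).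
by apply: eq_integral => x _; rewrite abseM (@gee0_abs _ (p2 x)%:E)// lee_fin.
Qed.

End same_law.

Section mutual_information_density.
Context d1 d2 (T1 : measurableType d1) (T2 : measurableType d2) (R : realType).
Variables (nu : probability T1 R) (G : probability T2 R).
Variables (rho : T1 * T2 -> R) (q : T1 -> R).
Hypotheses (mrho : measurable_fun setT rho) (rho_gt0 : forall z, 0 < rho z)
  (mq : measurable_fun setT q) (q_gt0 : forall y, 0 < q y).
Local Open Scope ereal_scope.
Hypothesis rho_dens : forall g, \int[nu]_y (rho (y, g))%:E = 1.
Hypothesis rho_mix : forall y, \int[G]_g (rho (y, g))%:E = (q y)%:E.
Variable J : probability (T1 * T2)%type R.
Hypothesis J_dens : same_law J (nu \x G) idfun (cst 1%R) idfun rho.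

Let J_int (f : T1 * T2 -> \bar R) : measurable_fun setT f ->
  (forall z, 0 <= f z) -> \int[J]_z f z = \int[nu \x G]_z (f z * (rho z)%:E).
Proof.
move=> mf f0; have := J_dens mf f0.
by under eq_integral do rewrite mule1.
Qed.

Let rho_ge0 z : (0 <= rho z)%R. Proof. exact: ltW. Qed.

Notation P1 := (distribution J (fst : {mfun (T1 * T2)%type >-> T1})).
Notation P2 := (distribution J (snd : {mfun (T1 * T2)%type >-> T2})).

Let mprod (f : T1 * T2 -> \bar R) : measurable_fun setT f ->
  measurable_fun setT (fun z => f z * (rho z)%:E).
Proof. by move=> mf; apply: emeasurable_funM => //; exact/measurable_EFinP. Qed.

Let prod_ge0 (f : T1 * T2 -> \bar R) z : (forall z, 0 <= f z) ->
  0 <= f z * (rho z)%:E.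
Proof. by move=> f0; rewrite mule_ge0// lee_fin. Qed.

Let first_marginal (f : T1 -> \bar R) : measurable_fun setT f ->
  (forall y, 0 <= f y) -> \int[P1]_y f y = \int[nu]_y (f y * (q y)%:E).
Proof.
move=> mf f0; rewrite ge0_integral_distribution//.
have mf1 : measurable_fun setT (f \o fst : T1 * T2 -> \bar R).
  exact: measurableT_comp.
rewrite (J_int mf1 (fun=> f0 _)) fubini_tonelli1; last 2 first.
- exact: mprod.
- by move=> z; apply: prod_ge0 => ?; exact: f0.
apply: eq_integral => y _; rewrite /fubini_F /= ge0_integralZl//.
- by rewrite rho_mix.
- by apply/measurable_EFinP; exact: measurable_fun_pair2.
- by move=> g _; rewrite lee_fin.
Qed.

Let second_marginal (f : T2 -> \bar R) : measurable_fun setT f ->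
  (forall y, 0 <= f y) -> \int[P2]_y f y = \int[G]_y f y.
Proof.
move=> mf f0; rewrite ge0_integral_distribution//.
have mf2 : measurable_fun setT (f \o snd : T1 * T2 -> \bar R).
  exact: measurableT_comp.
rewrite (J_int mf2 (fun=> f0 _)) fubini_tonelli2; last 2 first.
- exact: mprod.
- by move=> z; apply: prod_ge0 => ?; exact: f0.
apply: eq_integral => g _; rewrite /fubini_G /= ge0_integralZl//.
- by rewrite rho_dens mule1.
- by apply/measurable_EFinP; exact: measurable_fun_pair1.
- by move=> y _; rewrite lee_fin.
Qed.

Let Pi := product_law P1 P2.

Let mratio : measurable_fun setT (fun z : T1 * T2 => rho z / q z.1)%R.
Proof.
apply: measurable_funM => //; apply: measurable_fun_inv_gt0 => //.
exact: (measurableT_comp mq measurable_fst).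
Qed.

Let ratio_ge0 z : (0 <= rho z / q z.1)%R.
Proof. by rewrite divr_ge0// ltW. Qed.

(** The marginals have density [q] with respect to [nu] and law [G], so [Pi] has density [q z.1]
    with respect to [nu \x G]; multiplying it by [rho / q] gives back the density [rho] of [J]. *)
Let J_ratio A : measurable A -> J A = \int[Pi]_(z in A) (rho z / q z.1)%:E.
Proof.
move=> mA; rewrite integral_mkcond /Pi /product_law.
set h := (fun z : T1 * T2 => (rho z / q z.1)%:E) \_ A.
have mh : measurable_fun setT h.
  apply/(measurable_restrictT _ mA); apply: measurable_funTS.
  exact/measurable_EFinP.
have h0 z : 0 <= h z by rewrite /h patchE; case: ifP => // _; rewrite lee_fin.
rewrite fubini_tonelli1//.
rewrite first_marginal; last 2 first.
- exact: measurable_fun_fubini_tonelli_F.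
- by move=> y; exact: integral_ge0.
have mh2 y : measurable_fun setT (fun g => h (y, g)) by exact: measurable_fun_pair2.
under eq_integral => y _ do rewrite /fubini_F (second_marginal (mh2 y) (fun=> h0 _)).
have -> : J A = \int[J]_z (\1_A z)%:E by rewrite integral_indic// setIT.
have m1A : measurable_fun setT (fun z : T1 * T2 => (\1_A z)%:E : \bar R).
  by apply/measurable_EFinP; exact: measurable_indic.
have i0 (z : T1 * T2) : 0 <= (\1_A z)%:E :> \bar R by rewrite lee_fin.
rewrite (J_int m1A i0) fubini_tonelli1; last 2 first.
- exact: mprod.
- by move=> z; apply: mule_ge0; [exact: i0|rewrite lee_fin].
apply: eq_integral => y _; rewrite /fubini_F muleC -ge0_integralZl//; last first.
  by rewrite lee_fin ltW.
apply: eq_integral => g _; rewrite /h patchE indicE; case: ifP => _.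
  by rewrite mul1e -EFinM mulrC divfK// gt_eqF.
by rewrite mul0e mule0.
Qed.

Let J_Pi : J `<< Pi.
Proof.
apply/null_content_dominatesP => A mA A0; rewrite J_ratio//.
apply: null_set_integral => //.
by apply: measurable_funTS; exact/measurable_EFinP.
Qed.

(** By [J_ratio] the Radon-Nikodym derivative inside [relative_entropy] is [rho / q] almost
    everywhere for [Pi], hence also for [J], which [Pi] dominates. *)
Lemma mutual_info_density :
  mutual_info J = \int[nu \x G]_z ((log2 (rho z / q z.1))%:E * (rho z)%:E).
Proof.
rewrite /mutual_info /relative_entropy -/Pi asboolT//.
have mlog : measurable_fun setT (fun z : T1 * T2 => (log2 (rho z / q z.1))%:E).
  by apply/measurable_EFinP; apply: measurable_funM => //; exact: measurableT_comp.
rewrite -(same_law_integral (fun=> ler01) rho_ge0 J_dens mlog).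
under [RHS]eq_integral do rewrite mule1.
apply: ae_eq_integral => //.
  apply/measurable_EFinP; apply: measurable_funM => //; apply: measurableT_comp => //.
  apply: measurableT_comp => //.
apply: (null_dominates_ae_eq _ J_Pi) => //.
have : ae_eq Pi setT (Radon_Nikodym (charge_of_finite_measure J) Pi)
    (fun z => (rho z / q z.1)%:E).
  apply: integral_ae_eq => //.
  - exact: Radon_Nikodym_integrable.
  - exact/measurable_EFinP.
  - move=> E _ mE; rewrite -Radon_Nikodym_integral//; exact: J_ratio.
by apply: filterS => z + _ => /(_ Logic.I) ->.
Qed.

End mutual_information_density.

(** * The Gaussian channel *)

Section likelihood.
Context {R : realType} (M : nat).
Notation V := 'cV[R[i]]_M.
Implicit Types (u g : V) (s : R).

Definition re_dot g u : R := \sum_m complex.Re (conjc (g m ord0) * u m ord0).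

Definition sq_norm u : R := \sum_m Normc.normc (u m ord0) ^+ 2.

(* likelihood ratio of CN(s g, s) noise with respect to CN(0, s) noise *)
Definition lik s (z : V * V) : R :=
  expR (2 * re_dot z.2 z.1 - s * sq_norm z.2).

Lemma normc_sq (w : R[i]) :
  Normc.normc w ^+ 2 = complex.Re w ^+ 2 + complex.Im w ^+ 2.
Proof. by case: w => x y /=; rewrite sqr_sqrtr// addr_ge0// sqr_ge0. Qed.

Lemma sq_norm_ge0 u : 0 <= sq_norm u.
Proof. by apply: sumr_ge0 => m _; exact: sqr_ge0. Qed.

Lemma re_dot_real g u m : complex.Re (conjc (g m ord0) * u m ord0) =
  complex.Re (g m ord0) * complex.Re (u m ord0) +
  complex.Im (g m ord0) * complex.Im (u m ord0).
Proof. by case: (g m ord0) (u m ord0) => ? ? [? ?] /=; rewrite mulNr opprK. Qed.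

Lemma re_dotDr g u u' : re_dot g (u + u') = re_dot g u + re_dot g u'.
Proof.
by rewrite -big_split; apply: eq_bigr => m _ /=; rewrite mxE mulrDr raddfD.
Qed.

Lemma re_dotNr g u : re_dot g (- u) = - re_dot g u.
Proof.
by rewrite -sumrN; apply: eq_bigr => m _ /=; rewrite mxE mulrN raddfN.
Qed.

Lemma re_dotZ s g : re_dot g (s%:C *: g) = s * sq_norm g.
Proof.
rewrite mulr_sumr; apply: eq_bigr => m _; rewrite re_dot_real normc_sq mxE.
by case: (g m ord0) => x y /=; ring.
Qed.

Lemma sq_norm_shift s g u : sq_norm (u + s%:C *: g) <=
  2 * sq_norm u + 2 * s ^+ 2 * sq_norm g.
Proof.
rewrite !mulr_sumr -big_split; apply: ler_sum => m _ /=.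
rewrite !normc_sq !mxE; case: (g m ord0) (u m ord0) => a b [x y] /=.
rewrite !mul0r subr0 addr0.
by have := sqr_ge0 (x - s * a); have := sqr_ge0 (y - s * b); lra.
Qed.

(** Complete the square: the two sides differ by [|u - s g|^2 / s]. The bound does not involve [g],
    which is what makes the mixture finite. *)
Lemma re_dot_le s g u : 0 < s -> 2 * re_dot g u - s * sq_norm g <= sq_norm u / s.
Proof.
move=> s0; rewrite ler_pdivlMr// !mulr_sumr -sumrB mulr_suml.
apply: ler_sum => m _; rewrite re_dot_real !normc_sq.
case: (g m ord0) (u m ord0) => a b [x y] /=.
by have := sqr_ge0 (x - s * a); have := sqr_ge0 (y - s * b); lra.
Qed.

Lemma normr_re_dot g u : `|2 * re_dot g u| <= sq_norm g + sq_norm u.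
Proof.
have h g' : 2 * re_dot g' u <= sq_norm g' + sq_norm u.
  have := @re_dot_le 1 g' u ltr01; rewrite mul1r divr1; lra.
rewrite ler_norml h andbT lerNl.
have := h (- g).
have -> : re_dot (- g) u = - re_dot g u.
  by rewrite -sumrN; apply: eq_bigr => m _ /=; rewrite !re_dot_real mxE;
     case: (g m ord0) => ? ? /=; ring.
have -> : sq_norm (- g) = sq_norm g.
  by apply: eq_bigr => m _; rewrite !normc_sq mxE; case: (g m ord0) => ? ? /=; ring.
by rewrite mulrN.
Qed.

Lemma lik_gt0 s z : 0 < lik s z. Proof. exact: expR_gt0. Qed.

Lemma lik_ge0 s z : 0 <= lik s z. Proof. exact: expR_ge0. Qed.

Lemma lik_le s u g : 0 < s -> lik s (u, g) <= expR (sq_norm u / s).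
Proof. by move=> s0; rewrite ler_expR; exact: re_dot_le. Qed.

(** Observations of [g] with gains [s] and [s'] amount to their sum, an observation with gain
    [s + s']. This is the source of the martingale property of [mix]. *)
Lemma likD s s' u u' g : lik (s + s') (u + u', g) = lik s (u, g) * lik s' (u', g).
Proof. by rewrite /lik -expRD /= re_dotDr; congr expR; ring. Qed.

Lemma lnlik s z : ln (lik s z) = 2 * re_dot z.2 z.1 - s * sq_norm z.2.
Proof. exact: expRK. Qed.

Lemma measurable_fun_re_dot d (T : measurableType d) (f h : T -> V) :
  measurable_fun setT f -> measurable_fun setT h ->
  measurable_fun setT (fun t => re_dot (f t) (h t)).
Proof.
move=> mf mh; apply: measurable_sum => m; apply: measurable_fun_Re.
apply: measurable_fun_mulC; first apply: measurable_fun_conjC;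
  exact: measurable_fun_entry.
Qed.

Lemma measurable_fun_sq_norm d (T : measurableType d) (f : T -> V) :
  measurable_fun setT f -> measurable_fun setT (fun t => sq_norm (f t)).
Proof.
move=> mf; apply: measurable_sum => m.
have mfm := measurable_fun_entry m ord0 mf.
under eq_fun do rewrite normc_sq.
by apply: measurable_funD; apply: measurable_funX;
  [exact: measurable_fun_Re|exact: measurable_fun_Im].
Qed.

Lemma measurable_lik s : measurable_fun setT (lik s).
Proof.
apply: measurableT_comp => //; apply: measurable_funB; apply: measurable_funM => //.
  by apply: measurable_fun_re_dot.
exact: measurable_fun_sq_norm.
Qed.

End likelihood.

Section mixture.
Context {R : realType} (M : nat).
Notation V := 'cV[R[i]]_M.
Variable G : probability V R.
Local Open Scope ereal_scope.
Implicit Types (u g : V) (s : R).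

(** For [0 < s] the integral is finite, by [mixE], so that [fine] loses nothing there. *)
Definition mix s u : R := fine (\int[G]_g (lik s (u, g))%:E).

Let mlik2 s u : measurable_fun setT (fun g => (lik s (u, g))%:E).
Proof. by apply/measurable_EFinP; apply: measurable_fun_pair2; exact: measurable_lik. Qed.

Lemma mixE s u : (0 < s)%R -> (mix s u)%:E = \int[G]_g (lik s (u, g))%:E.
Proof.
move=> s0; rewrite fineK// ge0_fin_numE; last first.
  by apply: integral_ge0 => g _; rewrite lee_fin lik_ge0.
apply: (@le_lt_trans _ _ (\int[G]_g (expR (sq_norm u / s))%:E)).
  apply: ge0_le_integral => //.
  - by move=> g _; rewrite lee_fin lik_ge0.
  - by move=> g _; rewrite lee_fin lik_le.
by rewrite integral_probability_cst ltry.
Qed.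

Lemma mix_le s u : (0 < s)%R -> (mix s u <= expR (sq_norm u / s))%R.
Proof.
move=> s0; rewrite -lee_fin mixE//.
rewrite -[leRHS](integral_probability_cst G).
apply: ge0_le_integral => //.
- by move=> g _; rewrite lee_fin lik_ge0.
- by move=> g _; rewrite lee_fin lik_le.
Qed.

(** Were the integral of the positive function [lik s (u, _)] zero, the whole space would be
    negligible for the probability [G]. *)
Lemma mix_gt0 s u : (0 < s)%R -> (0 < mix s u)%R.
Proof.
move=> s0; rewrite lt_neqAle; apply/andP; split; last first.
  by apply: fine_ge0; apply: integral_ge0 => g _; rewrite lee_fin lik_ge0.
apply/negP => /eqP mix0.
have : \int[G]_g `|(lik s (u, g))%:E| = 0.
  rewrite -[RHS]/(0%R%:E) mix0 mixE//; apply: eq_integral => g _.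
  by rewrite gee0_abs// lee_fin lik_ge0.
move=> /(ae_eq_integral_abs _ measurableT (mlik2 s u))[A [mA A0 subA]].
have AT : A = setT.
  rewrite -subTset => g _; apply: subA => /= /(_ Logic.I) /eqP.
  by rewrite eqe gt_eqF// lik_gt0.
have := probability_setT G; rewrite -[X in _ X = _]AT => /(etrans (esym A0)) /eqP.
by rewrite eq_sym onee_eq0.
Qed.

Lemma mix_ge0 s u : (0 <= mix s u)%R.
Proof. by apply: fine_ge0; apply: integral_ge0 => g _; rewrite lee_fin lik_ge0. Qed.

Lemma measurable_mix s : measurable_fun setT (mix s).
Proof.
apply: (measurableT_comp (f := fine)) => //.
apply: (@measurable_fun_fubini_tonelli_F _ _ _ _ _ G (fun z => (lik s z)%:E)).
  by apply/measurable_EFinP; exact: measurable_lik.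
by move=> z; rewrite lee_fin lik_ge0.
Qed.

Lemma measurable_lnmix s : measurable_fun setT (fun u => ln (mix s u)).
Proof. by apply: measurableT_comp => //; exact: measurable_mix. Qed.

End mixture.

(** Dominates second moments by exponential moments, which the shift formulas compute. *)
Lemma sqr_le_expR {R : realType} (x : R) :
  x ^+ 2 <= expR (2 * x) + expR (2 * - x).
Proof.
wlog x0 : x / 0 <= x.
  move=> h; have [/h//|/ltW x0] := leP 0 x.
  by have := h (- x); rewrite opprK sqrrN addrC; apply; rewrite oppr_ge0.
apply: ler_wpDr; first exact: expR_ge0.
rewrite mulr_natl mulr2n expRD -expr2 ler_sqr ?nnegrE ?expR_ge0//.
by apply: le_trans (expR_ge1Dx x); rewrite lerDr.
Qed.

(** The concavity bound of [ln] taken at [x^-1]; it is the pointwise source of Gibbs' inequality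
    below. *)
Lemma one_sub_inv_le_ln {R : realType} (x : R) : 0 < x -> 1 - x^-1 <= ln x.
Proof.
move=> x0; have xV0 : 0 < x^-1 by rewrite invr_gt0.
have : ln (1 + (x^-1 - 1)) <= x^-1 - 1 by apply: le_ln1Dx; lra.
by rewrite addrC subrK lnV ?posrE//; lra.
Qed.

(** Pointwise Gibbs inequality between the densities [q] and [q1 * q2 / q0]. The logarithm is split
    into four terms weighted by [q] so that each can be integrated separately. *)
Lemma log_ratio_ge {R : realType} (q q0 q1 q2 : R) :
  0 < q -> 0 < q0 -> 0 < q1 -> 0 < q2 ->
  q - q1 * q2 / q0 <= (ln q * q + ln q0 * q) - (ln q1 * q + ln q2 * q).
Proof.
move=> qp q0p q1p q2p.
have := ler_wpM2r (ltW qp)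
  (one_sub_inv_le_ln (divr_gt0 (mulr_gt0 qp q0p) (mulr_gt0 q1p q2p))).
rewrite ln_div ?posrE ?mulr_gt0// !lnM ?posrE//.
have -> : (1 - (q * q0 / (q1 * q2))^-1) * q = q - q1 * q2 / q0.
  by field; rewrite !gt_eqF.
lra.
Qed.

(** Integrates term by term an inequality of the shape of [log_ratio_ge]. *)
Lemma le_integral_combination d (T : measurableType d) (R : realType)
    (mu : {measure set T -> \bar R}) (f1 f2 f3 f4 f5 f6 : T -> \bar R)
    (a1 a2 a3 a4 a5 a6 : R) :
  mu.-integrable setT f1 -> mu.-integrable setT f2 -> mu.-integrable setT f3 ->
  mu.-integrable setT f4 -> mu.-integrable setT f5 -> mu.-integrable setT f6 ->
  (forall x, f1 x - f2 x <= (f3 x + f4 x) - (f5 x + f6 x))%E ->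
  (\int[mu]_x f1 x = a1%:E)%E -> (\int[mu]_x f2 x = a2%:E)%E ->
  (\int[mu]_x f3 x = a3%:E)%E -> (\int[mu]_x f4 x = a4%:E)%E ->
  (\int[mu]_x f5 x = a5%:E)%E -> (\int[mu]_x f6 x = a6%:E)%E ->
  a1 - a2 <= (a3 + a4) - (a5 + a6).
Proof.
move=> i1 i2 i3 i4 i5 i6 le_f e1 e2 e3 e4 e5 e6.
rewrite -lee_fin !(EFinB, EFinD) -e1 -e2 -e3 -e4 -e5 -e6.
have i34 := integrableD measurableT i3 i4; have i56 := integrableD measurableT i5 i6.
rewrite -(integralB measurableT i1 i2) -(integralD measurableT i3 i4).
rewrite -(integralD measurableT i5 i6) -(integralB measurableT i34 i56).
apply: le_integral => //; first exact: (integrableB measurableT i1 i2).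
exact: (integrableB measurableT i34 i56).
Qed.

(** * Information carried by the Gaussian channel *)

Section gaussian_channel.
Context {R : realType} (M : nat).
Notation V := 'cV[R[i]]_M.
Variables (gam : R -> probability V R) (G : probability V R).
Local Open Scope ereal_scope.
Implicit Types (u g : V) (s : R) (F : V -> \bar R).

Hypothesis gam_shift : forall s g F, (0 < s)%R ->
  measurable_fun setT F -> (forall u, 0 <= F u) ->
  \int[gam s]_u F (u + s%:C *: g)%R = \int[gam s]_u (F u * (lik s (u, g))%:E).
Hypothesis gam_add : forall s a F, (0 < s)%R -> (0 < a)%R ->
  measurable_fun setT F -> (forall u, 0 <= F u) ->
  \int[gam s]_u \int[gam a]_u' F (u + u')%R = \int[gam (s + a)%R]_u F u.
Hypothesis gam_opp : forall s F, (0 < s)%R ->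
  measurable_fun setT F -> (forall u, 0 <= F u) ->
  \int[gam s]_u F (- u)%R = \int[gam s]_u F u.
Hypothesis G_sq : \int[G]_g (sq_norm g)%:E < +oo.

Let measurable_V_lik s g : measurable_fun setT (fun u => (lik s (u, g))%:E).
Proof. by apply/measurable_EFinP; apply: measurable_fun_pair1; exact: measurable_lik. Qed.

Let measurable_G_lik s u : measurable_fun setT (fun g => (lik s (u, g))%:E).
Proof. by apply/measurable_EFinP; apply: measurable_fun_pair2; exact: measurable_lik. Qed.

Let measurable_addV u : measurable_fun setT (fun u' : V => u + u')%R.
Proof. exact: measurable_fun_addmx. Qed.

Lemma lik_int s g : (0 < s)%R -> \int[gam s]_u (lik s (u, g))%:E = 1.
Proof.
move=> s0; rewrite -[RHS](integral_probability_cst (gam s)).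
rewrite (gam_shift g s0 (measurable_cst (1 : \bar R)) (fun=> lee01)).
by under [RHS]eq_integral do rewrite mul1e.
Qed.

Let gam_exp s g : (0 < s)%R ->
  \int[gam s]_u (expR (2 * re_dot g u))%:E = (expR (s * sq_norm g))%:E.
Proof.
move=> s0; rewrite -[RHS]mule1 -(lik_int g s0) -ge0_integralZl//.
- by apply: eq_integral => u _; rewrite -EFinM -expRD /=; congr (expR _)%:E; ring.
- by move=> u _; rewrite lee_fin lik_ge0.
Qed.

Let unit_vec (z : R[i]) (m : 'I_M) : V := z *: delta_mx m ord0.

Let re_dot_unit (z : R[i]) m u :
  re_dot (unit_vec z m) u = complex.Re (conjc z * u m ord0)%R.
Proof.
rewrite /re_dot (bigD1 m)//= big1 ?addr0; last first.
  by move=> k km; rewrite !mxE (negbTE km) mulr0 rmorph0 mul0r.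
by rewrite !mxE !eqxx mulr1.
Qed.

(** In each coordinate, the exponentials in the directions 1, -1, i and -i dominate the squared
    modulus by [sqr_le_expR], and [gam_exp] gives their integrals. *)
Lemma gam_sq s : (0 < s)%R -> \int[gam s]_u (sq_norm u)%:E < +oo.
Proof.
move=> s0.
pose e z m u : R := expR (2 * re_dot (unit_vec z m) u).
pose z1 : R[i] := (1%R +i* 0%R)%C; pose z2 : R[i] := ((- 1)%R +i* 0%R)%C.
pose z3 : R[i] := (0%R +i* 1%R)%C; pose z4 : R[i] := (0%R +i* (- 1)%R)%C.
pose b m u : R := (e z1 m u + e z2 m u + e z3 m u + e z4 m u)%R.
have me z m : measurable_fun setT (e z m).
  apply: measurableT_comp => //; apply: measurable_funM => //.
  exact: measurable_fun_re_dot.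
have mb m : measurable_fun setT (fun u => (b m u)%:E).
  by apply/measurable_EFinP; do 3 apply: measurable_funD => //.
have b0 m u : (0 <= b m u)%R by rewrite !addr_ge0 ?expR_ge0.
apply: (@le_lt_trans _ _ (\int[gam s]_u \sum_m (b m u)%:E)).
  apply: ge0_le_integral => //.
  - by move=> u _; rewrite lee_fin sq_norm_ge0.
  - by apply/measurable_EFinP; exact: measurable_fun_sq_norm.
  - exact: emeasurable_sum.
  - move=> u _; rewrite sumEFin lee_fin; apply: ler_sum => m _.
    rewrite normc_sq /b /e !re_dot_unit.
    case: (u m ord0) => x y /=.
    rewrite ?(mul1r, mul0r, mulN1r, oppr0, subr0, addr0, sub0r, opprK, add0r).
    have := sqr_le_expR x; have := sqr_le_expR y; lra.
rewrite ge0_integral_sum//; last by move=> m u _; rewrite lee_fin.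
apply: lte_sum_pinfty => m _.
under eq_integral do rewrite !EFinD.
have mE z : measurable_fun setT (fun u => (e z m u)%:E) by exact/measurable_EFinP.
have E0 z u : 0 <= (e z m u)%:E by rewrite lee_fin expR_ge0.
rewrite !ge0_integralD//; last 4 first.
- by move=> u _; rewrite adde_ge0.
- exact: emeasurable_funD.
- by move=> u _; rewrite !adde_ge0.
- by do 2 apply: emeasurable_funD => //.
have elt z : \int[gam s]_u (e z m u)%:E < +oo.
  apply: (@le_lt_trans _ _ (expR (s * sq_norm (unit_vec z m)))%:E); last exact: ltry.
  by rewrite le_eqVlt; apply/orP; left; apply/eqP; exact: gam_exp.
exact: lte_add_pinfty
  (lte_add_pinfty (lte_add_pinfty (elt z1) (elt z2)) (elt z3)) (elt z4).
Qed.

Let gG s : probability (V * V)%type R := (gam s \x G)%E.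

Let measurable_gG_lik s : measurable_fun setT (fun z : V * V => (lik s z)%:E).
Proof. by apply/measurable_EFinP; exact: measurable_lik. Qed.

Let EFin_lik_ge0 s (z : V * V) : 0 <= (lik s z)%:E.
Proof. by rewrite lee_fin lik_ge0. Qed.

(** Likelihood martingale: by [likD] the new observation multiplies [lik t (u, g)] by
    [lik b (u', g)], which has mean 1 under pure noise for every [g]. *)
Lemma mix_martingale t b u : (0 < t)%R -> (0 < b)%R ->
  \int[gam b]_u' (mix G (t + b) (u + u'))%:E = (mix G t u)%:E.
Proof.
move=> t0 b0.
pose f (z : V * V) := (lik t (u, z.2))%:E * (lik b z)%:E.
have mf : measurable_fun setT f.
  by apply: emeasurable_funM => //; exact: (measurableT_comp (measurable_G_lik t u)).
transitivity (\int[gam b]_u' \int[G]_g f (u', g)).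
  apply: eq_integral => u' _; rewrite (mixE G _ (addr_gt0 t0 b0)).
  by apply: eq_integral => g _; rewrite likD EFinM.
apply: etrans (@fubini_tonelli _ _ _ _ _ (gam b) G f mf _) _.
  by move=> z; apply: mule_ge0.
rewrite (mixE G _ t0); apply: eq_integral => g _; rewrite /f /=.
by rewrite ge0_integralZl// (lik_int _ b0) mule1.
Qed.

Lemma law_mix s : (0 < s)%R ->
  same_law (gG s) (gam s) fst (lik s) idfun (mix G s).
Proof.
move=> s0 f mf f0.
have mf1 : measurable_fun setT (fun z : V * V => f z.1 * (lik s z)%:E).
  by apply: emeasurable_funM => //; exact: (measurableT_comp mf measurable_fst).
rewrite (@fubini_tonelli1 _ _ _ _ _ _ _ _ mf1); last first.
  by move=> z; exact: mule_ge0.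
apply: eq_integral => u _; rewrite /fubini_F /= ge0_integralZl//.
by rewrite mixE.
Qed.

Let law_mix_sym s : (0 < s)%R ->
  same_law (gam s) (gG s) idfun (mix G s) fst (lik s).
Proof. by move=> s0 f mf f0; rewrite (law_mix s0 mf f0). Qed.

Let shift s (z : V * V) : V * V := (z.1 + s%:C *: z.2, z.2)%R.

Let measurable_shift s : measurable_fun setT (shift s).
Proof.
apply: measurable_fun_pair => //; apply: measurable_fun_addmx => //.
exact: measurable_fun_scalemx.
Qed.

(** Reweighting pure noise by the likelihood amounts to adding the signal [s g] to it. Averages
    under the channel thus become averages over independent noise and [g]. *)
Let law_shift s : (0 < s)%R ->
  same_law (gG s) (gG s) idfun (lik s) (shift s) (cst 1%R).
Proof.
move=> s0 f mf f0.
have mf1 : measurable_fun setT (fun z : V * V => f z * (lik s z)%:E).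
  exact: emeasurable_funM.
rewrite (@fubini_tonelli2 _ _ _ _ _ _ _ _ mf1); last by move=> z; exact: mule_ge0.
under [RHS]eq_integral do rewrite mule1.
have mf2 := measurableT_comp mf (measurable_shift s).
rewrite (@fubini_tonelli2 _ _ _ _ _ _ _ _ mf2); last by move=> z; exact: f0.
apply: eq_integral => g _; apply/esym.
exact: (gam_shift g s0 (measurable_fun_pair1 _ mf) (fun=> f0 _)).
Qed.

Let sq_norm1_integrable s : (0 < s)%R ->
  (gG s).-integrable setT (fun z : V * V => (sq_norm z.1)%:E).
Proof.
move=> s0; apply/integrable12ltyP.
  by apply/measurable_EFinP; exact: measurable_fun_sq_norm.
rewrite (_ : integral _ _ _ = \int[gam s]_u (sq_norm u)%:E) ?gam_sq//.
apply: eq_integral => u _; rewrite -[RHS](integral_probability_cst G).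
by apply: eq_integral => g _; rewrite gee0_abs// lee_fin sq_norm_ge0.
Qed.

Let sq_norm2_integrable s :
  (gG s).-integrable setT (fun z : V * V => (sq_norm z.2)%:E).
Proof.
apply/integrable21ltyP.
  by apply/measurable_EFinP; exact: measurable_fun_sq_norm.
rewrite (_ : integral _ _ _ = \int[G]_u (sq_norm u)%:E) ?G_sq//.
apply: eq_integral => u _; rewrite -[RHS](integral_probability_cst (gam s)).
by apply: eq_integral => g _; rewrite gee0_abs// lee_fin sq_norm_ge0.
Qed.

Let re_dot_integrable s : (0 < s)%R ->
  (gG s).-integrable setT (fun z : V * V => (2 * re_dot z.2 z.1)%:E).
Proof.
move=> s0; apply: (@le_integrable _ _ _ _ _ measurableT _
    (fun z => (sq_norm z.2)%:E + (sq_norm z.1)%:E)).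
- apply/measurable_EFinP; apply: measurable_funM => //.
  exact: measurable_fun_re_dot.
- move=> z _; rewrite -EFinD !abse_EFin lee_fin.
  by rewrite (ger0_norm (addr_ge0 (sq_norm_ge0 _) (sq_norm_ge0 _))) normr_re_dot.
- by apply: integrableD => //; [exact: sq_norm2_integrable|exact: sq_norm1_integrable].
Qed.

(** The noise is symmetric, so the integral equals its own opposite; being finite, it vanishes. *)
Let re_dot_mean s : (0 < s)%R -> \int[gG s]_z (2 * re_dot z.2 z.1)%:E = 0.
Proof.
move=> s0; set f := (fun z : V * V => _).
have mf : measurable_fun setT f.
  by apply/measurable_EFinP; apply: measurable_funM => //; exact: measurable_fun_re_dot.
have mopp : measurable_fun setT (fun z : V * V => (- z.1, z.2)%R).
  apply: measurable_fun_pair => //; apply: measurable_fun_mx => i j.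
  under eq_fun do rewrite mxE -mulN1r.
  apply: measurable_fun_mulC => //.
  exact: (measurableT_comp (measurable_entry i j) measurable_fst).
have law_opp : same_law (gG s) (gG s) (fun z : V * V => (- z.1, z.2)%R)
    (cst 1%R) idfun (cst 1%R).
  move=> h mh h0; under eq_integral do rewrite mule1.
  under [RHS]eq_integral do rewrite mule1.
  rewrite (@fubini_tonelli2 _ _ _ _ _ _ _ _ (measurableT_comp mh mopp) (fun=> h0 _)).
  rewrite (@fubini_tonelli2 _ _ _ _ _ _ _ _ mh h0).
  apply: eq_integral => g _.
  exact: (gam_opp s0 (measurable_fun_pair1 _ mh) (fun=> h0 _)).
have := same_law_integral (fun=> ler01) (fun=> ler01) law_opp mf.
under eq_integral do rewrite mule1.
under [X in _ = X -> _]eq_integral do rewrite mule1.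
rewrite (_ : integral _ _ _ = - \int[gG s]_z f z); last first.
  rewrite -integralN; last by apply: integrable_add_def => //; exact: re_dot_integrable.
  by apply: eq_integral => z _; rewrite /f /= re_dotNr mulrN EFinN.
have := integrable_fin_num measurableT (re_dot_integrable s0).
rewrite -/f; case: (\int[gG s]_z f z) => // r _ [] r0.
by congr EFin; lra.
Qed.

Let power : R := fine (\int[G]_g (sq_norm g)%:E).

Let lnlik_shift s z : ((ln (lik s (shift s z)))%:E * 1 =
   (2 * re_dot z.2 z.1)%:E + (s * sq_norm z.2)%:E).
Proof. by rewrite mule1 lnlik /shift /= re_dotDr re_dotZ -EFinD; congr EFin; ring. Qed.

Let measurable_lnlik s : measurable_fun setT (fun z : V * V => (ln (lik s z))%:E).
Proof.
by apply/measurable_EFinP; apply: measurableT_comp => //; exact: measurable_lik.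
Qed.

Let lnlik_integrable s : (0 < s)%R ->
  (gG s).-integrable setT (fun z => (ln (lik s z))%:E * (lik s z)%:E).
Proof.
move=> s0; apply: (same_law_integrable (lik_ge0 s) (fun=> ler01)
    (law_shift s0) (@measurable_id _ _ _) (measurable_lik s) (measurable_lnlik s)).
  under eq_fun do rewrite lnlik_shift.
  apply: integrableD => //; first exact: re_dot_integrable.
  under eq_fun do rewrite EFinM.
  by apply: integrableZl => //; exact: sq_norm2_integrable.
Qed.

(** Once the signal is added to the noise, [ln (lik s)] becomes [s |g|^2] plus the cross term, of
    mean 0. *)
Let lnlik_integral s : (0 < s)%R ->
  \int[gG s]_z ((ln (lik s z))%:E * (lik s z)%:E) = (s * power)%:E.
Proof.
move=> s0.
rewrite (same_law_integral (lik_ge0 s) (fun=> ler01) (law_shift s0) (measurable_lnlik s)).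
under eq_integral do rewrite lnlik_shift.
have sq_int : (gG s).-integrable setT (fun z : V * V => (s * sq_norm z.2)%:E).
  under eq_fun do rewrite EFinM.
  by apply: integrableZl => //; exact: sq_norm2_integrable.
rewrite (integralD measurableT (re_dot_integrable s0) sq_int) re_dot_mean// add0e.
under eq_integral do rewrite EFinM.
rewrite (integralZl measurableT (sq_norm2_integrable s)) EFinM; congr (_ * _).
have mG : measurable_fun setT (fun z : V * V => (sq_norm z.2)%:E).
  by apply/measurable_EFinP; exact: measurable_fun_sq_norm.
rewrite (@fubini_tonelli2 _ _ _ _ _ _ _ _ mG); last first.
  by move=> z; rewrite lee_fin sq_norm_ge0.
rewrite /power fineK; last first.
  by rewrite ge0_fin_numE//; apply: integral_ge0 => g _; rewrite lee_fin sq_norm_ge0.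
by apply: eq_integral => g _; rewrite /fubini_G /= (integral_probability_cst (gam s)).
Qed.

Let mlnmix s : measurable_fun setT (fun u => (ln (mix G s u))%:E).
Proof. by apply/measurable_EFinP; exact: measurable_lnmix. Qed.

(** [mix ln mix] lies between [mix - 1] and [|u|^2 mix / s], the latter by [mix_le], so it is enough
    that the channel output has a finite second moment. *)
Lemma lnmix_integrable s : (0 < s)%R ->
  (gam s).-integrable setT (fun u => (ln (mix G s u))%:E * (mix G s u)%:E).
Proof.
move=> s0.
have sq_int : (gam s).-integrable setT (fun u => (sq_norm u)%:E * (mix G s u)%:E).
  have msq1 : measurable_fun setT (fun z : V * V => (sq_norm z.1)%:E).
    by apply/measurable_EFinP; exact: measurable_fun_sq_norm.
  have msq : measurable_fun setT (fun u : V => (sq_norm u)%:E).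
    by apply/measurable_EFinP; exact: measurable_fun_sq_norm.
  (* Pass from the output law to the joint law, then by [law_shift] to independent noise and signal,
     where [sq_norm_shift] bounds the square of the sum. *)
  apply: (same_law_integrable (mix_ge0 G s) (lik_ge0 s)
    (law_mix_sym s0) (@measurable_id _ _ _) (measurable_mix G s) msq).
  apply: (same_law_integrable (lik_ge0 s) (fun=> ler01)
    (law_shift s0) (@measurable_id _ _ _) (measurable_lik s) msq1).
  apply: (@le_integrable _ _ _ _ _ measurableT _
      (fun z => 2%:E * (sq_norm z.1)%:E + (2 * s ^+ 2)%:E * (sq_norm z.2)%:E)).
  - apply: emeasurable_funM => //.
    exact: (measurableT_comp msq1 (measurable_shift s)).
  - move=> z _; rewrite mule1 -!EFinM -EFinD !abse_EFin lee_fin.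
    rewrite ger0_norm ?sq_norm_ge0// ger0_norm; last first.
      apply: addr_ge0; first by rewrite mulr_ge0// sq_norm_ge0.
      by apply: mulr_ge0; rewrite ?sq_norm_ge0// mulr_ge0// sqr_ge0.
    exact: sq_norm_shift.
  - by apply: integrableD => //; apply: integrableZl => //;
      [exact: sq_norm1_integrable|exact: sq_norm2_integrable].
apply: (@le_integrable _ _ _ _ _ measurableT _
    (fun u => 1 + (s^-1)%:E * ((sq_norm u)%:E * (mix G s u)%:E))).
- by apply: emeasurable_funM => //; apply/measurable_EFinP; exact: measurable_mix.
- move=> u _; rewrite -!EFinM -EFinD !abse_EFin lee_fin.
  have m0 := mix_gt0 G u s0; have n0 := sq_norm_ge0 u.
  have si0 : (0 < s^-1)%R by rewrite invr_gt0.
  have b0 : (0 <= s^-1 * (sq_norm u * mix G s u))%R.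
    by rewrite mulr_ge0 ?(ltW si0)// mulr_ge0// ltW.
  rewrite [leRHS]ger0_norm ?addr_ge0// ler_norml; apply/andP; split.
    have := one_sub_inv_le_ln m0; rewrite -(ler_pM2r m0) mulrBl mul1r mulVf ?gt_eqF//.
    lra.
  have : (ln (mix G s u) <= sq_norm u / s)%R.
    by rewrite -ler_expR lnK ?posrE//; exact: mix_le.
  rewrite -(ler_pM2r m0) => h.
  by rewrite (le_trans h)// mulrAC mulrC ler_wpDl.
- apply: integrableD => //; last exact: integrableZl.
  exact: finite_measure_integrable_cst.
Qed.

(** The divergence, in nats, of the channel output from pure noise of the same level. *)
Definition mix_entropy s : R := fine (\int[gam s]_u ((ln (mix G s u))%:E * (mix G s u)%:E)).

Lemma mix_entropyE s : (0 < s)%R ->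
  \int[gam s]_u ((ln (mix G s u))%:E * (mix G s u)%:E) = (mix_entropy s)%:E.
Proof.
by move=> s0; rewrite fineK//; apply: integrable_fin_num => //; exact: lnmix_integrable.
Qed.

Let log_ratioE s z : (0 < s)%R ->
  (ln (lik s z / mix G s z.1))%:E * (lik s z)%:E =
  (ln (lik s z))%:E * (lik s z)%:E - (ln (mix G s z.1))%:E * (lik s z)%:E.
Proof.
by move=> s0; rewrite ln_div ?posrE ?lik_gt0 ?mix_gt0// -!EFinM -EFinB mulrBl.
Qed.

Let lnmix1_integrable s : (0 < s)%R ->
  (gG s).-integrable setT (fun z => (ln (mix G s z.1))%:E * (lik s z)%:E).
Proof.
move=> s0; apply: (same_law_integrable (lik_ge0 s) (mix_ge0 G s)
  (law_mix s0) measurable_fst (measurable_lik s) (mlnmix s)).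
exact: lnmix_integrable.
Qed.

Lemma channel_information_integrable s : (0 < s)%R -> (gG s).-integrable setT
  (fun z => (ln (lik s z / mix G s z.1))%:E * (lik s z)%:E).
Proof.
move=> s0; rewrite (eq_fun (fun z => log_ratioE z s0)).
exact: (integrableB measurableT (lnlik_integrable s0) (lnmix1_integrable s0)).
Qed.

(** The divergence of the pair from independent noise and [g], namely [s * power], less that of the
    output from pure noise. *)
Lemma channel_information s : (0 < s)%R ->
  \int[gG s]_z ((ln (lik s z / mix G s z.1))%:E * (lik s z)%:E) =
  (s * power - mix_entropy s)%:E.
Proof.
move=> s0; transitivity (\int[gG s]_z ((ln (lik s z))%:E * (lik s z)%:E -
    (ln (mix G s z.1))%:E * (lik s z)%:E)).
  by apply: eq_integral => z _; exact: log_ratioE.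
rewrite (integralB measurableT (lnlik_integrable s0) (lnmix1_integrable s0)).
rewrite lnlik_integral// EFinB -mix_entropyE//; congr (_ - _).
exact: (same_law_integral (lik_ge0 s) (mix_ge0 G s) (law_mix s0) (mlnmix s)).
Qed.

Let lik_mass s : (0 < s)%R -> \int[gG s]_z (lik s z)%:E = 1.
Proof.
move=> s0; rewrite (@fubini_tonelli2 _ _ _ _ _ _ _ _ (measurable_gG_lik s))//.
rewrite -[RHS](integral_probability_cst G); apply: eq_integral => g _.
exact: lik_int.
Qed.

Let mix_mass s : (0 < s)%R -> \int[gam s]_u (mix G s u)%:E = 1.
Proof.
move=> s0; rewrite -(lik_mass s0).
transitivity (\int[gam s]_u (1 * (mix G s u)%:E)).
  by apply: eq_integral => u _; rewrite mul1e.
rewrite -(law_mix s0 (measurable_cst (1 : \bar R)) (fun=> lee01)).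
by apply: eq_integral => z _; rewrite mul1e.
Qed.

Let lik_integrable s : (0 < s)%R ->
  (gG s).-integrable setT (fun z => (lik s z)%:E).
Proof.
move=> s0; apply/integrableP; split => //.
rewrite (eq_integral (fun z => (lik s z)%:E)) ?lik_mass ?ltry// => z _.
by rewrite gee0_abs.
Qed.

Let EFin_mix_ge0 s u : 0 <= (mix G s u)%:E.
Proof. by rewrite lee_fin mix_ge0. Qed.

Let mmix s : measurable_fun setT (fun u => (mix G s u)%:E).
Proof. by apply/measurable_EFinP; exact: measurable_mix. Qed.

Let mmix1 s : measurable_fun setT (fun z : V * V => (mix G s z.1)%:E).
Proof. exact: (measurableT_comp (mmix s) measurable_fst). Qed.

Let mix_mass1 s : (0 < s)%R -> \int[gG s]_z (mix G s z.1)%:E = 1.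
Proof.
move=> s0; rewrite (@fubini_tonelli1 _ _ _ _ _ _ _ _ (mmix1 s))//.
rewrite -[RHS](mix_mass s0); apply: eq_integral => u _.
by rewrite /fubini_F /= (integral_probability_cst G).
Qed.

Let mix1_integrable s : (0 < s)%R ->
  (gG s).-integrable setT (fun z => (mix G s z.1)%:E).
Proof.
move=> s0; apply/integrableP; split => //.
rewrite (eq_integral (fun z : V * V => (mix G s z.1)%:E)) ?mix_mass1 ?ltry// => z _.
by rewrite gee0_abs.
Qed.

(** The information is nonnegative: [lik ln (lik / mix) >= lik - mix] pointwise, and the right-hand
    side has integral 0. *)
Lemma mix_entropy_le s : (0 < s)%R -> (mix_entropy s <= s * power)%R.
Proof.
move=> s0; rewrite -subr_ge0 -lee_fin -(channel_information s0).
have e0 : \int[gG s]_z ((lik s z)%:E - (mix G s z.1)%:E) = 0.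
  rewrite (integralB measurableT (lik_integrable s0) (mix1_integrable s0)).
  by rewrite lik_mass// mix_mass1// subee.
apply: (@le_trans _ _ (\int[gG s]_z ((lik s z)%:E - (mix G s z.1)%:E))).
  by rewrite e0.
apply: le_integral => //.
- exact: integrableB (lik_integrable s0) (mix1_integrable s0).
- apply: (eq_integrable measurableT _ _ _ (integrableB measurableT (lnlik_integrable s0)
    (same_law_integrable (lik_ge0 s) (mix_ge0 G s) (law_mix s0) measurable_fst
       (measurable_lik s) (mlnmix s) (lnmix_integrable s0)))) => z _.
  by rewrite /= ln_div ?posrE ?lik_gt0 ?mix_gt0// -!EFinM -EFinB mulrBl.
- move=> z _; rewrite -EFinB -EFinM lee_fin.
  have l0 := lik_gt0 s z; have m0 := mix_gt0 G z.1 s0.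
  have := ler_wpM2r (ltW l0) (one_sub_inv_le_ln (divr_gt0 l0 m0)).
  have -> // : ((1 - (lik s z / mix G s z.1)^-1) * lik s z = lik s z - mix G s z.1)%R.
  by field; rewrite !gt_eqF.
Qed.

Section submodularity.
Variables (s a b : R).
Hypotheses (s0 : (0 < s)%R) (a0 : (0 < a)%R) (b0 : (0 < b)%R).

Let W : probability (V * (V * V))%type R := (gam s \x (gam a \x gam b))%E.

Let tonelli (h : V * (V * V) -> \bar R) : measurable_fun setT h ->
  (forall z, 0 <= h z) ->
  \int[W]_z h z = \int[gam s]_u0 \int[gam a]_u1 \int[gam b]_u2 h (u0, (u1, u2)).
Proof.
move=> mh h0; rewrite (@fubini_tonelli1 _ _ _ _ _ _ _ _ mh h0).
apply: eq_integral => u0 _; rewrite /fubini_F.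
by rewrite (@fubini_tonelli1 _ _ _ _ _ _ _ _ (measurable_fun_pair2 _ mh) (fun=> h0 _)).
Qed.

Let tonelli' (h : V * (V * V) -> \bar R) : measurable_fun setT h ->
  (forall z, 0 <= h z) ->
  \int[W]_z h z = \int[gam s]_u0 \int[gam b]_u2 \int[gam a]_u1 h (u0, (u1, u2)).
Proof.
move=> mh h0; rewrite (@fubini_tonelli1 _ _ _ _ _ _ _ _ mh h0).
apply: eq_integral => u0 _; rewrite /fubini_F.
by rewrite (@fubini_tonelli2 _ _ _ _ _ _ _ _ (measurable_fun_pair2 _ mh) (fun=> h0 _)).
Qed.

Let m1 : measurable_fun setT (fun z : V * (V * V) => z.2.1).
Proof. exact: (measurableT_comp measurable_fst measurable_snd). Qed.

Let m2 : measurable_fun setT (fun z : V * (V * V) => z.2.2).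
Proof. exact: (measurableT_comp measurable_snd measurable_snd). Qed.

Let tot (z : V * (V * V)) : V := (z.1 + (z.2.1 + z.2.2))%R.
Let fst01 (z : V * (V * V)) : V := (z.1 + z.2.1)%R.
Let fst02 (z : V * (V * V)) : V := (z.1 + z.2.2)%R.

Let mtot : measurable_fun setT tot.
Proof. by apply: measurable_fun_addmx => //; exact: measurable_fun_addmx. Qed.

Let mfst01 : measurable_fun setT fst01.
Proof. exact: measurable_fun_addmx. Qed.

Let mfst02 : measurable_fun setT fst02.
Proof. exact: measurable_fun_addmx. Qed.

(** By [likD], the density with respect to [W] of three observations of [g] with gains [s], [a], [b]
    and independent noises. *)
Let Q z := mix G (s + (a + b)) (tot z).

Let mQ : measurable_fun setT Q.
Proof. exact: (measurableT_comp (measurable_mix G _) mtot). Qed.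

Let Q_ge0 z : (0 <= Q z)%R. Proof. exact: mix_ge0. Qed.

Let mfQ (phi : V * (V * V) -> V) (f : V -> \bar R) : measurable_fun setT phi ->
  measurable_fun setT f -> measurable_fun setT (fun z => f (phi z) * (Q z)%:E).
Proof.
move=> mphi mf; apply: emeasurable_funM; last exact/measurable_EFinP.
exact: measurableT_comp.
Qed.

Let law_tot : same_law W (gam (s + (a + b))%R) tot Q idfun (mix G (s + (a + b))).
Proof.
move=> f mf f0; have ab0 := addr_gt0 a0 b0.
pose k u := f u * (mix G (s + (a + b)) u)%:E.
have mk : measurable_fun setT k by apply: emeasurable_funM => //; exact: mmix.
have k0 u : 0 <= k u by apply: mule_ge0.
rewrite (tonelli (mfQ mtot mf)); last by move=> z; apply: mule_ge0; rewrite ?lee_fin.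
rewrite -(gam_add s0 ab0 mk k0); apply: eq_integral => u0 _.
rewrite -(gam_add a0 b0 (measurableT_comp mk (measurable_addV u0)) (fun=> k0 _)).
by [].
Qed.

(** Under the density [Q], the sum of the first two observations is distributed as the channel
    output at level [s + a]: the third one is integrated out by [mix_martingale]. *)
Let law_fst01 : same_law W (gam (s + a)%R) fst01 Q idfun (mix G (s + a)).
Proof.
move=> f mf f0; have sa0 := addr_gt0 s0 a0.
have mk : measurable_fun setT (fun u => f u * (mix G (s + a) u)%:E).
  by apply: emeasurable_funM => //; exact: mmix.
rewrite (tonelli (mfQ mfst01 mf)); last by move=> z; apply: mule_ge0; rewrite ?lee_fin.
rewrite -(gam_add s0 a0 mk); last by move=> u; exact: mule_ge0.
apply: eq_integral => u0 _; apply: eq_integral => u1 _.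
transitivity (\int[gam b]_u2 (f (u0 + u1)%R *
    (mix G (s + (a + b)) (u0 + (u1 + u2)))%:E)); first by [].
rewrite ge0_integralZl//; last first.
  by apply: (measurableT_comp (mmix _)); do 2 apply: measurable_fun_addmx => //.
congr (_ * _); apply: etrans _ (mix_martingale (u0 + u1)%R sa0 b0).
by apply: eq_integral => u2 _; rewrite /Q /tot /= !addrA.
Qed.

Let law_fst02 : same_law W (gam (s + b)%R) fst02 Q idfun (mix G (s + b)).
Proof.
move=> f mf f0; have sb0 := addr_gt0 s0 b0.
have mk : measurable_fun setT (fun u => f u * (mix G (s + b) u)%:E).
  by apply: emeasurable_funM => //; exact: mmix.
rewrite (tonelli' (mfQ mfst02 mf)); last by move=> z; apply: mule_ge0; rewrite ?lee_fin.
rewrite -(gam_add s0 b0 mk); last by move=> u; exact: mule_ge0.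
apply: eq_integral => u0 _; apply: eq_integral => u2 _.
transitivity (\int[gam a]_u1 (f (u0 + u2)%R *
    (mix G (s + (a + b)) (u0 + (u1 + u2)))%:E)); first by [].
rewrite ge0_integralZl//; last first.
  by apply: (measurableT_comp (mmix _)); do 2 apply: measurable_fun_addmx => //.
congr (_ * _); apply: etrans _ (mix_martingale (u0 + u2)%R sb0 a0).
have e1 : (s + (a + b) = s + b + a)%R by rewrite addrA addrAC.
apply: eq_integral => u1 _; rewrite e1.
by have -> : (u0 + (u1 + u2) = u0 + u2 + u1)%R by rewrite addrA addrAC.
Qed.

Let law_fst0 : same_law W (gam s) fst Q idfun (mix G s).
Proof.
move=> f mf f0; have ab0 := addr_gt0 a0 b0.
rewrite (tonelli (mfQ measurable_fst mf)); last first.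
  by move=> z; apply: mule_ge0; rewrite ?lee_fin.
apply: eq_integral => u0 _.
have mk : measurable_fun setT (fun w => f u0 * (mix G (s + (a + b)) (u0 + w)%R)%:E).
  apply: emeasurable_funM => //.
  exact: (measurableT_comp (mmix _) (measurable_addV u0)).
rewrite (gam_add a0 b0 mk); last by move=> w; exact: mule_ge0.
rewrite ge0_integralZl//; last first.
  exact: (measurableT_comp (mmix _) (measurable_addV u0)).
by rewrite mix_martingale.
Qed.

(* Of two independent further observations of [g], with gains [a] and [b], the
   second is worth less once the first is known. *)
Lemma mix_entropy_supermodular :
  (mix_entropy (s + a) + mix_entropy (s + b) <=
   mix_entropy (s + (a + b)) + mix_entropy s)%R.
Proof.
have sa0 := addr_gt0 s0 a0; have sb0 := addr_gt0 s0 b0.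
have sab0 := addr_gt0 s0 (addr_gt0 a0 b0).
pose T c (phi : V * (V * V) -> V) z := (ln (mix G c (phi z)))%:E * (Q z)%:E.
have Tint c phi : (0 < c)%R -> measurable_fun setT phi ->
    same_law W (gam c) phi Q idfun (mix G c) -> W.-integrable setT (T c phi).
  move=> c0 mphi law; exact: (same_law_integrable Q_ge0 (mix_ge0 G c) law mphi mQ
    (mlnmix c) (lnmix_integrable c0)).
have TE c phi : (0 < c)%R -> same_law W (gam c) phi Q idfun (mix G c) ->
    \int[W]_z T c phi z = (mix_entropy c)%:E.
  move=> c0 law; rewrite -mix_entropyE//.
  exact: (same_law_integral Q_ge0 (mix_ge0 G c) law (mlnmix c)).
have It := Tint _ _ sab0 mtot law_tot; have I0 := Tint _ _ s0 measurable_fst law_fst0.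
have I1 := Tint _ _ sa0 mfst01 law_fst01; have I2 := Tint _ _ sb0 mfst02 law_fst02.
(* [P] is the joint density that would hold if the last two observations were independent given the
   first. It has mass 1 by two uses of [mix_martingale], and Gibbs' inequality compares [Q] with
   it. *)
pose P z := (mix G (s + a) (fst01 z) * mix G (s + b) (fst02 z) / mix G s z.1)%R.
have P0 z : 0 <= (P z)%:E by rewrite lee_fin !mulr_ge0 ?invr_ge0 ?mix_ge0.
have mP : measurable_fun setT (fun z => (P z)%:E).
  apply/measurable_EFinP; apply: measurable_funM; first apply: measurable_funM.
  - exact: (measurableT_comp (measurable_mix _ _)).
  - exact: (measurableT_comp (measurable_mix _ _)).
  - apply: measurable_fun_inv_gt0 => [z|]; first exact: mix_gt0.
    exact: (measurableT_comp (measurable_mix _ _) measurable_fst).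
have Pmass : \int[W]_z (P z)%:E = 1.
  rewrite (tonelli mP P0) -(mix_mass s0); apply: eq_integral => u0 _.
  have v0 : (0 <= (mix G s u0)^-1)%R by rewrite invr_ge0 mix_ge0.
  transitivity (\int[gam a]_u1 ((mix G s u0)^-1%:E * (mix G (s + a) (u0 + u1))%:E *
      (mix G s u0)%:E)).
    apply: eq_integral => u1 _.
    rewrite -[in RHS](mix_martingale u0 s0 b0) -ge0_integralZl//.
    - apply: eq_integral => u2 _; rewrite /P /fst01 /fst02 /= -!EFinM.
      by congr EFin; ring.
    - exact: (measurableT_comp (mmix _) (measurable_addV u0)).
    - by rewrite -EFinM lee_fin mulr_ge0// mix_ge0.
  have m0 := mix_gt0 G u0 s0.
  apply: etrans _ (mix_martingale u0 s0 a0); apply: eq_integral => u1 _.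
  by rewrite -!EFinM; congr EFin; field; rewrite gt_eqF.
have Qmass : \int[W]_z (Q z)%:E = 1.
  rewrite -(mix_mass sab0).
  transitivity (\int[W]_z (1 * (Q z)%:E)).
    by apply: eq_integral => z _; rewrite mul1e.
  rewrite (law_tot (measurable_cst (1 : \bar R)) (fun=> lee01)).
  by apply: eq_integral => z _; rewrite mul1e.
have int1 (f : V * (V * V) -> \bar R) : measurable_fun setT f ->
    (forall z, 0 <= f z) -> \int[W]_z f z = 1 -> W.-integrable setT f.
  move=> mf f0 f1; apply/integrableP; split => //.
  rewrite (eq_integral f) ?f1 ?ltry// => z _; exact: gee0_abs.
have EQ0 z : 0 <= (Q z)%:E by rewrite lee_fin.
have EmQ : measurable_fun setT (fun z => (Q z)%:E) by exact/measurable_EFinP.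
have IQ := int1 _ EmQ EQ0 Qmass.
have IP := int1 _ mP P0 Pmass.
rewrite -subr_ge0 -[leLHS](subrr (1%R : R)).
apply: (le_integral_combination IQ IP It I0 I1 I2 _ Qmass Pmass (TE _ _ sab0 law_tot)
  (TE _ _ s0 law_fst0) (TE _ _ sa0 law_fst01) (TE _ _ sb0 law_fst02)) => z.
have := log_ratio_ge (mix_gt0 G (tot z) sab0) (mix_gt0 G z.1 s0)
  (mix_gt0 G (fst01 z) sa0) (mix_gt0 G (fst02 z) sb0).
by rewrite -lee_fin; exact.
Qed.

End submodularity.

End gaussian_channel.

(** * Concave functions on the half-line *)

Section concave_sequence.
Context {R : realType} (u : nat -> R).
Hypothesis u_ge0 : forall n, 0 <= u n.
Hypothesis u_concave : forall n, u n.+2 + u n <= u n.+1 + u n.+1.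

Let slope_le0 n : u n.+1 - u n <= u 1%N - u 0%N.
Proof. by elim: n => // n IH; have := u_concave n; lra. Qed.

(** A concave sequence stays below the line through its first two terms, so an initial decrease
    would eventually make it negative. *)
Lemma concave_seq_mono : u 0%N <= u 1%N.
Proof.
rewrite leNgt; apply/negP => u10.
have bound n : u n <= u 0%N + n%:R * (u 1%N - u 0%N).
  elim: n => [|n IH]; first by rewrite mul0r addr0.
  by have := slope_le0 n; rewrite -natr1 mulrDl mul1r; lra.
(* Past the zero [u 0 / (u 0 - u 1)] of that line, the upper bound is negative. *)
pose n := (Num.truncn (u 0%N / (u 0%N - u 1%N))).+1.
have d0 : 0 < u 0%N - u 1%N by lra.
have : u 0%N / (u 0%N - u 1%N) < n%:R by exact: truncnS_gt.
rewrite ltr_pdivrMr// => h.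
by have := bound n; have := u_ge0 n; lra.
Qed.

(** The increment after [n] is at most each of the [n] earlier ones, hence at most [u n / n] since
    [u 0] is nonnegative; so [u n / n] cannot increase. *)
Lemma concave_seq_ratio i j : (i <= j)%N -> i%:R * u j <= j%:R * u i.
Proof.
have step n : n%:R * (u n.+1 - u n) <= u n.
  elim: n => [|n IH]; first by rewrite mul0r.
  rewrite -natr1 mulrDl mul1r.
  have : n%:R * (u n.+2 - u n.+1) <= n%:R * (u n.+1 - u n).
    by apply: ler_wpM2l => //; have := u_concave n; lra.
  by have := u_concave n; lra.
elim: j => [|j IH]; first by rewrite leqn0 => /eqP ->.
rewrite leq_eqVlt => /predU1P[->//|]; rewrite ltnS => ij.
have [j0|j0] := posnP j.
  by move: ij; rewrite j0 leqn0 => /eqP ->; rewrite mul0r mulr_ge0.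
have jp : 0 < j%:R :> R by rewrite ltr0n.
rewrite -(ler_pM2l jp).
have := ler_wpM2l (ler0n R i) (step j); have := IH ij => h1 h2.
have h3 : (j%:R + 1) * (i%:R * u j) <= (j%:R + 1) * (j%:R * u i).
  by apply: ler_wpM2l => //; lra.
rewrite -natr1; nra.
Qed.

End concave_sequence.

Section concave_function.
Context {R : realType} (F : R -> R).
Hypothesis F_ge0 : forall s, 0 < s -> 0 <= F s.
Hypothesis F_submod : forall s a b, 0 < s -> 0 < a -> 0 < b ->
  F (s + (a + b)) + F s <= F (s + a) + F (s + b).

Let sample (s a : R) (n : nat) := F (s + n%:R * a).

Let sample_ge0 s a n : 0 < s -> 0 < a -> 0 <= sample s a n.
Proof. by move=> s0 a0; apply: F_ge0; rewrite ltr_wpDr// mulr_ge0// ltW. Qed.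

Let sample_concave s a n : 0 < s -> 0 < a ->
  sample s a n.+2 + sample s a n <= sample s a n.+1 + sample s a n.+1.
Proof.
move=> s0 a0; have sn0 : 0 < s + n%:R * a by rewrite ltr_wpDr// mulr_ge0// ltW.
have := F_submod sn0 a0 a0; rewrite /sample -!natr1.
have -> : s + (n%:R + 1 + 1) * a = s + n%:R * a + (a + a) by ring.
by have -> : s + (n%:R + 1) * a = s + n%:R * a + a by ring.
Qed.

Lemma concave_mono s s' : 0 < s -> s <= s' -> F s <= F s'.
Proof.
move=> s0; rewrite le_eqVlt => /predU1P[->//|ss'].
have a0 : 0 < s' - s by rewrite subr_gt0.
have := concave_seq_mono (fun n => sample_ge0 n s0 a0)
  (fun n => sample_concave n s0 a0).
by rewrite /sample mul0r addr0 mul1r addrC subrK.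
Qed.

(** Sampling with step [s / i.+1] makes [s] a sample point, while monotonicity replaces [s'] by the
    first sample point beyond it. The error is a factor [i.+1 / i], removed by letting [i] grow. *)
Lemma concave_ratio s s' : 0 < s -> s <= s' -> s * F s' <= s' * F s.
Proof.
move=> s0 ss'; have s'0 : 0 < s' by exact: lt_le_trans ss'.
have Fs0 := F_ge0 s0.
have key i : i%:R * (s * F s') <= i.+1%:R * (s' * F s).
  pose de := s / i.+1%:R.
  have ip : 0 < i.+1%:R :> R by rewrite ltr0n.
  have de0 : 0 < de by rewrite divr_gt0.
  pose j := Num.truncn (s' / de).
  have ratio0 : 0 <= s' / de by rewrite divr_ge0// ltW.
  have jle : j%:R <= s' / de by rewrite truncn_le.
  have jgt : s' / de < j.+1%:R by exact: truncnS_gt.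
  have ij : (i <= j)%N.
    have h : i.+1%:R <= s' / de.
      by rewrite /de invf_div mulrA ler_pdivlMr// mulrC ler_wpM2r// ltW.
    by have := le_lt_trans h jgt; rewrite ltr_nat ltnS => /ltnW.
  have := concave_seq_ratio (fun n => sample_ge0 n de0 de0)
    (fun n => sample_concave n de0 de0) ij.
  (* Sampling starts at [de] because nothing is assumed of [F] at 0; index [n] is the point
     [n.+1 * de], so that [s] has index [i], and index [j] lies beyond [s']. *)
  have sampleE n : sample de de n = F (n.+1%:R * de).
    by rewrite /sample -natr1 mulrDl mul1r addrC.
  rewrite !sampleE (_ : i.+1%:R * de = s); last first.
    by rewrite /de mulrC divfK// gt_eqF.
  move=> h.
  have Fj : F s' <= F (j.+1%:R * de).
    by apply: concave_mono => //; rewrite ltW// -ltr_pdivrMr.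
  have h2 : i%:R * F s' <= j%:R * F s by apply: le_trans h; rewrite ler_wpM2l.
  have h3 : j%:R * s <= s' * i.+1%:R.
    by move: jle; rewrite /de invf_div mulrA ler_pdivlMr.
  by have := ler_wpM2l (ltW s0) h2; have := ler_wpM2r Fs0 h3; lra.
(* If the inequality failed, [key] would bound every multiple [n] of the gap by [s' * F s]. *)
rewrite leNgt; apply/negP => gap.
have d0 : 0 < s * F s' - s' * F s by rewrite subr_gt0.
pose n := (Num.truncn (s' * F s / (s * F s' - s' * F s))).+1.
have : s' * F s / (s * F s' - s' * F s) < n%:R by exact: truncnS_gt.
rewrite ltr_pdivrMr// => h.
by have := key n; rewrite -natr1; lra.
Qed.

(** If [s' <= s], monotonicity and [t <= 1] suffice; otherwise
    [t * F s' <= t * (s' / s) * F s <= F s]. *)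
Lemma concave_scale t s s' : 0 <= t <= 1 -> 0 < s -> 0 < s' -> t * s' <= s ->
  t * F s' <= F s.
Proof.
move=> /andP[t0 t1] s0 s'0 ts.
have [le_s|lt_s] := leP s' s.
  by apply: le_trans (concave_mono s'0 le_s); rewrite ler_piMl// F_ge0.
rewrite -(ler_pM2l s0); have := ler_wpM2l t0 (concave_ratio s0 (ltW lt_s)).
by have := ler_wpM2r (F_ge0 s0) ts; lra.
Qed.

End concave_function.

(** * Communication rates *)

Lemma ln_le_sub1 {R : realType} (x : R) : 0 < x -> ln x <= x - 1.
Proof.
move=> x0; have e : 1 + (x - 1) = x by ring.
by rewrite -{1}e; apply: le_ln1Dx; lra.
Qed.

Section communication_rate.
Context d (T : measurableType d) (R : realType) (P : probability T R).
Variables (p vc aN aF : R) (h1 h2 : {RV P >-> R[i]}).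
Hypotheses (p_gt0 : 0 < p) (vc_gt0 : 0 < vc) (aN_gt0 : 0 < aN) (aF_gt0 : 0 < aF).

Let ln2_gt0 : 0 < ln (2 : R).
Proof. by apply: ln_gt0; lra. Qed.

(* concavity of ln at 1 and 1 + y, with weights 1 - k and k *)
Let ln_scale (k y : R) : 0 <= k <= 1 -> 0 <= y -> k * ln (1 + y) <= ln (1 + k * y).
Proof.
move=> /andP[k0 k1] y0.
have m0 : 0 < 1 + k * y by rewrite ltr_wpDr// mulr_ge0.
have q0 : 0 < (1 + y) / (1 + k * y) by rewrite divr_gt0// ltr_wpDr.
have v0 : 0 < (1 + k * y)^-1 by rewrite invr_gt0.
have := ln_le_sub1 q0; rewrite ln_div ?posrE// ?ltr_wpDr// => h1'.
have := ln_le_sub1 v0; rewrite lnV ?posrE// => h2'.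
(* The tangent bounds at the two points cancel because [1 + k * y] is the mean of [1 + y] and 1 with
   weights [k] and [1 - k]. *)
have e : k * ((1 + y) / (1 + k * y) - 1) + (1 - k) * ((1 + k * y)^-1 - 1) = 0.
  by field; rewrite gt_eqF.
have := ler_wpM2l k0 h1'; have k0' : 0 <= 1 - k by lra.
have := ler_wpM2l k0' h2'; lra.
Qed.

Let ln_mono (x y : R) : 0 <= x -> x <= y -> ln (1 + x) <= ln (1 + y).
Proof. by move=> x0 xy; rewrite ler_ln ?posrE ?lerD2l// ltr_wpDr// (le_trans x0). Qed.

Let log2_mono (k x y : R) : 0 <= k <= 1 -> 0 <= x -> k * x <= y ->
  k * log2 (1 + x) <= 1 * log2 (1 + y).
Proof.
move=> k01 x0 kxy; rewrite mul1r /log2 mulrA ler_pM2r ?invr_gt0//.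
apply: le_trans (ln_scale k01 x0) _; apply: ln_mono kxy.
by case/andP: k01 => k0 _; rewrite mulr_ge0.
Qed.

Let hN := abs_hN h1 h2.
Let hF := abs_hF h1 h2.

Lemma measurable_fun_normc (f : T -> R[i]) : measurable_fun setT f ->
  measurable_fun setT (fun t => Normc.normc (f t)).
Proof.
move=> mf; rewrite (_ : (fun t => _) = (fun t => Num.sqrt
    (complex.Re (f t) ^+ 2 + complex.Im (f t) ^+ 2))); last first.
  by apply/funext => t; case: (f t).
under eq_fun => t do rewrite -powR12_sqrt ?addr_ge0 ?sqr_ge0//.
apply: (measurableT_comp (measurable_powR _)).
apply: measurable_funD; apply: measurable_funX.
  exact: measurable_fun_Re.
exact: measurable_fun_Im.
Qed.

Let measurable_hN : measurable_fun setT hN.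
Proof. by apply: measurable_maxr; exact: measurable_fun_normc. Qed.

Let measurable_hF : measurable_fun setT hF.
Proof. by apply: measurable_minr; exact: measurable_fun_normc. Qed.

Let gammaN_ k m := gammaN p vc aN h1 h2 k m.
Let gammaF_ k m := gammaF p vc aN aF h1 h2 k m.

Let numer_ge0 (m x a : R) : 0 <= m -> 0 < a -> 0 <= m * p * x ^+ 2 * a.
Proof.
move=> m0 a0; apply: mulr_ge0 (ltW a0); apply: mulr_ge0 (sqr_ge0 _).
exact: mulr_ge0 m0 (ltW p_gt0).
Qed.

Let denom_gt0 (k m x : R) : 0 < k -> 0 <= m -> 0 < k * vc + m * p * x ^+ 2 * aN.
Proof. by move=> k0 m0; rewrite ltr_wpDr ?numer_ge0// mulr_gt0. Qed.

Let gammaN_ge0 k m t : 0 < k -> 0 <= m -> 0 <= gammaN_ k m t.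
Proof. by move=> k0 m0; rewrite divr_ge0 ?numer_ge0// ltW// mulr_gt0. Qed.

Let gammaF_ge0 k m t : 0 < k -> 0 <= m -> 0 <= gammaF_ k m t.
Proof. by move=> k0 m0; rewrite divr_ge0 ?numer_ge0// ltW// denom_gt0. Qed.

Let gammaN_le k m t : 0 < k <= 1 -> 0 <= m <= 1 ->
  k * gammaN_ k m t <= gammaN_ 1 1 t.
Proof.
move=> /andP[k0 k1] /andP[m0 m1]; rewrite /gammaN_ /gammaN mul1r.
have -> : k * (m * p * abs_hN h1 h2 t ^+ 2 * aN / (k * vc)) =
    m * (p * abs_hN h1 h2 t ^+ 2 * aN / vc) by field; rewrite !gt_eqF.
rewrite mul1r; apply: ler_piMl => //; apply: mulr_ge0; last by rewrite invr_ge0 ltW.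
by have := numer_ge0 (abs_hN h1 h2 t) ler01 aN_gt0; rewrite mul1r.
Qed.

Let gammaF_le k m t : 0 < k <= 1 -> 0 <= m <= 1 ->
  k * gammaF_ k m t <= gammaF_ 1 1 t.
Proof.
move=> /andP[k0 k1] /andP[m0 m1]; rewrite /gammaF_ /gammaF !mul1r.
set b := p * abs_hF h1 h2 t ^+ 2.
have b0 : 0 <= b by rewrite mulr_ge0 ?sqr_ge0// ltW.
have -> : m * p * abs_hF h1 h2 t ^+ 2 = m * b by rewrite /b; ring.
have d1 : 0 < k * vc + m * b * aN.
  rewrite ltr_wpDr ?mulr_gt0//.
  exact: mulr_ge0 (mulr_ge0 m0 b0) (ltW aN_gt0).
have d2 : 0 < vc + b * aN by rewrite ltr_wpDr// mulr_ge0// ltW.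
rewrite -subr_ge0.
(* Over the common denominator, the numerator is a combination of [1 - m] and [1 - k] with
   nonnegative coefficients. *)
have -> : b * aF / (vc + b * aN) - k * (m * b * aF / (k * vc + m * b * aN)) =
    (b * aF) * (k * vc * (1 - m) + m * b * aN * (1 - k)) /
    ((vc + b * aN) * (k * vc + m * b * aN)) by field; rewrite !gt_eqF.
apply: divr_ge0; last by rewrite ltW// mulr_gt0.
have c1 : 0 <= 1 - m by lra.
have c2 : 0 <= 1 - k by lra.
apply: mulr_ge0; first exact: mulr_ge0 b0 (ltW aF_gt0).
apply: addr_ge0.
  exact: mulr_ge0 (mulr_ge0 (ltW k0) (ltW vc_gt0)) c1.
exact: mulr_ge0 (mulr_ge0 (mulr_ge0 m0 b0) (ltW aN_gt0)) c2.
Qed.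

Let mgammaN k m : 0 < k -> measurable_fun setT (gammaN_ k m).
Proof.
move=> k0; apply: measurable_funM => //; apply: measurable_funM => //.
by apply: measurable_funM => //; exact: measurable_funX.
Qed.

Let mgammaF k m : 0 < k -> 0 <= m -> measurable_fun setT (gammaF_ k m).
Proof.
move=> k0 m0.
have mh2 : measurable_fun setT (fun t => m * p * abs_hF h1 h2 t ^+ 2).
  by apply: measurable_funM => //; exact: measurable_funX.
apply: measurable_funM; first exact: measurable_funM.
apply: measurable_fun_inv_gt0 => [t|]; first exact: denom_gt0.
by apply: measurable_funD => //; exact: measurable_funM.
Qed.

Let mlog2 k (f : T -> R) : measurable_fun setT f ->
  measurable_fun setT (fun t => (k * log2 (1 + f t))%:E).
Proof.
move=> mf; apply/measurable_EFinP; apply: measurable_funM => //.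
apply: measurable_funM => //; apply: measurableT_comp => //.
exact: measurable_funD.
Qed.

Let log2_ge0 (x : R) : 0 <= x -> 0 <= log2 (1 + x).
Proof.
by move=> x0; apply: divr_ge0 (ltW ln2_gt0); apply: ln_ge0; rewrite lerDl.
Qed.

Local Open Scope ereal_scope.

Let expectation_le (k : R) (f g : T -> R) : (0 <= k <= 1)%R ->
  measurable_fun setT f -> measurable_fun setT g -> (forall t, (0 <= f t)%R) ->
  (forall t, (k * f t <= g t)%R) ->
  'E_P[fun t => (k * log2 (1 + f t))%R] <= 'E_P[fun t => (1 * log2 (1 + g t))%R].
Proof.
move=> k01 mf mg f0 fg; rewrite unlock; apply: ge0_le_integral => //=.
- by move=> t _; rewrite lee_fin mulr_ge0 ?log2_ge0//; case/andP: k01.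
- exact: mlog2.
- exact: mlog2.
- by move=> t _; rewrite lee_fin; exact: log2_mono.
Qed.

Let expectation_ge0 (f : T -> R) : (forall t, (0 <= f t)%R) ->
  0 <= 'E_P[fun t => (1 * log2 (1 + f t))%R].
Proof.
move=> f0; rewrite unlock; apply: integral_ge0 => t _.
by rewrite lee_fin mul1r log2_ge0.
Qed.

Lemma comm_rate_le (k m : R) : (0 <= k <= 1)%R -> (0 <= m <= 1)%R ->
  comm_rate P p vc aN aF h1 h2 k m <= comm_rate P p vc aN aF h1 h2 1 1.
Proof.
move=> /andP[k0 k1] m01; have m0 : (0 <= m)%R by case/andP: m01.
rewrite /comm_rate oner_eq0; have [_|kn0] := eqVneq k 0%R.
  by apply: adde_ge0; apply: expectation_ge0 => t;
    [exact: gammaN_ge0|exact: gammaF_ge0].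
have kp : (0 < k)%R by rewrite lt_neqAle eq_sym kn0.
have k01 : (0 < k <= 1)%R by rewrite kp.
have k01' : (0 <= k <= 1)%R by rewrite k0.
apply: leeD; apply: expectation_le => //.
- exact: mgammaN.
- exact: mgammaN.
- by move=> t; exact: gammaN_ge0.
- by move=> t; exact: gammaN_le.
- exact: mgammaF.
- exact: mgammaF.
- by move=> t; exact: gammaF_ge0.
- by move=> t; exact: gammaF_le.
Qed.

End communication_rate.

(** * Conditional laws *)

(* The events of [U] are generated by a countable pi-system, so that two versions
   of a conditional law almost surely agree on all events at once. *)
Section countable_generation.
Context {R : realType} (M L : nat).
Notation U := ('M[R[i]]_(M, L) * 'cV[R[i]]_M)%type.
Notation coord_index := (('I_M * 'I_L * bool) + ('I_M * bool))%type.

Let coord (k : coord_index) (x : U) : R :=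
  match k with
  | inl (i, j, b) => if b then complex.Re (x.1 i j) else complex.Im (x.1 i j)
  | inr (m, b) => if b then complex.Re (x.2 m ord0) else complex.Im (x.2 m ord0)
  end.

Let measurable_coord k : measurable_fun setT (coord k).
Proof.
case: k => [[[i j] b]|[m b]] /=.
  have mij : measurable_fun setT (fun x : U => x.1 i j).
    exact: (measurableT_comp (measurable_entry i j) measurable_fst).
  by case: b; [exact: measurable_fun_Re|exact: measurable_fun_Im].
have mm : measurable_fun setT (fun x : U => x.2 m ord0).
  exact: (measurableT_comp (measurable_entry m ord0) measurable_snd).
by case: b; [exact: measurable_fun_Re|exact: measurable_fun_Im].
Qed.

(** The constraints are kept in a list, so that intersecting boxes is concatenating lists and
    countability comes from [pickle]. *)
Definition rational_box (s : seq (coord_index * rat)) : set U :=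
  [set x | forall k, k \in s -> ratr k.2 < coord k.1 x].

Lemma measurable_rational_box s : measurable (rational_box s).
Proof.
rewrite (_ : rational_box s = \bigcap_(k in [set` s])
    (coord k.1 @^-1` `]ratr k.2, +oo[)); last first.
  apply/seteqP; split => x xs k ks /=; first by rewrite in_itv/= andbT; exact: xs.
  by have := xs k ks; rewrite /= in_itv/= andbT.
apply: fin_bigcap_measurable => [|k _]; first exact: finite_seq.
by rewrite -[X in measurable X]setTI; apply: measurable_coord.
Qed.

Let boxes := range rational_box.
Let U' := g_sigma_algebraType boxes.

Let measurable_coord' k : measurable_fun [set: U'] (coord k : U' -> R).
Proof.
apply: (measurability _ (RGenOInfty.measurableE R)) => _ [_ [x ->] <-].
(* The open half-line above [x] is the union of those above the rationals [q > x]. *)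
rewrite setTI (_ : _ @^-1` _ = \bigcup_(q in [set: rat])
    (if x < ratr q then rational_box [:: (k, q)] else set0 : set U')).
  apply: countable_bigcupT_measurable => // q; case: ifP => _.
    by apply: sub_sigma_algebra; exists [:: (k, q)].
  exact: measurable0.
apply/seteqP; split => [y /=|y [q _]].
  rewrite in_itv/= andbT => xy; have [q] := rat_in_itvoo xy.
  rewrite in_itv/= => /andP[xq qy]; exists q => //; rewrite xq => k'.
  by rewrite inE => /eqP ->.
case: ifP => // xq /(_ (k, q)); rewrite mem_head => /(_ isT) /= qy.
by rewrite in_itv/= andbT (lt_trans xq).
Qed.

(** The boxes already make every real coordinate measurable, hence the identity too: the
    sigma-algebra that they generate contains the original one. *)
Let measurable_id' : measurable_fun [set: U'] (id : U' -> U).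
Proof.
have -> : id = (fun x : U' => ((x : U).1, (x : U).2)).
  by apply/funext => -[].
apply: (@measurable_fun_pair _ _ _ U' _ _ (fun x : U' => (x : U).1)
  (fun x : U' => (x : U).2)).
  apply: measurable_fun_mx => i j; apply: measurable_fun_complex.
    exact: (measurable_coord' (inl (i, j, true))).
  exact: (measurable_coord' (inl (i, j, false))).
apply: measurable_fun_mx => i j; rewrite ord1; apply: measurable_fun_complex.
  exact: (measurable_coord' (inr (i, true))).
exact: (measurable_coord' (inr (i, false))).
Qed.

Lemma measurable_rational_boxE : @measurable _ U = <<s range rational_box >>.
Proof.
apply/seteqP; split => [A mA|].
  by rewrite -[A]setTI; exact: measurable_id'.
apply: smallest_sub; first exact: sigma_algebra_measurable.
by move=> _ [s _ <-]; exact: measurable_rational_box.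
Qed.

Lemma eq_prob_rational_box (m1 m2 : probability U R) :
  (forall s, m1 (rational_box s) = m2 (rational_box s)) ->
  forall A, measurable A -> m1 A = m2 A.
Proof.
move=> m12; apply: (measure_unique (range rational_box) (fun=> setT)).
- exact: measurable_rational_boxE.
- move=> _ _ [s _ <-] [s' _ <-]; exists (s ++ s') => //.
  apply/seteqP; split => [x h|x [h h'] k].
    by split => k ks; apply: h; rewrite mem_cat ks ?orbT.
  by rewrite mem_cat => /orP[]; [exact: h|exact: h'].
- by move=> _; exists [::] => //; apply/seteqP; split.
- by rewrite bigcup_const.
- by move=> _ [s _ <-]; exact: m12.
- by move=> _; apply: le_lt_trans (probability_le1 m1 measurableT) _; exact: ltry.
Qed.

End countable_generation.

Section conditional_law_unique.
Context d (T : measurableType d) (R : realType) (P : probability T R).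
Context d3 (T3 : measurableType d3) (M L : nat).
Notation U := ('M[R[i]]_(M, L) * 'cV[R[i]]_M)%type.
Variables (W : T -> U) (Z : T -> T3) (k0 : T3 -> pprobability U R).
Hypothesis mZ : measurable_fun setT Z.
Local Open Scope ereal_scope.

Let eval (h : T3 -> pprobability U R) A (mh : measurable_fun setT h) :
  measurable A -> measurable_fun setT (fun z => h z A).
Proof. by move=> mA; exact: (measurable_kernel (kprobability mh) A mA). Qed.

(** On a fixed box the two versions have the same integral over every event of [Z], so they agree
    there almost surely; the countably many exceptional sets are then merged. *)
Lemma conditional_law_ae_unique (k : T3 -> pprobability U R) :
  conditional_law P W Z k -> conditional_law P W Z k0 ->
  {ae P, forall t, forall A, measurable A -> k (Z t) A = k0 (Z t) A}.
Proof.
move=> [mk kE] [mk0 k0E].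
have box s : {ae P, forall t, k (Z t) (rational_box s) = k0 (Z t) (rational_box s)}.
  have mB := @measurable_rational_box R M L s.
  have : ae_eq (distribution P (mfun_of mZ)) setT
      (fun z => k z (rational_box s)) (fun z => k0 z (rational_box s)).
    have int (h : T3 -> pprobability U R) E : measurable_fun setT h -> measurable E ->
        \int[distribution P (mfun_of mZ)]_(z in E) h z (rational_box s) =
        \int[P]_(t in Z @^-1` E) h (Z t) (rational_box s).
      move=> mh mE; rewrite ge0_integral_pushforward//.
      exact/measurable_funTS/eval.
    apply: integral_ae_eq => //.
    - apply: (@le_integrable _ _ _ _ _ measurableT _ (cst 1)).
      + exact: eval.
      + move=> z _; rewrite abse1 gee0_abs//; exact: probability_le1.
      + exact: finite_measure_integrable_cst.
    - exact: eval.
    - by move=> E _ mE; rewrite !int// -kE// -k0E.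
  move=> [A [mA A0 subA]]; exists (Z @^-1` A); split => //.
    by rewrite -[_ @^-1` _]setTI; exact: mZ.
  by move=> t /= ne; apply: subA => /= h; apply: ne; exact: h.
have all_box : {ae P, forall t, forall n s, unpickle n = Some s ->
    k (Z t) (rational_box s) = k0 (Z t) (rational_box s)}.
  apply: ae_foralln => n; case: (unpickle n) => [s|]; last by apply: aeW.
  by apply: filterS (box s) => t h _ [<-].
apply: filterS all_box => t h; apply: eq_prob_rational_box => s.
exact: (h (pickle s) s (pickleK s)).
Qed.

(** This covers non-measurable functions: the integral of a nonnegative function is a supremum over
    the simple functions below it, and that set grows with the function. *)
Lemma ge0_integral_mono (f g : T -> \bar R) : (forall t, 0 <= f t) ->
  (forall t, f t <= g t) -> \int[P]_t f t <= \int[P]_t g t.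
Proof.
move=> f0 fg; have g0 t : 0 <= g t by exact: le_trans (f0 t) (fg t).
rewrite (ge0_integralTE _ f0) (ge0_integralTE _ g0).
apply: ereal_sup_le => _ [h /= hf <-].
by exists h => // t; exact: le_trans (fg t).
Qed.

(* [f] need not be measurable: nothing is known on [mutual_info (k (Z t))] for
   the version [k] chosen by [cond_mutual_info]. *)
Lemma integral_ae_cst (f : T -> \bar R) (c : R) : (0 <= c)%R ->
  {ae P, forall t, f t = c%:E} -> \int[P]_t f t = c%:E.
Proof.
move=> c0 [A [mA A0 subA]].
have memA : measurable_fun setT (fun t => t \in A).
  apply: (measurable_fun_bool true); rewrite setTI (_ : _ @^-1` _ = A)//.
  by apply/seteqP; split => t; [exact: set_mem|exact: mem_set].
(* [bad] dominates whatever [f] does on the negligible set [A], and still has integral 0. *)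
pose bad (t : T) : \bar R := if t \in A then +oo else 0.
have fA t : t \notin A -> f t = c%:E.
  by move=> tA; apply: contrapT => h; move: tA; rewrite notin_setE; apply; exact: subA.
have mbad : measurable_fun setT bad.
  exact: measurable_fun_ifT.
have bad0 t : 0 <= bad t by rewrite /bad; case: ifP.
have ibad : \int[P]_t bad t = 0.
  rewrite (ge0_negligible_integral mA measurableT mbad)// integral0_eq// => t [_ tA].
  by rewrite /bad memNset.
rewrite integralE -[RHS]sube0; congr (_ - _); last first.
  apply/eqP; rewrite eq_le integral_ge0 ?andbT; last by move=> t _; exact: funeneg_ge0.
  rewrite -ibad; apply: ge0_integral_mono => t; first exact: funeneg_ge0.
  rewrite funenegE /bad; case: ifPn => [_|/fA ->]; first exact: leey.
  by rewrite ge_max lexx andbT -EFinN lee_fin oppr_le0.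
apply/eqP; rewrite eq_le; apply/andP; split.
  rewrite -[leRHS]adde0 -ibad -[X in X + _](integral_probability_cst P).
  rewrite -ge0_integralD//.
  apply: ge0_integral_mono => t; first exact: funepos_ge0.
  rewrite funeposE /bad; case: ifPn => [_|/fA ->]; first by rewrite leey.
  by rewrite adde0 ge_max lexx lee_fin.
(* The positive part of [f] is at least [good], which is measurable and almost everywhere equal to
   [c]. *)
pose good (t : T) : \bar R := if t \in A then 0 else c%:E.
have mgood : measurable_fun setT good.
  exact: measurable_fun_ifT.
have -> : c%:E = \int[P]_t good t.
  rewrite -[LHS](integral_probability_cst P); apply: ae_eq_integral => //.
  exists A; split => // t /= h; apply: contrapT => tA; apply: h => _.
  by rewrite /good memNset.
apply: ge0_integral_mono => t; rewrite /good; case: ifPn => // tA.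
by rewrite funeposE (fA _ tA) le_max lexx.
Qed.

(** The set given to [xget] is inhabited through [k0], so the default 0 is not taken. Whichever
    version [k'] is selected agrees with [k0] almost surely, and then its information is [c]. *)
Lemma cond_mutual_info_const (c : R) : (0 <= c)%R ->
  conditional_law P W Z k0 ->
  (forall t (J : probability U R), (forall A, measurable A -> J A = k0 (Z t) A) ->
    mutual_info J = c%:E) ->
  cond_mutual_info P (fst \o W) (snd \o W) Z = c%:E.
Proof.
move=> c0 k0W info; rewrite /cond_mutual_info.
have WE : (fun t => ((fst \o W) t, (snd \o W) t)) = W.
  by apply/funext => t /=; rewrite -surjective_pairing.
set S := (X in xget _ X).
have S0 : S (\int[P]_t mutual_info (k0 (Z t))) by exists k0 => //; rewrite WE.
case: (@xgetPex _ 0 S (ex_intro _ _ S0)) => k' k'W ->.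
apply: integral_ae_cst => //; rewrite WE in k'W.
by apply: filterS (conditional_law_ae_unique k'W k0W) => t /info.
Qed.

End conditional_law_unique.

Section conditional_law_independent.
Context d (T : measurableType d) (R : realType) (P : probability T R).
Context d1 d2 d3 (T1 : measurableType d1) (T2 : measurableType d2)
  (U : measurableType d3).
Variables (Z : T -> T1) (Y : T -> T2) (h : T1 * T2 -> U).
Hypotheses (mZ : measurable_fun setT Z) (mY : measurable_fun setT Y)
  (mh : measurable_fun setT h) (ZY : independent_pair P Z Y).
Local Open Scope ereal_scope.

Lemma measurable_fun_slice z : measurable_fun setT (fun t => h (z, Y t)).
Proof. exact: (measurableT_comp (measurable_fun_pair2 z mh) mY). Qed.

Definition slice_law (z : T1) : pprobability U R :=
  distribution P (mfun_of (measurable_fun_slice z)).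

Let slice_lawE z A : measurable A ->
  slice_law z A = \int[P]_t (\1_A (h (z, Y t)))%:E.
Proof.
move=> mA.
transitivity (\int[P]_t (\1_((fun t => h (z, Y t)) @^-1` A) t)%:E).
  rewrite integral_indic// ?setIT// -[X in measurable X]setTI.
  exact: measurable_fun_slice.
by [].
Qed.

Let mhA A : measurable A ->
  measurable_fun setT (fun x : T1 * T2 => (\1_A (h x))%:E : \bar R).
Proof.
move=> mA; apply/measurable_EFinP.
exact: (measurableT_comp (measurable_indic mA) mh).
Qed.

Let measurable_slice_lawA A : measurable A ->
  measurable_fun setT (fun z => slice_law z A).
Proof.
move=> mA; have mhA' : measurable (h @^-1` A).
  by rewrite -[_ @^-1` _]setTI; exact: mh.
rewrite (_ : (fun z => _) =
    distribution P (mfun_of mY) \o xsection (h @^-1` A)); last first.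
  apply/funext => z; apply: (congr1 P).
  by apply/seteqP; split => t; rewrite /xsection /= inE.
exact: measurable_fun_xsection.
Qed.

Lemma measurable_slice_law : measurable_fun setT slice_law.
Proof.
apply: (measurability (@pset _ _ _ : set (set (pprobability U R)))) => //.
move=> _ -[_ [r r01] [A mA <-]] <-.
apply: emeasurable_fun_infty_o => //; exact: measurable_slice_lawA.
Qed.

(** Conditioning on [Z] freezes the first argument of [h], while by independence [Y] keeps its
    law. *)
Lemma conditional_law_independent :
  conditional_law P (fun t => h (Z t, Y t)) Z slice_law.
Proof.
split; first exact: measurable_slice_law.
move=> A B mA mB.
have mZB : measurable (Z @^-1` B) by rewrite -[_ @^-1` _]setTI; exact: mZ.
pose f (x : T1 * T2) : \bar R := (\1_A (h x))%:E * (\1_B x.1)%:E.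
have mf : measurable_fun setT f.
  apply: emeasurable_funM; first exact: mhA.
  apply/measurable_EFinP; apply: (measurableT_comp (measurable_indic mB)).
  exact: measurable_fst.
have f0 x : 0 <= f x by rewrite mule_ge0.
have mW : measurable_fun setT (fun t => h (Z t, Y t)).
  exact: (measurableT_comp mh (measurable_fun_pair mZ mY)).
transitivity (\int[P]_t f (Z t, Y t)).
  rewrite -[X in P X]setIT -integral_indic//; last first.
    by apply: measurableI => //; rewrite -[_ @^-1` _]setTI; exact: mW.
  by apply: eq_integral => t _; rewrite indicI EFinM.
rewrite (ge0_integral_independent_pair mZ mY ZY mf f0).
rewrite [RHS]integral_mkcond; apply: eq_integral => t _; rewrite /f/= patchE.
have [tB|tB] := boolP (t \in _).
  rewrite slice_lawE//; apply: eq_integral => t' _.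
  by rewrite (indicE _ B) (mem_set (set_mem tB : B (Z t))) mule1.
rewrite integral0_eq// => t' _; rewrite (indicE _ B) memNset ?mule0//.
by move: tB; rewrite notin_setE.
Qed.

End conditional_law_independent.

Section echo_independence.
Context d (T : measurableType d) (R : realType) (P : probability T R).
Context d1 d2 d3 (T1 : measurableType d1) (T2 : measurableType d2)
  (T3 : measurableType d3).
Variables (X : T -> T1) (Y : T -> T2) (Z : T -> T3).
Hypotheses (mX : measurable_fun setT X) (mY : measurable_fun setT Y)
  (mZ : measurable_fun setT Z).
Hypothesis XYZ :
  mutually_independent P (tnth [tuple sigma_of X; sigma_of Y; sigma_of Z]).
Local Open Scope ereal_scope.

Let independent3 A B C : measurable A -> measurable B -> measurable C ->
  P (X @^-1` A `&` (Y @^-1` B `&` Z @^-1` C)) =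
  P (X @^-1` A) * (P (Y @^-1` B) * P (Z @^-1` C)).
Proof.
move=> mA mB mC.
have := XYZ (J := [set: 'I_3]%SET)
  (E := tnth [tuple X @^-1` A; Y @^-1` B; Z @^-1` C]).
rewrite (eq_bigl xpredT); last by move=> i; rewrite finset.in_setT.
rewrite !big_ord_recl big_ord0 mule1 /= => <-.
  congr (P _); apply/seteqP; split => [t [At [Bt Ct]] i _|t ABC].
    by case: i => -[|[|[|]]].
  split; first exact: (ABC (@Ordinal 3 0 isT) (finset.in_setT _)).
  split; first exact: (ABC (@Ordinal 3 1 isT) (finset.in_setT _)).
  exact: (ABC (@Ordinal 3 2 isT) (finset.in_setT _)).
move=> i _; case: i => -[|[|[|//]]] lti /=; rewrite /sigma_of.
- by exists A => //; rewrite setTI.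
- by exists B => //; rewrite setTI.
- by exists C => //; rewrite setTI.
Qed.

Let PT : P setT = 1. Proof. exact: probability_setT. Qed.

Lemma independent_pair_last : independent_pair P Y Z.
Proof.
move=> B C mB mC; have := independent3 measurableT mB mC.
by rewrite preimage_setT setTI PT mul1e.
Qed.

(** Measurable rectangles form a pi-system generating the events of the pair of [Y] and [Z]; on them
    the claim is the threefold product formula. *)
Lemma independent_pair_first : independent_pair P X (fun t => (Y t, Z t)).
Proof.
move=> A D mA mD; rewrite setIC muleC.
move: D A mD mA.
apply: (independent_pair_of_pi_system
  (G := [set A `*` B | A in measurable & B in measurable])).
- exact: measurable_fun_pair.
- exact: mX.
- exact: measurable_prod_measurableType.
- move=> _ _ [B mB [C mC <-]] [B' mB' [C' mC' <-]].
  exists (B `&` B'); first exact: measurableI.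
  exists (C `&` C'); first exact: measurableI.
  by rewrite setXI.
- by exists setT => //; exists setT => //; rewrite setXTT.
move=> _ A [B mB [C mC <-]] mA.
have -> : (fun t => (Y t, Z t)) @^-1` (B `*` C) = Y @^-1` B `&` Z @^-1` C by [].
by rewrite (independent_pair_last mB mC) setIC muleC independent3.
Qed.

End echo_independence.

(** * Echoes *)

Section matched_filter.
Context {R : realType} (M L : nat).
Implicit Types (v : R) (z : 'cV[R[i]]_L) (g : 'cV[R[i]]_M) (n : 'M[R[i]]_(M, L)).

(** Correlation with the waveform. The factor [v^-1] is chosen so that the signal gain and the
    variance of the filtered noise are the same number [sq_norm z / v], as in the channel
    [s g + n]. *)
Definition matched_filter v z : 'cV[R[i]]_L := (v^-1)%:C *: map_mx (@conjc R) z.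

Lemma mulr_conjc (w : R[i]) : w * conjc w = (Normc.normc w ^+ 2)%:C.
Proof.
case: w => x y; rewrite normc_sq; apply/eqP; rewrite eq_complex /=.
by apply/andP; split; apply/eqP; ring.
Qed.

Lemma realC_sum (I : finType) (F : I -> R) : (\sum_i F i)%:C = \sum_i (F i)%:C.
Proof. exact: (raddf_sum (real_complex R)). Qed.

Lemma sq_norm_matched_filter v z :
  sq_norm (matched_filter v z) = sq_norm z / v ^+ 2.
Proof.
rewrite /sq_norm mulr_suml; apply: eq_bigr => l _; rewrite !normc_sq !mxE.
by case: (z l ord0) => x y /=; rewrite -exprVn; ring.
Qed.

Lemma mulmx_matched_filter v z g :
  (g *m z^T) *m matched_filter v z = (sq_norm z / v)%:C *: g.
Proof.
rewrite -mulmxA (_ : z^T *m _ = ((sq_norm z / v)%:C)%:M) ?mul_mx_scalar//.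
apply/matrixP => i j; rewrite !mxE !ord1 mulr1n.
rewrite /sq_norm mulr_suml realC_sum; apply: eq_bigr => l _.
by rewrite !mxE mulrCA mulr_conjc mulrC -rmorphM.
Qed.

(** The filtered vector is a sufficient statistic: the likelihood of [g] reads the matrix [n] only
    through it. *)
Lemma noise_density_matched_filter v z g n :
  noise_density v (g *m z^T) n = lik (sq_norm z / v) (n *m matched_filter v z, g).
Proof.
rewrite /noise_density /lik /=; congr expR.
rewrite -(pair_big xpredT xpredT (fun i l => (2 * complex.Re
  (conjc ((g *m z^T) i l) * n i l) - Normc.normc ((g *m z^T) i l) ^+ 2) / v)) /=.
rewrite /re_dot mulr_sumr /sq_norm mulr_sumr -sumrB; apply: eq_bigr => i _.
rewrite !mxE !mulr_suml mulr_sumr raddf_sum mulr_sumr -sumrB.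
apply: eq_bigr => l _; rewrite !mxE big_ord1 !mxE Normc.normcM exprMn !normc_sq.
by case: (g i ord0) (z l ord0) (n i l) => a b [x y] [c d] /=; ring.
Qed.

End matched_filter.

Section white_noise_matched_filter.
Context d (T : measurableType d) (R : realType) (P : probability T R).
Variables (M L : nat) (N : T -> 'M[R[i]]_(M, L)) (v : R).
Hypotheses (mN : measurable_fun setT N) (v_gt0 : 0 < v) (N_law : white_noise P N v).
Local Open Scope ereal_scope.
Implicit Types (s a : R) (u g : 'cV[R[i]]_M) (z : 'cV[R[i]]_L).
Implicit Types (F : 'cV[R[i]]_M -> \bar R).

Lemma measurable_fun_filter (y : 'cV[R[i]]_L) : measurable_fun setT (fun t => N t *m y).
Proof. exact: measurable_fun_mulmx. Qed.

Lemma white_noise_filter z F b : measurable_fun setT F -> (forall u, 0 <= F u) ->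
  \int[P]_t F (b + N t *m matched_filter v z)%R =
  smooth_all (Num.sqrt (sq_norm z / v / 2))%R F b.
Proof.
move=> mF F0; rewrite (white_noise_mulmx mN v_gt0 N_law _ _ mF F0).
rewrite -[(\sum_l _)%R]/(sq_norm (matched_filter v z)) sq_norm_matched_filter.
rewrite -sqrtrM; last by rewrite divr_ge0// ltW.
by congr (smooth_all (Num.sqrt _) F b); field; rewrite gt_eqF.
Qed.

Lemma white_noise_filter_shift z g F : measurable_fun setT F -> (forall u, 0 <= F u) ->
  \int[P]_t F (N t *m matched_filter v z + (sq_norm z / v)%:C *: g)%R =
  \int[P]_t (F (N t *m matched_filter v z) *
    (lik (sq_norm z / v) (N t *m matched_filter v z, g))%:E).
Proof.
move=> mF F0.
have mFy : measurable_fun setT (fun n : 'M[R[i]]_(M, L) => F (n *m matched_filter v z)).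
  by apply: (measurableT_comp mF); exact: measurable_fun_mulmx.
have := white_noise_shift mN v_gt0 N_law (g *m z^T)%R mFy (fun=> F0 _).
under eq_integral do rewrite mulmxDl mulmx_matched_filter.
by under [X in _ = X -> _]eq_integral do rewrite noise_density_matched_filter.
Qed.

Hypothesis L_gt0 : (0 < L)%N.

(** A waveform of energy [s * v] carried by a single sample, which exists as [0 < L]. Filtering the
    one matrix [N] with it realises every noise level [s]. *)
Let wave s : 'cV[R[i]]_L :=
  ((Num.sqrt (s * v))%:C *: delta_mx (Ordinal L_gt0) ord0)%R.

Let sq_norm_wave s : (0 <= s)%R -> (sq_norm (wave s) / v = s)%R.
Proof.
move=> s0; rewrite /sq_norm (bigD1 (Ordinal L_gt0))//= big1 => [|l ll0].
  rewrite !mxE !eqxx addr0 normc_sq /= mulr1 !mul0r mulr0 subr0 addr0.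
  rewrite expr0n addr0 sqr_sqrtr ?mulfK ?gt_eqF//.
  by rewrite mulr_ge0// ltW.
by rewrite !mxE (negbTE ll0) mulr0 Normc.normc0 expr0n.
Qed.

(* the law CN(0, s) on each coordinate *)
Definition filtered_noise (s : R) : probability 'cV[R[i]]_M R :=
  distribution P (mfun_of (measurable_fun_filter (matched_filter v (wave s)))).

Lemma filtered_noise_smooth s F b : (0 <= s)%R ->
  measurable_fun setT F -> (forall u, 0 <= F u) ->
  \int[filtered_noise s]_u F (b + u)%R = smooth_all (Num.sqrt (s / 2))%R F b.
Proof.
move=> s0 mF F0.
have mFb : measurable_fun setT (fun u => F (b + u)%R).
  by apply: (measurableT_comp mF); exact: measurable_fun_addmx.
by rewrite ge0_integral_distribution//= (white_noise_filter _ _ mF F0) sq_norm_wave.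
Qed.

Lemma filtered_noise_shift s g F : (0 < s)%R ->
  measurable_fun setT F -> (forall u, 0 <= F u) ->
  \int[filtered_noise s]_u F (u + s%:C *: g)%R =
  \int[filtered_noise s]_u (F u * (lik s (u, g))%:E).
Proof.
move=> s0 mF F0.
have mFg : measurable_fun setT (fun u => F (u + s%:C *: g)%R).
  by apply: (measurableT_comp mF); exact: measurable_fun_addmx.
have mFl : measurable_fun setT (fun u => F u * (lik s (u, g))%:E).
  apply: emeasurable_funM => //; apply/measurable_EFinP.
  by apply: measurable_fun_pair1; exact: measurable_lik.
rewrite ge0_integral_distribution// ge0_integral_distribution//=; last first.
  by move=> u; rewrite mule_ge0// lee_fin lik_ge0.
have := white_noise_filter_shift (wave s) g mF F0.
by rewrite sq_norm_wave// ltW.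
Qed.

(** Both laws come from the same matrix [N], but they are used as laws only: each integral is a
    convolution, and convolutions compose by [smooth_allD]. *)
Lemma filtered_noise_add s a F : (0 < s)%R -> (0 < a)%R ->
  measurable_fun setT F -> (forall u, 0 <= F u) ->
  \int[filtered_noise s]_u \int[filtered_noise a]_u' F (u + u')%R =
  \int[filtered_noise (s + a)%R]_u F u.
Proof.
move=> s0 a0 mF F0.
have mS : measurable_fun setT (smooth_all (Num.sqrt (a / 2)) F).
  exact: measurable_smooths.
have S0 u : 0 <= smooth_all (Num.sqrt (a / 2)) F u by exact: smooths_ge0.
transitivity (\int[filtered_noise s]_u smooth_all (Num.sqrt (a / 2)) F (0 + u)%R).
  apply: eq_integral => u _; rewrite add0r.
  exact: (filtered_noise_smooth u (ltW a0) mF F0).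
apply: etrans (filtered_noise_smooth 0%R (ltW s0) mS S0) _.
rewrite (smooth_allD (sqrtr_ge0 _) (sqrtr_ge0 _) mF F0).
rewrite !sqr_sqrtr ?divr_ge0 ?ltW// -mulrDl.
apply: etrans (esym (filtered_noise_smooth 0%R (ltW (addr_gt0 s0 a0)) mF F0)) _.
by apply: eq_integral => u _; rewrite add0r.
Qed.

(** The law of [N t *m y] depends on [y] through the moduli of its entries, which are those of
    [- y]. *)
Lemma filtered_noise_opp s F : (0 < s)%R ->
  measurable_fun setT F -> (forall u, 0 <= F u) ->
  \int[filtered_noise s]_u F (- u)%R = \int[filtered_noise s]_u F u.
Proof.
move=> s0 mF F0.
have mFN : measurable_fun setT (fun u => F (- u)%R).
  rewrite (_ : (fun u => _) = F \o (fun u => -1 *: u)%R); last first.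
    by apply/funext => u /=; rewrite scaleN1r.
  by apply: (measurableT_comp mF); exact: measurable_fun_scalemx.
rewrite ge0_integral_distribution// ge0_integral_distribution//=.
move: (matched_filter v _) => y.
transitivity (\int[P]_t F (0 + N t *m (- y))%R).
  by apply: eq_integral => t _; rewrite add0r mulmxN.
apply: etrans (white_noise_mulmx mN v_gt0 N_law _ _ mF F0) _.
transitivity (\int[P]_t F (0 + N t *m y)%R); last first.
  by apply: eq_integral => t _; rewrite add0r.
apply: esym; apply: etrans (white_noise_mulmx mN v_gt0 N_law _ _ mF F0) _.
congr (smooth_all (_ * Num.sqrt _) F _)%R; apply: eq_bigr => l _.
by rewrite !normc_sq mxE; case: (y l ord0) => x x' /=; rewrite !sqrrN.
Qed.

End white_noise_matched_filter.

Section echo_information.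
Context d (T : measurableType d) (R : realType) (P : probability T R).
Variables (M : nat) (g : T -> 'cV[R[i]]_M) (gam : R -> probability 'cV[R[i]]_M R).
Hypothesis mg : measurable_fun setT g.
Local Open Scope ereal_scope.
Notation V := 'cV[R[i]]_M.
Notation G := (distribution P (mfun_of mg)).
Implicit Types (s a : R) (F : V -> \bar R) (u h : V).

Hypothesis gam_smooth : forall s F b, (0 <= s)%R ->
  measurable_fun setT F -> (forall u, 0 <= F u) ->
  \int[gam s]_u F (b + u)%R = smooth_all (Num.sqrt (s / 2))%R F b.
Hypothesis gam_shift : forall s h F, (0 < s)%R ->
  measurable_fun setT F -> (forall u, 0 <= F u) ->
  \int[gam s]_u F (u + s%:C *: h)%R = \int[gam s]_u (F u * (lik s (u, h))%:E).
Hypothesis gam_opp : forall s F, (0 < s)%R ->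
  measurable_fun setT F -> (forall u, 0 <= F u) ->
  \int[gam s]_u F (- u)%R = \int[gam s]_u F u.
Hypothesis gam_add : forall s a F, (0 < s)%R -> (0 < a)%R ->
  measurable_fun setT F -> (forall u, 0 <= F u) ->
  \int[gam s]_u \int[gam a]_u' F (u + u')%R = \int[gam (s + a)%R]_u F u.
Hypothesis g_sq : \int[P]_t (sq_norm (g t))%:E < +oo.

Let G_sq : \int[G]_h (sq_norm h)%:E < +oo.
Proof.
rewrite ge0_integral_distribution//.
- by apply/measurable_EFinP; exact: measurable_fun_sq_norm.
- by move=> h; rewrite lee_fin sq_norm_ge0.
Qed.

(* mutual information, in nats, between [g] and [s g + n] with [n] of law CN(0, s) *)
Definition channel_info s : R :=
  if s == 0%R then 0%R
  else (s * fine (\int[G]_h (sq_norm h)%:E) - mix_entropy gam G s)%R.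

Let channel_info_gt0E s : (0 < s)%R -> channel_info s =
  (s * fine (\int[G]_h (sq_norm h)%:E) - mix_entropy gam G s)%R.
Proof. by move=> s0; rewrite /channel_info gt_eqF. Qed.

Lemma channel_info_ge0 s : (0 <= s)%R -> (0 <= channel_info s)%R.
Proof.
rewrite le_eqVlt => /predU1P[<-|s0]; first by rewrite /channel_info eqxx.
rewrite channel_info_gt0E// subr_ge0.
exact: (mix_entropy_le gam_shift gam_opp G_sq).
Qed.

(** The terms linear in the level cancel in the submodularity of [channel_info], which is therefore
    [mix_entropy_supermodular]. The level [s' = 0] occurs when all the power goes to
    communications. *)
Lemma channel_info_scale t s s' : (0 <= t <= 1)%R -> (0 < s)%R -> (0 <= s')%R ->
  (t * s' <= s)%R -> (t * channel_info s' <= channel_info s)%R.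
Proof.
move=> t01 s0; rewrite le_eqVlt => /predU1P[<-|s'0] tss'.
  by rewrite {1}/channel_info eqxx mulr0 channel_info_ge0// ltW.
apply: concave_scale => // [r r0|r a b r0 a0 b0].
  by apply: channel_info_ge0; exact: ltW.
rewrite !channel_info_gt0E ?addr_gt0//.
have := mix_entropy_supermodular gam_shift gam_add G_sq r0 a0 b0.
lra.
Qed.

Variables (L : nat) (N : T -> 'M[R[i]]_(M, L)) (v : R) (z : 'cV[R[i]]_L).
Hypotheses (mN : measurable_fun setT N) (v_gt0 : (0 < v)%R)
  (N_law : white_noise P N v) (gN : independent_pair P g N).

Let s := (sq_norm z / v)%R.
Let y := matched_filter v z.
Let nu := distribution P (mfun_of mN).
Let rho (w : 'M[R[i]]_(M, L) * V) : R := lik s (w.1 *m y, w.2).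

Let s_ge0 : (0 <= s)%R. Proof. by rewrite divr_ge0 ?sq_norm_ge0// ltW. Qed.

Let mfilter : measurable_fun setT (fun w : 'M[R[i]]_(M, L) * V => (w.1 *m y, w.2)).
Proof.
apply: measurable_fun_pair; last exact: measurable_snd.
by apply: measurable_fun_mulmx => //; exact: measurable_fst.
Qed.

Let mrho : measurable_fun setT rho.
Proof. exact: (measurableT_comp (measurable_lik s) mfilter). Qed.

Let rho_ge0 w : 0 <= (rho w)%:E. Proof. by rewrite lee_fin lik_ge0. Qed.

Let int_nu (F : 'M[R[i]]_(M, L) -> \bar R) : measurable_fun setT F ->
  (forall n, 0 <= F n) -> \int[nu]_n F n = \int[P]_t F (N t).
Proof. by move=> mF F0; rewrite ge0_integral_distribution. Qed.

Let rho_shift h (F : 'M[R[i]]_(M, L) -> \bar R) :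
  measurable_fun setT F -> (forall n, 0 <= F n) ->
  \int[P]_t F (h *m z^T + N t)%R = \int[P]_t (F (N t) * (rho (N t, h))%:E).
Proof.
move=> mF F0.
transitivity (\int[P]_t F (N t + h *m z^T)%R).
  by apply: eq_integral => t _; rewrite addrC.
apply: etrans (white_noise_shift mN v_gt0 N_law _ mF F0) _.
by apply: eq_integral => t _; rewrite noise_density_matched_filter.
Qed.

Let rho_dens h : \int[nu]_n (rho (n, h))%:E = 1.
Proof.
rewrite int_nu; last 2 first.
- by apply/measurable_EFinP; exact: measurable_fun_pair1.
- by move=> n; exact: rho_ge0.
rewrite -[RHS](integral_probability_cst P).
apply: esym; apply: etrans (rho_shift h (measurable_cst (1 : \bar R)) (fun=> lee01)) _.
by apply: eq_integral => t _; rewrite mul1e.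
Qed.

Variable J : probability ('M[R[i]]_(M, L) * V)%type R.
Hypothesis J_law : forall A, measurable A ->
  J A = P ((fun t => (g t *m z^T + N t, g t)%R) @^-1` A).

(** Given [g], the echo is white noise shifted by the signal, so its density with respect to the law
    of the noise is [rho]. *)
Let J_dens : same_law J (nu \x G) idfun (cst 1%R) idfun rho.
Proof.
move=> f mf f0 /=.
have mW : measurable_fun setT
    (fun w : V * 'M[R[i]]_(M, L) => (w.1 *m z^T + w.2, w.1)%R).
  apply: measurable_fun_pair => //; apply: measurable_fun_addmx => //.
  by apply: measurable_fun_mulmx => //; exact: measurable_cst.
have mWt := measurableT_comp mW (measurable_fun_pair mg mN).
have mfr : measurable_fun setT (fun w => f w * (rho w)%:E).
  by apply: emeasurable_funM => //; exact/measurable_EFinP.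
have fr0 w : 0 <= f w * (rho w)%:E by rewrite mule_ge0.
transitivity (\int[distribution P (mfun_of mWt)]_w f w).
  rewrite (eq_measure_integral (distribution P (mfun_of mWt))); last first.
    by move=> A mA _; exact: J_law.
  by apply: eq_integral => w _; rewrite mule1.
rewrite ge0_integral_distribution//=.
have := ge0_integral_independent_pair mg mN gN (measurableT_comp mf mW) (fun=> f0 _).
move=> /= ->.
rewrite (@fubini_tonelli2 _ _ _ _ _ _ _ _ mfr)//.
rewrite ge0_integral_distribution//; last 2 first.
- exact: (@measurable_fun_fubini_tonelli_G _ _ _ _ _ nu _ mfr).
- by move=> h; exact: integral_ge0.
apply: eq_integral => t _ /=.
have mft : measurable_fun setT (fun n : 'M[R[i]]_(M, L) => f (n, g t)).
  exact: measurable_fun_pair1.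
rewrite (rho_shift (g t) mft (fun=> f0 _)) /fubini_G int_nu//.
exact: (measurable_fun_pair1 (g t) mfr).
Qed.

(** The weight [rho] depends on the noise matrix only through the filter, and filtered noise has law
    [gam s]: both are compared through the same convolution. *)
Let filtered_law : (0 < s)%R ->
  same_law (nu \x G) (gam s \x G) (fun w => (w.1 *m y, w.2)) rho idfun (lik s).
Proof.
move=> s0 f mf f0.
have mfl : measurable_fun setT (fun w : V * V => f w * (lik s w)%:E).
  by apply: emeasurable_funM => //; apply/measurable_EFinP; exact: measurable_lik.
have fl0 w : 0 <= f w * (lik s w)%:E by rewrite mule_ge0// lee_fin lik_ge0.
have mfr : measurable_fun setT (fun w : 'M[R[i]]_(M, L) * V =>
    f (w.1 *m y, w.2) * (rho w)%:E).
  exact: (measurableT_comp mfl mfilter).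
have fr0 (w : 'M[R[i]]_(M, L) * V) : 0 <= f (w.1 *m y, w.2) * (rho w)%:E by exact: fl0.
rewrite (@fubini_tonelli2 _ _ _ _ _ _ _ _ mfr)//.
rewrite (@fubini_tonelli2 _ _ _ _ _ _ _ _ mfl)//.
apply: eq_integral => h _; rewrite /fubini_G.
have mflh : measurable_fun setT (fun u : V => f (u, h) * (lik s (u, h))%:E).
  exact: (measurable_fun_pair1 h mfl).
rewrite int_nu; [|exact: (measurable_fun_pair1 h mfr)|by move=> n; exact: fr0].
have := white_noise_filter mN v_gt0 N_law z 0%R mflh (fun=> fl0 _).
rewrite -(gam_smooth 0%R s_ge0 mflh (fun=> fl0 _)) => h1.
transitivity (\int[P]_t (f (0 + N t *m y, h)%R * (lik s (0 + N t *m y, h)%R)%:E)).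
  by apply: eq_integral => t _; rewrite add0r.
by rewrite [LHS]h1; apply: eq_integral => u _; rewrite add0r.
Qed.

Lemma echo_mutual_info : mutual_info J = (channel_info s / ln 2)%:E.
Proof.
(* A waveform of zero energy has a zero filter, so that [rho] is constantly 1 and echo and target
   are independent. *)
rewrite /channel_info; case: ifPn => [/eqP s0|sN0].
  have y0 : y = 0%R.
    have zv0 : sq_norm z = 0%R.
      by move/eqP: s0; rewrite /s mulf_eq0 invr_eq0 (gt_eqF v_gt0) orbF => /eqP.
    apply/matrixP => l j; rewrite !mxE !ord1.
    have /eqP : (Normc.normc (z l ord0) ^+ 2 = 0)%R.
      apply/eqP; move/eqP: zv0.
      rewrite psumr_eq0 => [/allP /(_ l)|k _]; last exact: sqr_ge0.
      by rewrite mem_index_enum => /(_ isT).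
    by rewrite sqrf_eq0 => /eqP /Normc.eq0_normc ->; rewrite conjc0 mulr0.
  have rho1 w : rho w = 1%R.
    rewrite /rho y0 mulmx0 /lik s0 mul0r subr0 /re_dot big1 ?mulr0 ?expR0// => m _.
    by rewrite mxE mulr0.
  rewrite (mutual_info_density mrho _ (q := cst 1%R) _ _ rho_dens _ J_dens)//=.
  - rewrite mul0r integral0_eq// => w _.
    by rewrite rho1 divr1 /log2 ln1 mul0r mul0e.
  - by move=> w; exact: lik_gt0.
  - move=> n; rewrite -[RHS](integral_probability_cst G).
    by apply: eq_integral => h _; rewrite rho1.
have s0 : (0 < s)%R by rewrite lt_neqAle eq_sym sN0.
have mratio : measurable_fun setT
    (fun w : V * V => (ln (lik s w / mix G s w.1))%:E : \bar R).
  apply/measurable_EFinP; apply: measurableT_comp => //.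
  apply: measurable_funM; first exact: measurable_lik.
  apply: (measurable_fun_inv_gt0 (f := fun w : V * V => mix G s w.1)).
    by move=> w; exact: mix_gt0.
  exact: (measurableT_comp (measurable_mix G s) measurable_fst).
have mq : measurable_fun setT (fun n : 'M[R[i]]_(M, L) => mix G s (n *m y)).
  by apply: (measurableT_comp (measurable_mix G s)); exact: measurable_fun_mulmx.
have := @mutual_info_density _ _ _ _ _ nu G rho _ mrho (fun=> lik_gt0 _ _) mq
  (fun=> mix_gt0 _ _ s0) rho_dens (fun n => esym (mixE G (n *m y) s0)) J J_dens.
move=> ->.
pose f (w : V * V) : \bar R := (ln (lik s w / mix G s w.1))%:E.
(* Apart from the factor [1 / ln 2] that converts nats to bits, the logarithm is a function of the
   filtered echo and [g], to which [filtered_law] applies. *)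
transitivity (\int[nu \x G]_w ((ln 2)^-1%:E * (f (w.1 *m y, w.2) * (rho w)%:E))).
  apply: eq_integral => w _; rewrite /log2 /f/= -!EFinM; congr EFin.
  by rewrite /rho; ring.
have mlikr := measurable_lik s.
have law := same_law_integral (fun=> lik_ge0 _ _) (lik_ge0 s) (filtered_law s0).
have f_int : (nu \x G).-integrable setT (fun w => f (w.1 *m y, w.2) * (rho w)%:E).
  apply: (same_law_integrable (fun=> lik_ge0 _ _) (lik_ge0 s) (filtered_law s0)
    mfilter mrho mratio).
  exact: (channel_information_integrable gam_shift G_sq s0).
rewrite (integralZl measurableT f_int) (law _ mratio).
rewrite (channel_information gam_shift gam_opp G_sq s0) -EFinM; congr EFin.
by rewrite mulrC.
Qed.

End echo_information.

Section echo_rate.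
Context d (T : measurableType d) (R : realType) (P : probability T R).
Variables (M L : nat) (g : T -> 'cV[R[i]]_M) (gam : R -> probability 'cV[R[i]]_M R).
Hypothesis mg : measurable_fun setT g.
Local Open Scope ereal_scope.
Implicit Types (s : R) (F : 'cV[R[i]]_M -> \bar R) (u h : 'cV[R[i]]_M).

Hypothesis gam_smooth : forall s F b, (0 <= s)%R ->
  measurable_fun setT F -> (forall u, 0 <= F u) ->
  \int[gam s]_u F (b + u)%R = smooth_all (Num.sqrt (s / 2))%R F b.
Hypothesis gam_shift : forall s h F, (0 < s)%R ->
  measurable_fun setT F -> (forall u, 0 <= F u) ->
  \int[gam s]_u F (u + s%:C *: h)%R = \int[gam s]_u (F u * (lik s (u, h))%:E).
Hypothesis gam_opp : forall s F, (0 < s)%R ->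
  measurable_fun setT F -> (forall u, 0 <= F u) ->
  \int[gam s]_u F (- u)%R = \int[gam s]_u F u.
Hypothesis g_sq : \int[P]_t (sq_norm (g t))%:E < +oo.

Variables (x : T -> 'cV[R[i]]_L) (N : T -> 'M[R[i]]_(M, L)) (v s : R).
Hypotheses (mx : measurable_fun setT x) (mN : measurable_fun setT N).
Hypotheses (v_gt0 : (0 < v)%R) (N_law : white_noise P N v)
  (indep : echo_independent P g x N).
Hypotheses (s_ge0 : (0 <= s)%R) (x_power : forall t, (sq_norm (x t) / v)%R = s).

Let h (w : 'cV[R[i]]_L * ('cV[R[i]]_M * 'M[R[i]]_(M, L))) :=
  (w.2.1 *m w.1^T + w.2.2, w.2.1)%R.

Let mh : measurable_fun setT h.
Proof.
have m2 : measurable_fun setT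
    (fun w : 'cV[R[i]]_L * ('cV[R[i]]_M * 'M[R[i]]_(M, L)) => w.2.1).
  exact: (measurableT_comp measurable_fst measurable_snd).
apply: measurable_fun_pair => //; apply: measurable_fun_addmx.
  by apply: measurable_fun_mulmx => //; exact: measurable_fun_trmx.
exact: (measurableT_comp measurable_snd measurable_snd).
Qed.

(** Given [x], target and noise keep their laws, and the information depends on the waveform through
    its energy alone, which is the same for all outcomes. *)
Lemma echo_cond_mutual_info : cond_mutual_info P (echo g x N) g x =
  (channel_info P gam mg s / ln 2)%:E.
Proof.
have ln2 : (0 < ln (2 : R))%R by rewrite ln_gt0// ltr1n.
have I0 : (0 <= channel_info P gam mg s / ln 2)%R.
  apply: divr_ge0; last exact: ltW.
  exact: (channel_info_ge0 mg gam_shift gam_opp g_sq s_ge0).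
have mgN := measurable_fun_pair mg mN.
have x_gN := independent_pair_first mx mg mN indep.
have gN := independent_pair_last indep.
have law := conditional_law_independent mx mgN mh x_gN.
apply: (cond_mutual_info_const mx I0 law) => t J Jk.
rewrite -(x_power t).
exact: (echo_mutual_info mg gam_smooth gam_shift gam_opp g_sq mN v_gt0 N_law gN).
Qed.

End echo_rate.

(** * Second moments and waveforms *)

Section second_moments.
Context d (T : measurableType d) (R : realType) (P : probability T R).
Local Open Scope ereal_scope.

(** A zero variance gives a Dirac mass; otherwise exponential moments dominate the square. *)
Lemma normal_law_sq (X : T -> R) (v : R) : measurable_fun setT X -> (0 <= v)%R ->
  normal_law P X v -> \int[P]_t (X t ^+ 2)%:E < +oo.
Proof.
move=> mX; have msq : measurable_fun setT (fun y : R => (y ^+ 2)%:E).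
  by apply/measurable_EFinP; exact: measurable_funX.
have sq0 (y : R) : 0 <= (y ^+ 2)%:E by rewrite lee_fin sqr_ge0.
rewrite le_eqVlt => /predU1P[<-|v0] X_law.
  rewrite [ltLHS](_ : _ = \int[distribution P (mfun_of (U := measurableTypeR R) mX)]_y
      (y ^+ 2)%:E); last by rewrite ge0_integral_distribution.
  rewrite (eq_measure_integral (\d_(0%R : measurableTypeR R))); last first.
    by move=> A mA _; have := X_law A mA; rewrite eqxx.
  by rewrite integral_dirac// diracT mul1e expr0n ltry.
rewrite (ge0_integral_normal_law mX v0 X_law msq sq0).
pose c := Num.sqrt v.
have mexp (h : R) : measurable_fun setT
    (fun y : measurableTypeR R => (expR (2 * (h * y)))%:E : \bar R).
  apply/measurable_EFinP; apply: measurableT_comp => //.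
  by do 2 apply: measurable_funM => //.
have exp0 (h y : R) : 0 <= (expR (2 * (h * y)))%:E by rewrite lee_fin expR_ge0.
have exp_lty (h : R) : \int[normal_prob 0 1]_y (expR (2 * (h * y)))%:E < +oo.
  (* Shifting the constant function 1 by [2 * h] yields the exponential moment
     [expR ((2 * h) ^+ 2 / 2)]. *)
  have h1 := gauss_shift (2 * h) (measurable_cst (1 : \bar R)) (fun=> lee01).
  rewrite (_ : \int[_]_y _ = (expR ((2 * h) ^+ 2 / 2))%:E *
     \int[normal_prob 0 1]_y (1 * (expR (2 * h * y - (2 * h) ^+ 2 / 2))%:E)).
    by rewrite -h1 integral_probability_cst mule1 ltry.
  rewrite -ge0_integralZl//.
  - by apply: eq_integral => y _; rewrite mul1e -EFinM -expRD mulrA addrC subrK.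
  - under eq_fun do rewrite mul1e.
    apply/measurable_EFinP; apply: measurableT_comp => //.
    by apply: measurable_funB => //; exact: measurable_funM.
apply: (@le_lt_trans _ _ (\int[normal_prob 0 1]_y
    ((expR (2 * (c * y)))%:E + (expR (2 * (- c * y)))%:E))).
  apply: ge0_le_integral => //.
  - by apply: (measurableT_comp msq); exact: measurable_funM.
  - by apply: emeasurable_funD; exact: mexp.
  - by move=> y _; rewrite -EFinD lee_fin mulNr; exact: sqr_le_expR.
rewrite (ge0_integralD _ measurableT _ (mexp c) _ (mexp (- c)%R)).
- exact: lte_add_pinfty.
- by move=> y _; exact: exp0.
- by move=> y _; exact: exp0.
Qed.

Lemma complex_normal_law_sq (Z : T -> R[i]) (v : R) : measurable_fun setT Z ->
  (0 <= v)%R -> complex_normal_law P Z v ->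
  \int[P]_t (Normc.normc (Z t) ^+ 2)%:E < +oo.
Proof.
move=> mZ v0 [Re_law Im_law _]; have v20 : (0 <= v / 2)%R by rewrite divr_ge0.
have mRe := measurable_fun_Re mZ; have mIm := measurable_fun_Im mZ.
under eq_integral do rewrite normc_sq EFinD.
rewrite ge0_integralD//; first last.
- by apply/measurable_EFinP; exact: measurable_funX.
- by move=> t _; rewrite lee_fin sqr_ge0.
- by apply/measurable_EFinP; exact: measurable_funX.
- by move=> t _; rewrite lee_fin sqr_ge0.
rewrite lte_add_pinfty//; [exact: normal_law_sq Re_law|exact: normal_law_sq Im_law].
Qed.

Variables (M K : nat) (a : 'I_K -> 'cV[R[i]]_M) (beta : 'I_K -> T -> R[i]).
Hypothesis mbeta : forall k, measurable_fun setT (beta k).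

Let partial (r : seq 'I_K) t : 'cV[R[i]]_M := (\sum_(k <- r) beta k t *: a k)%R.

Let measurable_partial r : measurable_fun setT (partial r).
Proof.
rewrite /partial; elim: r => [|k r IH].
  by under eq_fun do rewrite big_nil; exact: measurable_cst.
under eq_fun do rewrite big_cons; apply: measurable_fun_addmx => //.
exact: measurable_fun_scalemx.
Qed.

Lemma measurable_target_response : measurable_fun setT (target_response a beta).
Proof. exact: measurable_partial. Qed.

Let sq_normD (u w : 'cV[R[i]]_M) : (sq_norm (u + w) <= 2 * sq_norm u + 2 * sq_norm w)%R.
Proof. by have := sq_norm_shift 1 w u; rewrite scale1r expr1n mulr1. Qed.

Let sq_normZ (c : R[i]) (u : 'cV[R[i]]_M) :
  sq_norm (c *: u)%R = (Normc.normc c ^+ 2 * sq_norm u)%R.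
Proof.
rewrite /sq_norm mulr_sumr; apply: eq_bigr => m _.
by rewrite mxE Normc.normcM exprMn.
Qed.

(** Induction on the targets with [|u + w|^2 <= 2 |u|^2 + 2 |w|^2], which avoids the cross terms
    between coefficients. *)
Lemma target_response_sq :
  (forall k, \int[P]_t (Normc.normc (beta k t) ^+ 2)%:E < +oo) ->
  \int[P]_t (sq_norm (target_response a beta t))%:E < +oo.
Proof.
move=> beta_sq.
rewrite -[X in \int[_]_t (sq_norm (X t))%:E]/(partial (index_enum 'I_K)).
have sq_partial r : measurable_fun setT (fun t => (sq_norm (partial r t))%:E).
  by apply/measurable_EFinP; exact: measurable_fun_sq_norm.
have sq0 (u : 'cV[R[i]]_M) : 0 <= (sq_norm u)%:E by rewrite lee_fin sq_norm_ge0.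
elim: (index_enum _) => [|k r IH].
  rewrite integral0_eq ?ltry// => t _; rewrite /partial big_nil /sq_norm big1// => m _.
  by rewrite mxE Normc.normc0 expr0n.
have mk : measurable_fun setT (fun t => (Normc.normc (beta k t) ^+ 2)%:E : \bar R).
  apply/measurable_EFinP; apply: measurable_funX; exact: measurable_fun_normc.
apply: (@le_lt_trans _ _ (\int[P]_t ((2 * sq_norm (a k))%:E *
    (Normc.normc (beta k t) ^+ 2)%:E + 2%:E * (sq_norm (partial r t))%:E))).
  apply: ge0_le_integral => //.
  - apply: emeasurable_funD; exact: emeasurable_funM.
  - move=> t _; rewrite /partial big_cons -!EFinM -EFinD lee_fin.
    by rewrite -mulrA (mulrC (sq_norm (a k))) -sq_normZ; exact: sq_normD.
rewrite ge0_integralD//; first last.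
- exact: emeasurable_funM.
- by move=> t _; rewrite mule_ge0.
- exact: emeasurable_funM.
- move=> t _; apply: mule_ge0; rewrite lee_fin ?sqr_ge0//.
  by rewrite mulr_ge0 ?sq_norm_ge0.
have c0 : 0 <= (2 * sq_norm (a k))%:E by rewrite lee_fin mulr_ge0 ?sq_norm_ge0.
have n0 t : 0 <= (Normc.normc (beta k t) ^+ 2)%:E by rewrite lee_fin sqr_ge0.
rewrite (ge0_integralZl _ measurableT mk (fun t _ => n0 t) c0).
rewrite (ge0_integralZl _ measurableT (sq_partial r) (fun t _ => sq0 _) (lee0n 2)).
apply: lte_add_pinfty; apply: lte_mul_pinfty => //.
Qed.

End second_moments.

Section waveform_power.
Context {R : realType} (L : nat).
Implicit Types (x : 'cV[R[i]]_L).

Lemma conj_tr_mul (m n k : nat) (A : 'M[R[i]]_(m, n)) (B : 'M[R[i]]_(n, k)) :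
  conj_tr (A *m B) = conj_tr B *m conj_tr A.
Proof. by rewrite /conj_tr trmx_mul map_mxM. Qed.

Lemma sq_norm_conj_tr x c : conj_tr x *m x = (c%:C)%:M -> sq_norm x = c.
Proof.
move=> /matrixP /(_ ord0 ord0); rewrite !mxE mulr1n => xc.
apply: complexI; rewrite -xc /sq_norm realC_sum.
by apply: eq_bigr => l _; rewrite !mxE mulrC mulr_conjc.
Qed.

Lemma sq_norm_trmx (y : 'rV[R[i]]_L) c : y *m conj_tr y = (c%:C)%:M -> sq_norm y^T = c.
Proof.
move=> /matrixP /(_ ord0 ord0); rewrite !mxE mulr1n => yc.
apply: complexI; rewrite -yc /sq_norm realC_sum.
by apply: eq_bigr => l _; rewrite !mxE mulr_conjc.
Qed.

Lemma sq_norm_isac_waveform d (T : measurableType d) (p aN aF : R)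
    (S : T -> 'M[R[i]]_(2, L)) (t : T) :
  0 <= p -> 0 <= aN -> 0 <= aF -> aN + aF = 1 ->
  S t *m conj_tr (S t) = (L%:R)%:M ->
  sq_norm (isac_waveform p aN aF S t) = p * L%:R.
Proof.
move=> p0 aN0 aF0 aNF SS; apply: sq_norm_trmx.
rewrite scalemxAl conj_tr_mul mulmxA -(mulmxA _ (S t)) SS mul_mx_scalar.
apply/matrixP => i j; rewrite !mxE !ord1 mulr1n /=.
rewrite !big_ord_recl big_ord0 !mxE /= addr0.
have bc : Num.sqrt aN ^+ 2 + Num.sqrt aF ^+ 2 = 1 by rewrite !sqr_sqrtr.
have -> : p * L%:R = Num.sqrt p ^+ 2 * (Num.sqrt aN ^+ 2 + Num.sqrt aF ^+ 2) * L%:R.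
  by rewrite bc sqr_sqrtr// mulr1.
rewrite -(rmorph_nat (real_complex R)).
by apply/eqP; rewrite eq_complex /=; apply/andP; split; apply/eqP; ring.
Qed.

End waveform_power.

(** * Comparison of the two regions *)

Theorem theorem4
  (R : realType) (d : measure_display) (T : measurableType d)
  (P : probability T R)
  (p vc vs aN aF : R) (M L : nat)
  (p_gt0 : 0 < p) (M_ge1 : (1 <= M)%N) (L_ge1 : (1 <= L)%N)
  (vc_gt0 : 0 < vc) (vs_gt0 : 0 < vs)
  (aN_gt0 : 0 < aN) (aF_gt0 : 0 < aF) (aNF : aN + aF = 1) (aN_lt_aF : aN < aF)
  (rho1 rho2 : R) (rho1_gt0 : 0 < rho1) (rho2_gt0 : 0 < rho2)
  (h1 h2 : {RV P >-> R[i]})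
  (h1_law : complex_normal_law P h1 rho1)
  (h2_law : complex_normal_law P h2 rho2)
  (h_indep : mutually_independent P (tnth [tuple sigma_of h1; sigma_of h2]))
  (K : nat) (a : 'I_K -> 'cV[R[i]]_M) (s : 'I_K -> R)
  (beta : 'I_K -> {RV P >-> R[i]})
  (beta_law : forall k, complex_normal_law P (beta k) (s k ^+ 2))
  (beta_indep : mutually_independent P (fun k => sigma_of (beta k)))
  (S : {RV P >-> 'M[R[i]]_(2, L)}) (Ni : {RV P >-> 'M[R[i]]_(M, L)})
  (S_orth : forall t, S t *m conj_tr (S t) = (L%:R)%:M)
  (Ni_law : white_noise P Ni vs)
  (i_indep : echo_independent P (target_response a beta)
               (isac_waveform p aN aF S) Ni)
  (xf : R -> R -> {RV P >-> 'cV[R[i]]_L})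
  (Nf : R -> R -> {RV P >-> 'M[R[i]]_(M, L)})
  (xf_power : forall kappa mu : R, 0 <= kappa <= 1 -> 0 <= mu <= 1 ->
     forall t, conj_tr (xf kappa mu t) *m xf kappa mu t =
               (((1 - mu) * p * L%:R)%:C)%:M)
  (Nf_law : forall kappa mu : R, 0 <= kappa <= 1 -> 0 <= mu <= 1 ->
     white_noise P (Nf kappa mu) ((1 - kappa) * vs))
  (f_indep : forall kappa mu : R, 0 <= kappa <= 1 -> 0 <= mu <= 1 ->
     echo_independent P (target_response a beta) (xf kappa mu) (Nf kappa mu)) :
  fdsac_region P p vc aN aF h1 h2 (target_response a beta) xf Nf
    `<=` isac_region P p vc aN aF h1 h2 (target_response a beta) S Ni.
Proof.
move=> r [kappa [mu [k01 m01 [r1_ge0 r1_le r2_ge0 r2_le]]]].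
split=> //; last first.
  apply: le_trans r2_le _.
  exact: (comm_rate_le h1 h2 p_gt0 vc_gt0 aN_gt0 aF_gt0).
apply: le_trans r1_le _.
have mbeta k : measurable_fun setT (beta k) by exact: measurable_funPT.
have mg := measurable_target_response a mbeta.
have g_sq : (\int[P]_t (sq_norm (target_response a beta t))%:E < +oo)%E.
  apply: target_response_sq => // k.
  exact: complex_normal_law_sq (mbeta k) (sqr_ge0 _) (beta_law k).
have mN : measurable_fun setT Ni by exact: measurable_funPT.
(* Levels of the FDSAC system are also expressed in this family, built from the ISAC noise: the
   information of an echo depends only on the ratio of waveform energy to noise variance. *)
pose gam := filtered_noise P vs mN L_ge1.
have smooth_gam := filtered_noise_smooth mN vs_gt0 Ni_law L_ge1.
have shift_gam := filtered_noise_shift mN vs_gt0 Ni_law L_ge1.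
have add_gam := filtered_noise_add mN vs_gt0 Ni_law L_ge1.
have opp_gam := filtered_noise_opp mN vs_gt0 Ni_law L_ge1.
pose info := channel_info P gam mg.
have Lp : 0 < L%:R :> R by rewrite ltr0n.
have ln2 : 0 < ln 2 :> R by rewrite ln_gt0// ltr1n.
have si_gt0 : 0 < p * L%:R / vs by rewrite divr_gt0// mulr_gt0.
have isacE : isac_sensing_rate P (target_response a beta)
    (isac_waveform p aN aF S) Ni = (L%:R^-1 * (info (p * L%:R / vs) / ln 2))%:E.
  rewrite EFinM; congr (_ * _)%E.
  apply: (echo_cond_mutual_info mg smooth_gam shift_gam opp_gam g_sq _ mN vs_gt0
    Ni_law i_indep (ltW si_gt0)).
    apply: measurable_fun_trmx; apply: measurable_fun_scalemx => //.
    by apply: measurable_fun_mulmx => //; exact: measurable_funPT.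
  by move=> t; rewrite sq_norm_isac_waveform// ltW.
have info_ge0 := channel_info_ge0 mg shift_gam opp_gam g_sq (ltW si_gt0).
(* At [kappa = 1] the sensing rate is 0 by convention; for smaller [kappa] the noise variance is
   positive and the channel formula applies. *)
rewrite isacE /fdsac_sensing_rate; case: ifPn => [_|k1].
  by rewrite lee_fin mulr_ge0 ?invr_ge0 ?divr_ge0// ltW.
have [k0 k_le1] := andP k01; have [m0 m_le1] := andP m01.
have k_lt1 : kappa < 1 by rewrite lt_neqAle k1.
have v_gt0 : 0 < (1 - kappa) * vs by rewrite mulr_gt0// subr_gt0.
pose sf := (1 - mu) * p * L%:R / ((1 - kappa) * vs).
have sf_ge0 : 0 <= sf.
  by rewrite divr_ge0 ?(ltW v_gt0)// !mulr_ge0 ?(ltW p_gt0)// subr_ge0.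
have -> : cond_mutual_info P (echo (target_response a beta) (xf kappa mu) (Nf kappa mu))
    (target_response a beta) (xf kappa mu) = (info sf / ln 2)%:E.
  have mx : measurable_fun setT (xf kappa mu) by exact: measurable_funPT.
  have mNf : measurable_fun setT (Nf kappa mu) by exact: measurable_funPT.
  apply: (echo_cond_mutual_info mg smooth_gam shift_gam opp_gam g_sq mx mNf v_gt0
    (Nf_law _ _ k01 m01) (f_indep _ _ k01 m01) sf_ge0) => t.
  by rewrite (sq_norm_conj_tr (xf_power _ _ k01 m01 t)).
rewrite -EFinM lee_fin.
have t01 : 0 <= 1 - kappa <= 1 by rewrite subr_ge0 k_le1 gerBl.
have le_s : (1 - kappa) * sf <= p * L%:R / vs.
  (* The bandwidth fraction cancels between the rate and the noise variance, leaving the fraction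
     [1 - mu] of the ISAC level. *)
  have -> : (1 - kappa) * sf = (1 - mu) * (p * L%:R / vs).
    by rewrite /sf; field; rewrite !gt_eqF// subr_gt0.
  by rewrite ler_piMl ?(ltW si_gt0)// gerBl.
have := channel_info_scale mg shift_gam opp_gam add_gam g_sq t01 si_gt0 sf_ge0 le_s.
have c_ge0 : 0 <= (L%:R * ln 2)^-1 :> R by rewrite invr_ge0 ltW// mulr_gt0.
move=> /(ler_wpM2r c_ge0).
by congr (_ <= _); rewrite /info; field; rewrite !gt_eqF.
Qed.
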